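(* Let $0<\alpha<1/2$ and let $\{X_n\}_{n\ge 1}$ be independent $\{0,1\}$-valued random variables on a probability space $\Omega$ with expectations $\mathbb{E}X_n=\sigma_n=n^{-\alpha}$; let $a_n(\omega)$ be the associated counting function. Let $\mathcal{B}$ be an approximable set of functions $b:\mathbb{N}\to\mathbb{C}$ bounded in magnitude by $1$. Then, for almost every $\omega\in\Omega$, the following holds: for every measure-preserving system $(X,\mu,T)$ and every $f\in L^1(X)$ orthogonal to the invariant factor, \[ \sup_{b\in\mathcal{B}}\Big|\frac1N\sum_{n\le N} b(n)\,T^{a_n(\omega)}f\Big|\longrightarrow 0\quad\text{as } N\to\infty \] $\mu$-almost everywhere.
   Context: $\mathbb{N}=\{1,2,3,\dots\}$. The counting function $a_n(\omega)$ is the smallest integer such that $X_1(\omega)+\dots+X_{a_n(\omega)}(\omega)=n$. A measure-preserving system $(X,\mu,T)$ is a probability space $(X,\mu)$ with a measure-preserving transformation $T:X\to X$; $T^nf:=f\circ T^n$. A function $f\in L^1(X)$ is orthogonal to the invariant factor if its conditional expectation with respect to the $\sigma$-algebra of $T$-invariant sets is zero $\mu$-a.e. Approximable: a collection $\mathcal{B}$ of functions $b:\mathbb{N}\to\mathbb{C}$ is approximable if for every $\delta>0$ there exists $\kappa=\kappa(\delta)>0$, together with constants $C_\delta$ (depending only on $\delta$) and $C_\kappa=C_{\kappa(\delta)}$, such that for every sufficiently large integer $N$ there is a finite subset $\mathcal{B}_N\subset\mathcal{B}$ with: (i) $|\mathcal{B}_N|\le C_\delta e^{N^\delta}$; (ii)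 for every $b\in\mathcal{B}$ there is $b_0\in\mathcal{B}_N$ with $\sup_{t\le N}|b(t)-b_0(t)|\le C_\kappa N^{-\kappa}$ (the supremum over $t\in\mathbb{N}$, $t\le N$). The exceptional null set of $\omega$ does not depend on the measure-preserving system or on $f$. *)

(* Defs.v *)
From HB Require Import structures.
From mathcomp Require Import all_boot all_order all_algebra.
From mathcomp Require Import finmap.
From mathcomp Require Import all_classical all_reals all_analysis.
From mathcomp Require Import complex.

Set Implicit Arguments.
Unset Strict Implicit.
Unset Printing Implicit Defensive.

Import Order.TTheory GRing.Theory Num.Theory.
Import numFieldNormedType.Exports.

Local Open Scope classical_set_scope.
Local Open Scope ring_scope.

(* Sequences indexed by {1, 2, 3, ...} are encoded as functions on [nat] whose
   value at 0 is ignored: every condition and every sum below ranges over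
   positive indices only. *)

Section modulus.
Context {R : rcfType}.

(* Real-valued modulus on R[i]; the library norm takes its values in R[i]. *)
Definition modulus (z : R[i]) : R := Normc.normc z.

End modulus.

Section random.
Context {R : realType} {d : measure_display} {Omega : measurableType d}.

Definition mutually_independent (P : probability Omega R) (I : set nat)
    (X : nat -> {RV P >-> R}) : Prop :=
  forall (J : {fset nat}) (A : nat -> set R),
    [set` J] `<=` I ->
    (forall j, j \in J -> measurable (A j)) ->
    (P (\bigcap_(j in [set` J]) (X j @^-1` A j)) =
       \prod_(j <- J) P (X j @^-1` A j))%E.

(* The default 0 is only taken when no partial sum of X_1(w), X_2(w), ...
   equals n. *)
Definition counting_function (P : probability Omega R)
    (X : nat -> {RV P >-> R}) (w : Omega) (n : nat) : nat :=
  xget 0%N [set m | \sum_(1 <= i < m.+1) X i w = n%:R /\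
    forall k, \sum_(1 <= i < k.+1) X i w = n%:R -> (m <= k)%N].

End random.

Section approximable.
Context {R : realType}.

Definition approximable (B : set (nat -> R[i])) : Prop :=
  forall delta : R, 0 < delta ->
  exists kappa : R, 0 < kappa /\
  exists Cdelta Ckappa : R,
  \forall N \near \oo, exists BN : {fset (nat -> R[i])},
    [/\ [set` BN] `<=` B,
        #|` BN|%:R <= Cdelta * expR (N%:R `^ delta) &
        forall b, B b -> exists b0, b0 \in BN /\
          \big[Num.max/0]_(1 <= t < N.+1) modulus (b t - b0 t)
            <= Ckappa * N%:R `^ (- kappa)].

End approximable.

Section dynamics.
Context {R : realType} {d : measure_display} {Y : measurableType d}.

Definition measure_preserving (mu : probability Y R) (T : Y -> Y) : Prop :=
  measurable_fun setT T /\
  forall A, measurable A -> mu (T @^-1` A) = mu A.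

Definition invariant_sets (T : Y -> Y) : set (set Y) :=
  [set A | measurable A /\ T @^-1` A = A].

Definition complex_integrable (mu : probability Y R) (f : Y -> R[i]) : Prop :=
  mu.-integrable setT (fun y => (complex.Re (f y))%:E) /\
  mu.-integrable setT (fun y => (complex.Im (f y))%:E).

(* g is a version of the conditional expectation of f given the sub-sigma-algebra
   G: it is integrable, G-measurable, and has the same integral as f on every
   member of G. *)
Definition is_real_cond_exp (mu : probability Y R) (G : set (set Y))
    (f g : Y -> R) : Prop :=
  [/\ mu.-integrable setT (EFin \o g),
      forall A : set R, measurable A -> G (g @^-1` A) &
      forall A, G A -> (\int[mu]_(y in A) (g y)%:E = \int[mu]_(y in A) (f y)%:E)%E].

Definition is_cond_exp (mu : probability Y R) (G : set (set Y))
    (f g : Y -> R[i]) : Prop :=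
  is_real_cond_exp mu G (fun y => complex.Re (f y)) (fun y => complex.Re (g y)) /\
  is_real_cond_exp mu G (fun y => complex.Im (f y)) (fun y => complex.Im (g y)).

(* Conditional expectations are unique up to null sets, so asking for some
   version that vanishes almost everywhere is the same as asking it of all. *)
Definition orthogonal_to_invariant (mu : probability Y R) (T : Y -> Y)
    (f : Y -> R[i]) : Prop :=
  exists g : Y -> R[i],
    is_cond_exp mu (invariant_sets T) f g /\ {ae mu, forall y, g y = 0}.

Definition weighted_average (b : nat -> R[i]) (a : nat -> nat) (T : Y -> Y)
    (f : Y -> R[i]) (N : nat) (y : Y) : R[i] :=
  N%:R^-1 * \sum_(1 <= n < N.+1) b n * f (iter (a n) T y).

(* A real supremum: for |b| <= 1 it is taken over a bounded set, and it is 0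
   when B is empty. *)
Definition sup_average (B : set (nat -> R[i])) (a : nat -> nat) (T : Y -> Y)
    (f : Y -> R[i]) (N : nat) (y : Y) : R :=
  sup [set modulus (weighted_average b a T f N y) | b in B].

End dynamics.

(* Main.v *)
Require Import Defs.
From HB Require Import structures.
From mathcomp Require Import all_boot all_order all_algebra.
From mathcomp Require Import finmap.
From mathcomp Require Import all_classical all_reals all_analysis.
From mathcomp Require Import measurable_realfun.
From mathcomp Require Import complex.
From mathcomp Require Import ring lra zify.

Set Implicit Arguments.
Unset Strict Implicit.
Unset Printing Implicit Defensive.

Import Order.TTheory GRing.Theory Num.Theory.
Import numFieldNormedType.Exports.

Local Open Scope classical_set_scope.
Local Open Scope ring_scope.

(** Write x k for the bit X_(k+1)(w), sigma k = (k+1)^-alpha for its mean, and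
    cnt x M for the number of ones among the first M bits.  The N-th one of x
    sits at position a_N, so for N = cnt x M the average to be estimated is
    1/N times
      sum_(k < M) x k * b (cnt x k + 1) * f (T^(k+1) y).
    Replacing x k by (x k - sigma k) + sigma k splits it into a noise sum, with
    coefficients c_b k = (x k - sigma k) * b (cnt x k + 1), and a smooth sum.

    Randomness enters only through [typical]: almost surely, for all large M,
    cnt x M is comparable to M^(1-alpha) and every correlation
    sum_k c_b k * c_b' (k + h) with 0 < h < M, for b and b' in a finite list
    approximating the weights, is at most M^(1/2-alpha+gain), where
    gain = (1/2-alpha)/2.  Indeed b (cnt x k + 1) is known before the bit x k is
    drawn, so the correlation is a martingale in k; its conditional variance is
    about M^(1-2 alpha), and Freedman's inequality [freedman] beats the union
    over the exp (M^small) pairs of weights.  The condition alpha < 1/2 makes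
    these correlations negligible in the Schur tests below.  As [typical] speaks
    of x alone, the exceptional set depends neither on the system nor on f.

    For a typical x the rest is deterministic, and rests on three facts.

    - Coboundaries ([ae_coboundary_negligible]).  If f = g - g o T with g
      bounded, the smooth sum is controlled by summation by parts, since its
      coefficients sigma k * b (cnt x k + 1) change, apart from the decay of
      sigma, only when a one occurs.  For the noise sum, a Gram matrix
      estimate on an orbit segment ([gram_bound]) bounds the mean square of its
      maximum over all weights of the list, whatever the weight chosen at each
      point, with a power gain in M.  This is summable along N = n^p, which
      gives convergence there, and bounded functions allow interpolation
      between consecutive values of n^p.

    - A weak type (1,1) inequality for the averages along x without weights
      ([weak_type]).  At each dyadic scale f is cut down to the points where it
      and its forward average are not too large.  The discarded part is
      controlled by a counting argument and the maximal ergodic theorem, the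
      smooth part again by the maximal ergodic theorem, and the noise part in
      mean square: expanding the square leaves the correlations with b = 1.

    - Density ([coboundary_approximation]).  The maximal ergodic theorem on the
      invariant set where the sums of f - e are unbounded shows that ordinary
      ergodic averages of f tend to 0 when f integrates to 0 over all invariant
      sets; hence f is an L1 limit of coboundaries of bounded functions.

    The theorem follows by writing f as such a coboundary plus a function of
    small norm, whose contribution is dominated, for all weights bounded by 1 at
    once, by averages of its absolute value along x.  Complex weights and
    functions are treated through their real and imaginary parts. *)

(** * An exponential inequality for sums of independent bits *)

Section exponential_weights.
Context {R : realType}.
Implicit Types (x y : nat -> bool) (p : nat -> R).

Fixpoint words (M : nat) : seq (seq bool) :=
  if M is M'.+1 then [seq rcons s c | s <- words M', c <- [:: false; true]]
  else [:: [::]].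

Definition weight p (s : seq bool) : R :=
  \prod_(i < size s) (if nth false s i then p i else 1 - p i).

(** Functions of an infinite bit sequence are evaluated on finite words padded
    with zeros, so that predictability can be stated without dependent types. *)
Definition expect p M (G : (nat -> bool) -> R) : R :=
  \sum_(s <- words M) weight p s * G (nth false s).

Lemma wordsS M :
  words M.+1 = [seq rcons s c | s <- words M, c <- [:: false; true]].
Proof. by []. Qed.

Lemma size_words M s : s \in words M -> size s = M.
Proof.
elim: M s => [|M IH] s; first by rewrite inE => /eqP ->.
by rewrite wordsS; case/allpairsP=> -[u c] /= [/IH us _ ->]; rewrite size_rcons us.
Qed.

Lemma nth_words (x : nat -> bool) M :
  exists2 s, s \in words M & forall i, (i < M)%N -> nth false s i = x i.
Proof.
elim: M => [|M [s sM sx]]; first by exists [::] => //; rewrite inE.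
exists (rcons s (x M)).
  by rewrite wordsS; apply/allpairsP; exists (s, x M); split => //=; case: (x M).
move=> i iM; rewrite nth_rcons (size_words sM).
move: iM; rewrite ltnS leq_eqVlt => /orP[/eqP->|iM]; first by rewrite ltnn eqxx.
by rewrite iM sx.
Qed.

Lemma weight_rcons p s c :
  weight p (rcons s c) = weight p s * (if c then p (size s) else 1 - p (size s)).
Proof.
rewrite /weight size_rcons big_ord_recr /= nth_rcons ltnn eqxx; congr (_ * _).
by apply: eq_bigr => i _; rewrite nth_rcons ltn_ord.
Qed.

Lemma weight_ge0 p s : (forall k, 0 <= p k <= 1) -> 0 <= weight p s.
Proof.
move=> p01; apply: prodr_ge0 => i _.
by have := p01 i; case: ifP => _ /andP[? ?] //; rewrite subr_ge0.
Qed.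

Lemma expectS p M G :
  expect p M.+1 G = \sum_(s <- words M) weight p s *
    ((1 - p M) * G (nth false (rcons s false)) +
     p M * G (nth false (rcons s true))).
Proof.
rewrite /expect wordsS big_allpairs_dep /=.
rewrite big_seq [RHS]big_seq; apply: eq_bigr => s sM.
rewrite !big_cons big_nil !weight_rcons (size_words sM) /=; ring.
Qed.

(** Squaring the tangent bound exp (v/2) <= 1 / (1 - v/2); the restriction on
    v keeps the remaining cubic factor positive. *)
Lemma expR_le_quadratic (v : R) : `|v| <= 4^-1 -> expR v <= 1 + v + v ^+ 2.
Proof.
rewrite ler_norml => /andP[v1 v2].
have h : 0 < 1 - v / 2 by lra.
have e1 : expR (v / 2) <= (1 - v / 2)^-1.
  rewrite -[v / 2]opprK expRN lef_pV2 ?posrE ?expR_gt0//; last by lra.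
  by rewrite (le_trans _ (expR_ge1Dx _))//; lra.
have -> : expR v = expR (v / 2) ^+ 2 by rewrite -expRM_natl; congr expR; lra.
have : expR (v / 2) ^+ 2 <= (1 - v / 2)^-1 ^+ 2.
  by rewrite ler_sqr ?nnegrE ?expR_ge0// invr_ge0 ltW.
move=> /le_trans; apply.
rewrite exprVn -[leLHS]mul1r ler_pdivrMr ?exprn_gt0//.
nra.
Qed.

(** The linear terms cancel because u * (bit - q) is centred, and the
    quadratic ones contribute at most u^2 times the variance q (1 - q). *)
Lemma centered_bit_mgf (q u : R) : 0 <= q <= 1 -> `|u| <= 4^-1 ->
  (1 - q) * expR (u * (0 - q) - u ^+ 2 * q) + q * expR (u * (1 - q) - u ^+ 2 * q)
  <= 1.
Proof.
move=> /andP[q0 q1] u1.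
have hv (v : R) : `|v| <= 1 -> expR (u * v) <= 1 + u * v + (u * v) ^+ 2.
  move=> v1; apply: expR_le_quadratic.
  by rewrite normrM; apply: le_trans u1; rewrite ler_piMr.
have h0 := hv (0 - q); have h1 := hv (1 - q).
rewrite !expRD !expRN !mulrA -mulrDl ler_pdivrMr ?expR_gt0// mul1r.
apply: le_trans (expR_ge1Dx _).
have {}h0 := h0 ltac:(rewrite ler_norml; lra).
have {}h1 := h1 ltac:(rewrite ler_norml; lra).
have : 0 <= u ^+ 2 * q ^+ 2 by rewrite mulr_ge0 ?sqr_ge0.
have : (1 - q) * expR (u * (0 - q)) <= (1 - q) * (1 + u * (0 - q) + (u * (0 - q)) ^+ 2).
  by rewrite ler_wpM2l// subr_ge0.
have : q * expR (u * (1 - q)) <= q * (1 + u * (1 - q) + (u * (1 - q)) ^+ 2).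
  by rewrite ler_wpM2l.
move: (expR _) (expR _) => E F; nra.
Qed.

Definition predictable (g : (nat -> bool) -> nat -> R) :=
  forall x y k, (forall i, (i < k)%N -> x i = y i) -> g x k = g y k.

(** The multiplier of t * (x M - p M) is fixed by the first M bits, so
    averaging over the last bit alone costs a factor at most 1 by
    [centered_bit_mgf]. *)
Lemma expect_supermartingale p M (g : (nat -> bool) -> nat -> R) (t : R) :
  (forall k, 0 <= p k <= 1) -> predictable g ->
  (forall x k, `|g x k| <= 1) -> 0 <= t <= 4^-1 ->
  expect p M (fun x => expR (\sum_(k < M)
    (t * g x k * ((x k)%:R - p k) - (t * g x k) ^+ 2 * p k))) <= 1.
Proof.
move=> p01 gP g1 /andP[t0 t1]; elim: M => [|M IH].
  by rewrite /expect /= big_seq1 /weight !big_ord0 expR0 mulr1.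
rewrite expectS; apply: le_trans IH; rewrite /expect !big_seq.
apply: ler_sum => s sM; apply: ler_wpM2l; first exact: weight_ge0.
have eqb b : \sum_(k < M.+1) (t * g (nth false (rcons s b)) k *
      ((nth false (rcons s b) k)%:R - p k) -
      (t * g (nth false (rcons s b)) k) ^+ 2 * p k) =
    \sum_(k < M) (t * g (nth false s) k * ((nth false s k)%:R - p k) -
      (t * g (nth false s) k) ^+ 2 * p k) +
    (t * g (nth false s) M * (b%:R - p M) - (t * g (nth false s) M) ^+ 2 * p M).
  have ag k : (k <= M)%N -> g (nth false (rcons s b)) k = g (nth false s) k.
    move=> kM; apply: gP => i ik; rewrite nth_rcons (size_words sM).
    by rewrite (leq_trans ik kM).
  rewrite big_ord_recr /= ag// nth_rcons (size_words sM) ltnn eqxx; congr (_ + _).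
  apply: eq_bigr => k _; rewrite ag; last exact: ltnW.
  by rewrite nth_rcons (size_words sM) ltn_ord.
rewrite !eqb.
move: (\sum_(_ < _) _) => Sg; rewrite !(expRD Sg) [(1 - p M) * _]mulrCA.
rewrite [p M * _]mulrCA -mulrDr ler_piMr ?expR_ge0//.
apply: centered_bit_mgf => //.
by rewrite normrM ger0_norm//; apply: le_trans t1; rewrite ler_piMr.
Qed.

(** The variance is part of the event: for correlations it is itself random,
    and only its control on the same event matters. *)
Definition large_deviation p M (g : (nat -> bool) -> nat -> R) (l V : R) x :=
  (l <= \sum_(k < M) g x k * ((x k)%:R - p k)) &&
  (\sum_(k < M) g x k ^+ 2 * p k <= V).

(** Markov's inequality applied to the exponential supermartingale, whose
    exponent is at least t l - t^2 V on the event. *)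
Lemma freedman p M (g : (nat -> bool) -> nat -> R) (t l V : R) :
  (forall k, 0 <= p k <= 1) -> predictable g ->
  (forall x k, `|g x k| <= 1) -> 0 <= t <= 4^-1 ->
  expect p M (fun x => (large_deviation p M g l V x)%:R) <=
  expR (- (t * l) + t ^+ 2 * V).
Proof.
move=> p01 gP g1 t01.
have := expect_supermartingale M p01 gP g1 t01.
rewrite -(ler_pM2l (expR_gt0 (- (t * l) + t ^+ 2 * V))) mulr1; apply: le_trans.
rewrite /expect mulr_sumr !big_seq; apply: ler_sum => s sM.
rewrite mulrCA; apply: ler_wpM2l; first exact: weight_ge0.
rewrite -expRD /large_deviation.
case: (boolP (_ && _)) => [/andP[hl hV]|_]; last by rewrite expR_ge0.
apply: le_trans (expR_ge1Dx _); rewrite lerDl big_split /= sumrN.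
have -> : \sum_(k < M) t * g (nth false s) k * ((nth false s k)%:R - p k) =
  t * \sum_(k < M) g (nth false s) k * ((nth false s k)%:R - p k).
  by rewrite mulr_sumr; apply: eq_bigr => k _; ring.
have -> : \sum_(k < M) (t * g (nth false s) k) ^+ 2 * p k =
  t ^+ 2 * \sum_(k < M) g (nth false s) k ^+ 2 * p k.
  by rewrite mulr_sumr; apply: eq_bigr => k _; ring.
move: t01 => /andP[t0 _].
have := ler_wpM2l t0 hl; have := ler_wpM2l (sqr_ge0 t) hV; lra.
Qed.

End exponential_weights.

(** * The law of finitely many random bits *)

Section cylinders.
Context {R : realType} {d : measure_display} {Omega : measurableType d}.
Variables (P : probability Omega R) (X : nat -> {RV P >-> R}) (p : nat -> R).
Hypothesis X01 : forall n w, (0 < n)%N -> X n w = 0 \/ X n w = 1.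
Hypothesis Xind : mutually_independent [set n | (0 < n)%N] X.
Hypothesis XE : forall k, ('E_P[X k.+1] = (p k)%:E)%E.

Definition bits (w : Omega) (k : nat) : bool := X k.+1 w == 1.

Lemma natr_bits w k : (bits w k)%:R = X k.+1 w.
Proof.
rewrite /bits; have [->|->] := X01 w (ltn0Sn k); last by rewrite eqxx.
by rewrite eq_sym oner_eq0.
Qed.

(** The complement of 1 stands for the value 0: the variables take only two
    values, and these two sets are exactly complementary. *)
Definition bit_set (b : bool) : set R := if b then [set 1] else ~` [set 1].

Lemma measurable_bit_set b : measurable (bit_set b).
Proof. by case: b; [|apply: measurableC]; exact: measurable_set1. Qed.

Lemma measurable_bit_preimage k b : measurable (X k.+1 @^-1` bit_set b).
Proof.
rewrite -[_ @^-1` _]setTI; apply: (measurable_funP (X k.+1)) => //.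
exact: measurable_bit_set.
Qed.

Lemma bit_preimageE k b : X k.+1 @^-1` bit_set b = [set w | bits w k = b].
Proof.
apply/seteqP; split => w /=; rewrite /bits /bit_set; case: b => /=.
- by move=> ->; rewrite eqxx.
- by move/eqP/negbTE.
- by move/eqP.
- by move/eqP.
Qed.

Lemma bit_preimageP k b w : bit_set b (X k.+1 w) <-> bits w k = b.
Proof. by have := bit_preimageE k b; move=> /(congr1 (@^~ w)) /= ->. Qed.

Lemma probability_bit k b :
  (P (X k.+1 @^-1` bit_set b) = (if b then p k else 1 - p k)%:E)%E.
Proof.
have h1 : (P (X k.+1 @^-1` bit_set true) = (p k)%:E)%E.
  rewrite -XE -expectation_indic; last exact: measurable_bit_preimage.
  congr expectation; apply/funext => w; rewrite indicE -natr_bits.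
  congr (nat_of_bool _)%:R; apply/idP/idP; first by move=> /set_mem/bit_preimageP.
  by move=> ?; apply/mem_set/bit_preimageP.
case: b => //.
have -> : X k.+1 @^-1` bit_set false = ~` (X k.+1 @^-1` bit_set true) by [].
rewrite probability_setC; first by rewrite h1 EFinB.
exact: measurable_bit_preimage.
Qed.

Definition cylinder (s : seq bool) : set Omega :=
  [set w | forall i, (i < size s)%N -> bits w i = nth false s i].

Lemma cylinder_bigcap s :
  cylinder s = \bigcap_(j in [set` [fset j in iota 1 (size s)]%fset])
    (X j @^-1` bit_set (nth false s j.-1)).
Proof.
apply/seteqP; split => w /= h.
  move=> [|j] /=; rewrite !inE mem_iota// => /andP[_ js].
  by apply/bit_preimageP; exact: h.
by move=> i iS; apply/bit_preimageP/(h i.+1); rewrite /= !inE mem_iota.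
Qed.

Lemma measurable_cylinder s : measurable (cylinder s).
Proof.
rewrite cylinder_bigcap; apply: bigcap_measurableType.
move=> [|j] /=; rewrite !inE mem_iota// => _; exact: measurable_bit_preimage.
Qed.

Lemma probability_cylinder s : (P (cylinder s) = (weight p s)%:E)%E.
Proof.
rewrite cylinder_bigcap Xind; last 2 first.
- by move=> j /=; rewrite !inE mem_iota => /andP[].
- by move=> j _; exact: measurable_bit_set.
have -> : (\prod_(j <- [fset j in iota 1 (size s)]%fset)
    P (X j @^-1` bit_set (nth false s j.-1)) =
  \prod_(j <- iota 1 (size s)) P (X j @^-1` bit_set (nth false s j.-1)))%E.
  apply: perm_big; apply: uniq_perm; rewrite ?fset_uniq ?iota_uniq//.
  by move=> j; rewrite !inE.
rewrite (iotaDl 1 0) big_map -[X in iota 0 X]subn0 big_mkord /weight -prodEFin.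
by apply: eq_bigr => i _; rewrite add1n probability_bit.
Qed.

(** Described through cylinders rather than as a preimage, so that
    measurability holds by construction, whatever Q does on sequences that are
    not finitely supported. *)
Definition bit_event M (Q : pred (nat -> bool)) : set Omega :=
  \big[setU/set0]_(s <- words M | Q (nth false s)) cylinder s.

Lemma measurable_bit_event M Q : measurable (bit_event M Q).
Proof. by apply: bigsetU_measurable => s _; exact: measurable_cylinder. Qed.

Lemma probability_bit_event M Q :
  (P (bit_event M Q) <= (expect p M (fun x => (Q x)%:R))%:E)%E.
Proof.
rewrite /bit_event /expect; elim: (words M) => [|s l IH].
  by rewrite !big_nil measure0.
rewrite !big_cons; case: (Q _); last by rewrite mulr0 add0r.
rewrite mulr1 EFinD -probability_cylinder.
apply: le_trans (leeD2l _ IH); apply: measureU2 => //.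
  exact: measurable_cylinder.
by apply: bigsetU_measurable => u _; exact: measurable_cylinder.
Qed.

Lemma mem_bit_event M (Q : pred (nat -> bool)) w :
  (forall x y, (forall i, (i < M)%N -> x i = y i) -> Q x = Q y) ->
  Q (bits w) -> bit_event M Q w.
Proof.
move=> QM Qw; have [s sM sw] := nth_words (bits w) M.
rewrite /bit_event -bigcup_seq_cond; exists s; rewrite /= ?sM ?(QM _ (bits w)) //.
by move=> i; rewrite (size_words sM) => /sw.
Qed.

End cylinders.

(** * Power sums and decay rates *)

Section power_sums.
Context {R : realType}.
Implicit Types (a b t : R).

(** The index is shifted by one, so that sigma a k is the mean of bit number k
    when bits are counted from 0. *)
Definition sigma (a : R) (k : nat) : R := k.+1%:R `^ (- a).

Lemma sigma_gt0 a k : 0 < sigma a k.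
Proof. exact: powR_gt0. Qed.

Lemma sigma_nincr a k l : 0 <= a -> (k <= l)%N -> sigma a l <= sigma a k.
Proof.
move=> a0 kl; rewrite /sigma !powRN lef_pV2 ?posrE ?powR_gt0//.
by apply: ge0_ler_powR; rewrite ?nnegrE ?ler_nat.
Qed.

Lemma sigma0 a : sigma a 0 = 1.
Proof. by rewrite /sigma powR1. Qed.

Lemma sigma_le1 a k : 0 <= a -> sigma a k <= 1.
Proof. by move=> a0; rewrite -(sigma0 a); exact: sigma_nincr. Qed.

Lemma sigma_sqr a k : sigma a k ^+ 2 = sigma (2 * a) k.
Proof.
rewrite /sigma expr2 -powRD; last by rewrite pnatr_eq0 implybT.
by congr (_ `^ _); ring.
Qed.

(** The tangent line of exp at c * ln y, used at ln y and at 0 with weights c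
    and 1 - c. *)
Lemma powR_le_affine (c y : R) : 0 < c < 1 -> 0 <= y -> y `^ c <= 1 - c + c * y.
Proof.
move=> /andP[c0 c1]; rewrite le_eqVlt => /predU1P[<-|y0].
  by rewrite powR0 ?gt_eqF// mulr0 addr0 subr_ge0 ltW.
rewrite /powR gt_eqF//; set z := c * ln y.
have h (u : R) : expR z * (1 + (u - z)) <= expR u.
  have -> : expR u = expR z * expR (u - z) by rewrite -expRD; congr expR; ring.
  by rewrite ler_pM2l ?expR_gt0// expR_ge1Dx.
have := h (ln y); have := h 0; rewrite expR0 (lnK y0) => h1 h2.
have c1' : 0 <= 1 - c by lra.
have := ler_wpM2l c1' h1; have := ler_wpM2l (ltW c0) h2.
have -> : c * (expR z * (1 + (ln y - z))) = expR z * (c + (z - c * z)).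
  by rewrite /z; ring.
have -> : (1 - c) * (expR z * (1 + (0 - z))) =
  expR z - expR z * (c + (z - c * z)) by ring.
move=> ? ?; lra.
Qed.

(** By [powR_le_affine], (1 - a) m^-a is at most m^(1-a) - (m-1)^(1-a), and
    these differences telescope. *)
Lemma sum_sigma_le a M : 0 < a < 1 ->
  \sum_(k < M) sigma a k <= (1 - a)^-1 * M%:R `^ (1 - a).
Proof.
move=> /andP[a0 a1].
have a1' : 0 < 1 - a by lra.
rewrite ler_pdivlMl//; elim: M => [|M IH]; first by rewrite big_ord0 mulr0 powR_ge0.
rewrite big_ord_recr /= mulrDr -lerBrDr; apply: le_trans IH _.
have e : M.+1%:R `^ (1 - a) = M.+1%:R * sigma a M :> R.
  rewrite powRD; last by rewrite pnatr_eq0 implybT.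
  by rewrite powRr1.
have := @powR_le_affine (1 - a) (M%:R / M.+1%:R) ltac:(lra) ltac:(by rewrite divr_ge0).
rewrite powRM ?invr_ge0// => h.
have -> : M%:R `^ (1 - a) = M%:R `^ (1 - a) * M.+1%:R^-1 `^ (1 - a) * M.+1%:R `^ (1 - a) :> R.
  rewrite -powR_inv1// -mulrA -powRrM -powRD; last by rewrite pnatr_eq0 implybT.
  by rewrite mulN1r addNr powRr0 mulr1.
apply: le_trans (ler_wpM2r (powR_ge0 _ _) h) _.
rewrite e le_eqVlt; apply/orP; left; apply/eqP.
have : M.+1%:R != 0 :> R by [].
by move: (sigma a M) => s; rewrite -natr1 => ?; field.
Qed.

Lemma sum_sigma_ge a M : 0 <= a -> (0 < M)%N -> M%:R `^ (1 - a) <= \sum_(k < M) sigma a k.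
Proof.
case: M => // M a0 _.
have -> : M.+1%:R `^ (1 - a) = \sum_(k < M.+1) sigma a M :> R.
  rewrite powRD; last by rewrite pnatr_eq0 implybT.
  by rewrite powRr1// sumr_const card_ord mulr_natl.
by apply: ler_sum => k _; apply: sigma_nincr => //; rewrite -ltnS.
Qed.

Lemma near_powR_ge (t K : R) : 0 < t -> \forall M \near \oo, K <= M%:R `^ t.
Proof.
move=> t0; have K0 : 0 <= `|K| `^ t^-1 by exact: powR_ge0.
near=> M; apply: le_trans (ler_norm K) _.
have -> : `|K| = (`|K| `^ t^-1) `^ t by rewrite -powRrM mulVf ?gt_eqF// powRr1.
apply: ge0_ler_powR; rewrite ?nnegrE ?(ltW t0)//.
near: M; exact: nbhs_infty_ger.
Unshelve. all: by end_near. Qed.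

Lemma natr_le_expR (t : R) M : 0 < t -> (0 < M)%N ->
  M%:R <= expR (M%:R `^ t / t).
Proof.
move=> t0 M0; have z0 : 0 < M%:R `^ t :> R by rewrite powR_gt0// ltr0n.
have {1}-> : M%:R = (M%:R `^ t) `^ t^-1 :> R.
  by rewrite -powRrM mulfV ?gt_eqF// powRr1.
rewrite expRM; apply: ge0_ler_powR; rewrite ?nnegrE ?invr_ge0 ?expR_ge0 ?(ltW t0) ?(ltW z0)//.
by rewrite (le_trans _ (expR_ge1Dx _))// lerDr.
Qed.

(** With z = M^t, both M and the prefactor grow at most like exp (O(z)), which
    exp (- c z^2) absorbs. *)
Lemma subexponential_decay (t A c : R) : 0 < t -> 0 <= A -> 0 < c ->
  \forall M \near \oo,
    expR (A + A * M%:R `^ t - c * M%:R `^ t ^+ 2) <= (M.+1 * M.+2)%:R^-1.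
Proof.
move=> t0 A0 c0; near=> M.
have M0 : (0 < M)%N by near: M; exact: nbhs_infty_gt.
have z0 : 0 < M%:R `^ t :> R by rewrite powR_gt0// ltr0n.
have z1 : 1 <= M%:R `^ t by near: M; exact: near_powR_ge.
have zbig : (A + A + 6 + 2 / t) / c <= M%:R `^ t by near: M; exact: near_powR_ge.
set z := M%:R `^ t in z0 z1 zbig *.
have Mz : M%:R <= expR (z / t) by exact: natr_le_expR.
rewrite -[leRHS]mul1r ler_pdivlMr ?ltr0n//.
have h6 : (M.+1 * M.+2)%:R <= 6 * M%:R ^+ 2 :> R.
  by rewrite -natrX -natrM ler_nat; nia.
have h7 : 6 * M%:R ^+ 2 <= expR 6 * expR (z / t) ^+ 2 :> R.
  apply: ler_pM => //; first by rewrite (le_trans _ (expR_ge1Dx _))//; lra.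
  by rewrite ler_sqr ?nnegrE ?expR_ge0.
apply: le_trans (ler_wpM2l (expR_ge0 _) (le_trans h6 h7)) _.
rewrite -expRM_natl -!expRD -[leRHS]expR0 ler_expR.
move: zbig; rewrite ler_pdivrMr// => zbig.
have := ler_wpM2r (ltW z0) zbig; rewrite expr2.
have : 0 < t^-1 by rewrite invr_gt0.
move: (t^-1) => u u0; nra.
Unshelve. all: by end_near. Qed.

End power_sums.

(** * Borel-Cantelli *)

Section borel_cantelli.
Context {R : realType} {d : measure_display} {T : measurableType d}.
Variable mu : probability T R.

Lemma sum_inverse_pronic M :
  \sum_(0 <= n < M) (n.+1 * n.+2)%:R^-1 = 1 - M.+1%:R^-1 :> R.
Proof.
elim: M => [|M IH]; first by rewrite big_geq// invr1 subrr.
have h1 : M.+1%:R != 0 :> R by [].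
have h2 : M.+2%:R != 0 :> R by [].
rewrite big_nat_recr//= IH natrM; move: h1 h2.
have -> : M.+2%:R = M.+1%:R + 1 :> R by rewrite natr1.
by move: (M.+1%:R) => u u0 u1; field; rewrite u0 u1.
Qed.

(** The bounds are summable because 1 / ((n+1)(n+2)) telescopes. *)
Lemma ae_eventually_notin (F : nat -> set T) :
  (forall M, measurable (F M)) ->
  (\forall M \near \oo, mu (F M) <= ((M.+1 * M.+2)%:R^-1)%:E)%E ->
  {ae mu, forall w, \forall M \near \oo, ~ F M w}.
Proof.
move=> mF [M0 _ hM0].
pose G M := if (M < M0)%N then set0 else F M.
have mG M : measurable (G M) by rewrite /G; case: ifP.
have G0 : mu (lim_sup_set G) = 0%E.
  apply: lim_sup_set_cvg0 => //; apply: (@le_lt_trans _ _ 1%E); last exact: ltry.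
  apply: lime_le; first exact: is_cvg_nneseries.
  apply: nearW => M /=.
  apply: (@le_trans _ _ (\sum_(0 <= n < M) ((n.+1 * n.+2)%:R^-1)%:E)%E).
    apply: lee_sum => n _; rewrite /G; case: ltnP => [_|/hM0//].
    by rewrite measure0 lee_fin invr_ge0.
  by rewrite sumEFin sum_inverse_pronic lee_fin gerBl invr_ge0.
exists (lim_sup_set G); split => //.
  by apply: bigcapT_measurable => n; apply: bigcup_measurable.
move=> w /= nw n _; apply: contrapT => h; apply: nw.
exists (maxn n M0) => // M /=; rewrite geq_max => /andP[nM M0M] FMw.
by apply: h; exists M => //; rewrite /G ltnNge M0M.
Qed.

End borel_cantelli.

(** * Typical sparse sequences *)

Section sparse_sequences.
Context {R : realType}.
Implicit Types (x : nat -> bool) (a : R) (b c : nat -> R).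

Definition cnt x M : nat := \sum_(k < M) x k.

Lemma cntS x M : cnt x M.+1 = (cnt x M + x M)%N.
Proof. by rewrite /cnt big_ord_recr. Qed.

(** The weight is evaluated at the number of the next one to appear. It
    depends on the bits before k only, which makes the noise a martingale
    difference; when x k = 1 it is the weight actually attached to that one. *)
Definition noise a b x k : R := ((x k)%:R - sigma a k) * b (cnt x k).+1.

Definition corr a b c x M h : R :=
  \sum_(k < M - h) noise a b x k * noise a c x (k + h)%N.

(** With a = 1/2 - 2 gain, correlations of size M^(3 gain), summed over M
    lags, are smaller by the factor M^(- gain) than the square of M^(1-a), the
    order of cnt x M. *)
Definition gain a : R := (2^-1 - a) / 2.

(** For a single scale M. The third item controls the conditional variance of
    the correlations; it also bounds the total variation of the smooth
    coefficients. *)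
Definition typical a (L : seq (nat -> R)) M x :=
  [/\ 2^-1 * M%:R `^ (1 - a) <= (cnt x M)%:R,
      (cnt x M)%:R <= 4 * M%:R `^ (1 - a),
      \sum_(k < M) sigma a k * (x k)%:R <= 2 / (1 - 2 * a) * M%:R `^ (1 - 2 * a) &
      forall b c h, b \in L -> c \in L -> (0 < h < M)%N ->
        `|corr a b c x M h| <= M%:R `^ (3 * gain a)].

Local Notation deviation_test := (((nat -> bool) -> nat -> R) * (R * R))%type.

(** A test is a predictable multiplier together with a deviation threshold and
    a variance bound, so that one union bound serves all the requirements of
    [typical]. *)
Definition fails_test a M (q : deviation_test) x :=
  large_deviation (sigma a) M q.1 q.2.1 q.2.2 x.

(** The sign e provides both one-sided deviations of the correlation at lag h,
    seen as a martingale in its later index. *)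
Definition corr_test a M (e : bool) (h : nat) b c : deviation_test :=
  (fun x k => (-1) ^+ e * (if (h <= k)%N then noise a b x (k - h) * c (cnt x k).+1
                           else 0),
   (M%:R `^ (3 * gain a), 3 / (1 - 2 * a) * M%:R `^ (1 - 2 * a))).

Definition count_low_test a M : deviation_test :=
  (fun _ _ => -1, (2^-1 * \sum_(k < M) sigma a k, \sum_(k < M) sigma a k)).
Definition count_high_test a M : deviation_test :=
  (fun _ _ => 1, (\sum_(k < M) sigma a k, \sum_(k < M) sigma a k)).
Definition weighted_count_test a M : deviation_test :=
  (fun _ k => sigma a k, (\sum_(k < M) sigma (2 * a) k, \sum_(k < M) sigma (2 * a) k)).

Definition tests a (L : seq (nat -> R)) M : seq deviation_test :=
  [:: count_low_test a M, count_high_test a M, weighted_count_test a M &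
   [seq corr_test a M eh.1 eh.2 bc.1 bc.2 |
     eh <- [seq (e, h) | e <- [:: false; true], h <- iota 1 M.-1],
     bc <- [seq (b, c) | b <- L, c <- L]]].

Lemma corrE a b c x M h : (0 < h < M)%N ->
  corr a b c x M h = \sum_(k < M)
    (if (h <= k)%N then noise a b x (k - h) * c (cnt x k).+1 else 0) *
    ((x k)%:R - sigma a k).
Proof.
set F := fun k => (if (h <= k)%N then noise a b x (k - h) * c (cnt x k).+1 else 0) *
    ((x k)%:R - sigma a k).
move=> /andP[h0 hM]; rewrite -(big_mkord xpredT F).
rewrite (@big_cat_nat _ _ _ h)//=; last exact: ltnW.
rewrite [X in X + _]big_nat_cond big1 ?add0r; last first.
  by move=> k; rewrite andbT /F /= => kh; rewrite leqNgt kh mul0r.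
have -> : \sum_(h <= k < M) F k = \sum_(0 <= k < M - h) F (k + h)%N.
  by rewrite -{1}[h]add0n big_addn.
rewrite big_mkord /corr; apply: eq_bigr => k _.
rewrite /F leq_addl addnK /noise; ring.
Qed.

Lemma eq_cnt x y k : (forall i, (i < k)%N -> x i = y i) -> cnt x k = cnt y k.
Proof. by move=> xy; apply: eq_bigr => i _; rewrite xy. Qed.

Lemma large_deviation_local (p : nat -> R) M g l V x y : predictable g ->
  (forall i, (i < M)%N -> x i = y i) ->
  large_deviation p M g l V x = large_deviation p M g l V y.
Proof.
move=> gP xy; rewrite /large_deviation.
have gE (k : 'I_M) : g x k = g y k.
  by apply: gP => i ik; apply: xy; rewrite (ltn_trans ik).
have -> : \sum_(k < M) g x k * ((x k)%:R - p k) =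
  \sum_(k < M) g y k * ((y k)%:R - p k).
  by apply: eq_bigr => k _; rewrite gE xy.
by congr (_ && (_ <= _)); apply: eq_bigr => k _; rewrite gE.
Qed.

Lemma noise_le1 a b x k : 0 <= a -> (forall n, (0 < n)%N -> `|b n| <= 1) ->
  `|noise a b x k| <= 1.
Proof.
move=> a0 b1; rewrite /noise normrM mulr_ile1 ?normr_ge0 ?b1//.
have := sigma_gt0 a k; have := sigma_le1 k a0.
by case: (x k) => /= h1 h2; rewrite ler_norml; lra.
Qed.

Lemma predictable_corr_test a M e h b c : (0 < h)%N ->
  predictable (corr_test a M e h b c).1.
Proof.
move=> h0 x y k xy; rewrite /corr_test /=; case: leqP => // hk.
have khk : (k - h < k)%N by lia.
rewrite /noise (eq_cnt xy) (xy _ khk) (@eq_cnt x y (k - h))//.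
by move=> i ik; apply: xy; apply: ltn_trans ik khk.
Qed.

Lemma corr_test_le1 a M e h b c x k : 0 <= a ->
  (forall n, (0 < n)%N -> `|b n| <= 1) -> (forall n, (0 < n)%N -> `|c n| <= 1) ->
  `|(corr_test a M e h b c).1 x k| <= 1.
Proof.
move=> a0 b1 c1; rewrite /corr_test /= normrM normrX normrN1 expr1n mul1r.
by case: ifP => _; rewrite ?normr0// normrM mulr_ile1 ?normr_ge0 ?noise_le1 ?c1.
Qed.

(** The square of the noise at k - h is at most x (k - h) + sigma (k - h), and
    sigma decreases, so the factor sigma k may be replaced by sigma (k - h).
    This removes the dependence on the lag. *)
Lemma sum_lag_variance a b c x M h : 0 <= a -> 
  (forall n, (0 < n)%N -> `|b n| <= 1) -> (forall n, (0 < n)%N -> `|c n| <= 1) ->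
  \sum_(k < M) (if (h <= k)%N then noise a b x (k - h) * c (cnt x k).+1 else 0) ^+ 2
     * sigma a k <=
  \sum_(k < M) sigma a k * (x k)%:R + \sum_(k < M) sigma (2 * a) k.
Proof.
move=> a0 b1 c1; set F := fun k => sigma a k * (x k)%:R + sigma (2 * a) k.
have F0 k : 0 <= F k.
  by rewrite addr_ge0 ?mulr_ge0 ?(ltW (sigma_gt0 _ _)).
rewrite -big_split /= -/(F _) -[leRHS](big_mkord xpredT F).
apply: (@le_trans _ _ (\sum_(0 <= k < M - h) F k)); last first.
  have := leq_subr h M; move: (M - h)%N => N NM.
  by rewrite (@big_cat_nat _ _ _ N 0 M)//= lerDl sumr_ge0.
set G := (fun k => (if (h <= k)%N then noise a b x (k - h) * c (cnt x k).+1 else 0) ^+ 2 * sigma a k).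
have Gle k : (h <= k)%N -> G k <= F (k - h)%N.
  move=> hk; rewrite /G hk exprMn.
  have h1 : c (cnt x k).+1 ^+ 2 <= 1 by rewrite -real_normK ?num_real// expr_le1// c1.
  have h2 : noise a b x (k - h) ^+ 2 <= (x (k - h)%N)%:R + sigma a (k - h).
    rewrite /noise exprMn.
    have h3 : b (cnt x (k - h)).+1 ^+ 2 <= 1 by rewrite -real_normK ?num_real// expr_le1// b1.
    apply: le_trans (ler_piMr (sqr_ge0 _) h3) _.
    have := sigma_gt0 a (k - h); have := sigma_le1 (k - h) a0.
    by case: (x _) => /= ? ?; nra.
  apply: (@le_trans _ _ (((x (k - h)%N)%:R + sigma a (k - h)) * sigma a (k - h))).
    apply: ler_pM.
    - by rewrite mulr_ge0 ?sqr_ge0.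
    - exact/ltW/sigma_gt0.
    - by apply: le_trans h2; rewrite ler_piMr ?sqr_ge0.
    by apply: sigma_nincr => //; rewrite leq_subr.
  by rewrite /F -sigma_sqr mulrDl mulrC expr2.
rewrite -(big_mkord xpredT G); have [Mh|hM] := leqP M h.
  rewrite big_nat_cond big1 ?sumr_ge0// => k; rewrite andbT /= => kM.
  by rewrite /G leqNgt (leq_trans kM Mh)/= expr0n mul0r.
rewrite (@big_cat_nat _ _ _ h)//=; last exact: ltnW.
rewrite [X in X + _]big_nat_cond big1 ?add0r; last first.
  by move=> k; rewrite andbT /= => kh; rewrite /G leqNgt kh /= expr0n mul0r.
have -> : \sum_(h <= k < M) G k = \sum_(0 <= k < M - h) G (k + h)%N.
  by rewrite -{1}[h]add0n big_addn.
by apply: ler_sum => k _; apply: le_trans (Gle _ (leq_addl _ _)) _; rewrite addnK.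
Qed.

Lemma mem_testsP a L M q : q \in tests a L M ->
  [\/ q = count_low_test a M, q = count_high_test a M, q = weighted_count_test a M |
     exists e h b c, [/\ b \in L, c \in L, (0 < h < M)%N & q = corr_test a M e h b c]].
Proof.
rewrite /tests !inE => /or4P[/eqP->|/eqP->|/eqP->|]; try by constructor.
case/allpairsP => -[eh bc] [].
case/allpairsP => -[e h] [_ hM ->] /allpairsP[[b c] [bL cL ->]] ->.
by constructor 4; exists e, h, b, c; split => //; move: hM; rewrite mem_iota /=; lia.
Qed.

Lemma corr_test_in a L M e h b c : b \in L -> c \in L -> (0 < h < M)%N ->
  corr_test a M e h b c \in tests a L M.
Proof.
move=> bL cL hM; rewrite /tests !inE; apply/or4P; constructor 4.
apply/allpairsP; exists ((e, h), (b, c)); split => //.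
  apply/allpairsP; exists (e, h); split => //; first by case: e.
  by rewrite mem_iota /=; lia.
by apply/allpairsP; exists (b, c).
Qed.

Lemma size_tests a L M : size (tests a L M) = (3 + 2 * M.-1 * (size L * size L))%N.
Proof.
have size3 A (q1 q2 q3 : A) s : size [:: q1, q2, q3 & s] = (3 + size s)%N by [].
by rewrite /tests size3 !size_allpairs size_iota.
Qed.

Lemma predictable_test a L M q : q \in tests a L M -> predictable q.1.
Proof.
move=> /mem_testsP[->|->|->|[e [h [b [c [_ _ /andP[h0 _] ->]]]]]] //.
exact: predictable_corr_test.
Qed.

Lemma test_le1 a L M q x k : 0 <= a ->
  (forall b, b \in L -> forall n, (0 < n)%N -> `|b n| <= 1) ->
  q \in tests a L M -> `|q.1 x k| <= 1.
Proof.
move=> a0 L1 /mem_testsP[->|->|->|[e [h [b [c [bL cL _ ->]]]]]] /=.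
- by rewrite normrN1.
- by rewrite normr1.
- by rewrite ger0_norm ?sigma_le1// ltW// sigma_gt0.
- by apply: corr_test_le1 => //; exact: L1.
Qed.

(** Every test is refined enough for the exponent to be a multiple of M^gain:
    t is a constant for the counts, whose thresholds are comparable to their
    variances, and M^(- 2 gain) / 4 for the correlations, which makes t^2
    times the variance bounded. *)
Lemma expR_test_le a M q (L : seq (nat -> R)) : 0 < a < 2^-1 -> (0 < M)%N ->
  q \in tests a L M ->
  exists2 t, 0 <= t <= 4^-1 & expR (- (t * q.2.1) + t ^+ 2 * q.2.2) <=
  expR (3 / (1 - 2 * a) - 16^-1 * M%:R `^ (gain a / 2) ^+ 2).
Proof.
move=> /andP[a0 a1] M0.
have M1 : 1 <= M%:R :> R by rewrite ler1n.
have a12 : 0 < 1 - 2 * a by lra.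
have -> : M%:R `^ (gain a / 2) ^+ 2 = M%:R `^ gain a :> R.
  by rewrite -powR_mulrn ?powR_ge0// -powRrM; congr (_ `^ _); field.
have C0 : 0 <= 3 / (1 - 2 * a) by rewrite divr_ge0// ltW.
have eta0 : 0 < gain a by rewrite /gain; lra.
have s1 : M%:R `^ gain a <= \sum_(k < M) sigma a k.
  apply: le_trans (sum_sigma_ge (ltW a0) M0); apply: ler_powR => //.
  by rewrite /gain; lra.
have s2 : M%:R `^ gain a <= \sum_(k < M) sigma (2 * a) k.
  apply: le_trans (@sum_sigma_ge _ (2 * a) M ltac:(lra) M0); apply: ler_powR => //.
  by rewrite /gain; lra.
have half (S z C : R) : 0 <= C -> z <= S ->
    - (4^-1 * (2^-1 * S)) + 4^-1 ^+ 2 * S <= C - 16^-1 * z.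
  by move=> ? ?; rewrite expr2; lra.
have full (S z C : R) : 0 <= C -> 0 <= z -> z <= S ->
    - (4^-1 * S) + 4^-1 ^+ 2 * S <= C - 16^-1 * z.
  by move=> ? ? ?; rewrite expr2; lra.
move=> /mem_testsP[->|->|->|[e [h [b [c [bL cL _ ->]]]]]] /=.
- by exists 4^-1; [lra|rewrite ler_expR; apply: half].
- by exists 4^-1; [lra|rewrite ler_expR; apply: full].
- by exists 4^-1; [lra|rewrite ler_expR; apply: full].
(* This t balances the variance M^(4 gain) and leaves t * M^(3 gain) = M^gain / 4. *)
- exists (4^-1 * M%:R `^ (- (2 * gain a))).
    apply/andP; split; first by rewrite mulr_ge0 ?powR_ge0.
    rewrite ler_piMr// -[leRHS](powRr0 M%:R); apply: ler_powR => //; lra.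
  rewrite ler_expR.
  have e1 : M%:R `^ (- (2 * gain a)) * M%:R `^ (3 * gain a) = M%:R `^ gain a :> R.
    rewrite -powRD; last by rewrite (gt_eqF (lt_le_trans ltr01 M1)) implybT.
    by congr (_ `^ _); ring.
  have e2 : M%:R `^ (- (2 * gain a)) ^+ 2 * M%:R `^ (1 - 2 * a) = 1 :> R.
    rewrite -powR_mulrn ?powR_ge0// -powRrM -powRD; last first.
      by rewrite (gt_eqF (lt_le_trans ltr01 M1)) implybT.
    by rewrite -[RHS](powRr0 M%:R); congr (_ `^ _); rewrite /gain; field.
  have -> : (4^-1 * M%:R `^ (- (2 * gain a))) ^+ 2 *
     (3 / (1 - 2 * a) * M%:R `^ (1 - 2 * a)) =
     16^-1 * (3 / (1 - 2 * a)) * (M%:R `^ (- (2 * gain a)) ^+ 2 * M%:R `^ (1 - 2 * a)).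
    by move: (M%:R `^ _) (M%:R `^ _) (3 / _) => u v w; field.
  rewrite e2 -(mulrA 4^-1 (M%:R `^ _)) e1 mulr1.
  have := powR_ge0 M%:R (gain a); move: (3 / _) C0 => C C0; lra.
Qed.

(** The bound on the weighted count keeps the variances of the correlation
    tests below their bound, so that passing these tests does limit the
    correlations. *)
Lemma typical_of_tests a (L : seq (nat -> R)) M x : 0 < a < 2^-1 -> (0 < M)%N ->
  (forall b, b \in L -> forall n, (0 < n)%N -> `|b n| <= 1) ->
  ~~ has (fun q => fails_test a M q x) (tests a L M) -> typical a L M x.
Proof.
move=> /andP[a0 a1] M0 L1 /hasPn ok.
have aux q : q \in tests a L M ->
   \sum_(k < M) q.1 x k ^+ 2 * sigma a k <= q.2.2 ->
   \sum_(k < M) q.1 x k * ((x k)%:R - sigma a k) < q.2.1.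
  move=> /ok; rewrite /fails_test /large_deviation negb_and -ltNge => /orP[//|].
  by rewrite -ltNge => h1 h2; have := lt_le_trans h1 h2; rewrite ltxx.
have s1 := sum_sigma_ge (ltW a0) M0.
have s1' : \sum_(k < M) sigma a k <= 2 * M%:R `^ (1 - a).
  apply: le_trans (sum_sigma_le M _) _; first lra.
  rewrite ler_wpM2r ?powR_ge0// invf_ple ?posrE; lra.
have s2' : \sum_(k < M) sigma (2 * a) k <= (1 - 2 * a)^-1 * M%:R `^ (1 - 2 * a).
  by apply: (sum_sigma_le M _); lra.
have s2 : 0 <= \sum_(k < M) sigma (2 * a) k by apply: sumr_ge0 => k _; exact/ltW/sigma_gt0.
have cntE : (cnt x M)%:R = \sum_(k < M) (x k)%:R :> R by rewrite /cnt natr_sum.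
have low := aux (count_low_test a M).
have {}low := low (mem_head _ _).
have := aux (count_high_test a M) ltac:(by rewrite !inE eqxx orbT) => high.
have := aux (weighted_count_test a M) ltac:(by rewrite !inE eqxx !orbT) => wgt.
have {}wgt : \sum_(k < M) sigma a k * (x k)%:R < 2 * \sum_(k < M) sigma (2 * a) k.
  have {}wgt : \sum_(k < M) sigma a k * ((x k)%:R - sigma a k) < \sum_(k < M) sigma (2 * a) k.
    apply: wgt => /=; apply: ler_sum => k _; rewrite sigma_sqr ler_piMr//.
      exact/ltW/sigma_gt0.
    exact/sigma_le1/ltW.
  move: wgt; under eq_bigr do rewrite mulrBr -expr2 sigma_sqr.
  rewrite sumrB; lra.
split.
- move: low => /=; under eq_bigr do rewrite sqrrN expr1n mul1r.
  move=> /(_ (lexx _)); under eq_bigr do rewrite mulN1r opprB.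
  rewrite sumrB -cntE; lra.
- move: high => /=; under eq_bigr do rewrite expr1n mul1r.
  move=> /(_ (lexx _)); under eq_bigr do rewrite mul1r.
  rewrite sumrB -cntE; lra.
- by rewrite -mulrA; lra.
- move=> b c h bL cL hM.
  have V : \sum_(k < M) (if (h <= k)%N then noise a b x (k - h) * c (cnt x k).+1 else 0) ^+ 2
     * sigma a k <= 3 / (1 - 2 * a) * M%:R `^ (1 - 2 * a).
    apply: le_trans (@sum_lag_variance a b c x M h (ltW a0) (L1 b bL) (L1 c cL)) _.
    by rewrite -mulrA; lra.
  have h1 := aux _ (corr_test_in a false bL cL hM).
  have h2 := aux _ (corr_test_in a true bL cL hM).
  move: h1 h2 => /=; under eq_bigr do rewrite expr0 mul1r.
  under [in X in _ -> X]eq_bigr do rewrite expr1 mulN1r sqrrN.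
  move=> /(_ V) h1 /(_ V).
  move: h1; under eq_bigr do rewrite expr0 mul1r.
  rewrite -corrE// => h1.
  under eq_bigr do rewrite expr1 mulN1r mulNr.
  by rewrite sumrN -corrE// => h2; rewrite ler_norml; lra.
Qed.

End sparse_sequences.

(** * Almost every sequence is typical *)

Section almost_surely_typical.
Context {R : realType} {d : measure_display} {Omega : measurableType d}.
Variables (P : probability Omega R) (X : nat -> {RV P >-> R}) (a : R).
Hypothesis a01 : 0 < a < 2^-1.
Hypothesis X01 : forall n w, (0 < n)%N -> X n w = 0 \/ X n w = 1.
Hypothesis Xind : mutually_independent [set n | (0 < n)%N] X.
Hypothesis XE : forall k, ('E_P[X k.+1] = (sigma a k)%:E)%E.

Lemma expect_has_le (p : nat -> R) M (I : Type) (l : seq I)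
    (Q : I -> pred (nat -> bool)) :
  (forall k, 0 <= p k <= 1) ->
  expect p M (fun x => (has (Q^~ x) l)%:R) <=
  \sum_(q <- l) expect p M (fun x => (Q q x)%:R).
Proof.
move=> p01; rewrite /expect exchange_big /= !big_seq; apply: ler_sum => s _.
rewrite -mulr_sumr ler_wpM2l ?weight_ge0//.
elim: l => [|q l IH] /=; first by rewrite big_nil.
rewrite big_cons; case: (Q q _) => /=; last by rewrite add0r.
by rewrite lerDl; apply: le_trans IH.
Qed.

(** Each failure has probability exp (- c M^gain), against a number of tests
    of order M times exp (O(M^(gain/2))). *)
Lemma ae_typical (L : nat -> seq (nat -> R)) (A : R) : 0 <= A ->
  (forall M b, b \in L M -> forall n, (0 < n)%N -> `|b n| <= 1) ->
  (\forall M \near \oo, (size (L M))%:R <= expR (A + A * M%:R `^ (gain a / 2))) ->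
  {ae P, forall w, \forall M \near \oo, typical a (L M) M (bits X w)}.
Proof.
move=> A0 L1 Lsize; have /andP[a0 a1] := a01.
set t := gain a / 2; have t0 : 0 < t by rewrite /t /gain; lra.
have p01 k : 0 <= sigma a k <= 1 by rewrite sigma_le1 ?ltW// sigma_gt0.
pose Q M x := has (fun q => fails_test a M q x) (tests a (L M) M).
set C := 3 / (1 - 2 * a).
have C0 : 0 <= C by rewrite /C divr_ge0//; lra.
have small : (\forall M \near \oo,
    P (bit_event X M (Q M)) <= ((M.+1 * M.+2)%:R^-1)%:E)%E.
  pose B := 5 + t^-1 + 2 * A + C.
  have B0 : 0 <= B by rewrite !addr_ge0// ?invr_ge0 ?(ltW t0) ?mulr_ge0.
  have dec := @subexponential_decay R t B 16^-1 t0 B0 ltac:(by []).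
  near=> M.
  have M0 : (0 < M)%N by near: M; exact: nbhs_infty_gt.
  apply: le_trans (probability_bit_event X01 Xind XE M (Q M)) _; rewrite lee_fin.
  apply: (@le_trans _ _ (expR (B + B * M%:R `^ t - 16^-1 * M%:R `^ t ^+ 2))); last first.
    by near: M.
  apply: le_trans (expect_has_le M _ _ p01) _.
  apply: (@le_trans _ _ (\sum_(q <- tests a (L M) M)
    expR (C - 16^-1 * M%:R `^ t ^+ 2))).
    rewrite !big_seq; apply: ler_sum => q qL.
    have [u u0 le_u] := expR_test_le a01 M0 qL.
    apply: (@le_trans _ _ (expR (- (u * q.2.1) + u ^+ 2 * q.2.2))); last exact: le_u.
    apply: freedman => //; first exact: predictable_test qL.
    by move=> x k; apply: test_le1 qL => //; [exact: ltW|exact: L1].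
  rewrite big_const_seq count_predT iter_addr_0 size_tests -[expR _ *+ _]mulr_natl.
  have -> : B + B * M%:R `^ t - 16^-1 * M%:R `^ t ^+ 2 =
    (B - C + B * M%:R `^ t) + (C - 16^-1 * M%:R `^ t ^+ 2) by ring.
  rewrite (expRD (B - C + _)) ler_wpM2r ?expR_ge0//.
  have hL : (size (L M))%:R <= expR (A + A * M%:R `^ t) by near: M.
  have hM := natr_le_expR t0 M0.
  have z0 := powR_ge0 M%:R t.
  apply: (@le_trans _ _ (5 * (expR (M%:R `^ t / t) *
     (expR (A + A * M%:R `^ t) * expR (A + A * M%:R `^ t))))); last first.
    rewrite -!expRD; apply: (@le_trans _ _ (expR 5 * expR (M%:R `^ t / t +
      (A + A * M%:R `^ t + (A + A * M%:R `^ t))))).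
      rewrite ler_wpM2r ?expR_ge0// (le_trans _ (expR_ge1Dx _))//; lra.
    have t1 : 0 <= t^-1 by rewrite invr_ge0 ltW.
    rewrite -expRD ler_expR /B; move: (M%:R `^ t) z0 (t^-1) t1 => z z0 u u0; nra.
  have h5 : 1 <= expR (M%:R `^ t / t).
    by apply: le_trans hM; rewrite ler1n.
  have h6 : 1 <= expR (A + A * M%:R `^ t).
    rewrite -{1}(@expR0 R) ler_expR; nra.
  have h7 : M.-1%:R <= expR (M%:R `^ t / t).
    by apply: le_trans hM; rewrite ler_nat leq_pred.
  rewrite natrD !natrM.
  move: (expR (M%:R `^ t / t)) (expR (A + _)) h5 h6 h7 hL => e f h5 h6 h7 hL.
  have h8 : (size (L M))%:R * (size (L M))%:R <= f * f by apply: ler_pM.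
  have h9 : M.-1%:R * ((size (L M))%:R * (size (L M))%:R) <= e * (f * f).
    by apply: ler_pM; rewrite ?mulr_ge0.
  have h10 : 1 <= e * (f * f) by rewrite !mulr_ege1.
  rewrite -mulrA; lra.
have := ae_eventually_notin (fun M => measurable_bit_event X M (Q M)) small.
apply: filterS => w nw; near=> M.
have M0 : (0 < M)%N by near: M; exact: nbhs_infty_gt.
apply: typical_of_tests => //; first exact: L1.
apply/negP => QM; have : ~ bit_event X M (Q M) w by near: M.
apply; apply: mem_bit_event QM => x y xy; apply: eq_in_has => q qL.
exact: large_deviation_local (predictable_test qL) xy.
Unshelve. all: by end_near. Qed.

End almost_surely_typical.

(** * Integration over a probability space *)

Section integrable_functions.
Context {R : realType} {d : measure_display} {Y : measurableType d}.
Variable mu : probability Y R.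
Implicit Types (f g h : Y -> R).

(** Real-valued functions are used throughout, so that expectations can be
    manipulated in the field of reals. *)
Definition L1 f := mu.-integrable setT (EFin \o f).
Local Notation E f := (Rintegral mu setT f).

Lemma L1_measurable f : L1 f -> measurable_fun setT f.
Proof. by move=> /measurable_int /measurable_EFinP. Qed.

Lemma L1D f g : L1 f -> L1 g -> L1 (fun y => f y + g y).
Proof. exact: integrableD. Qed.

Lemma L1B f g : L1 f -> L1 g -> L1 (fun y => f y - g y).
Proof. exact: integrableB. Qed.

Lemma L1Z (c : R) f : L1 f -> L1 (fun y => c * f y).
Proof. by move=> f1; have := integrableZl measurableT c f1. Qed.

Lemma L1_abs f : L1 f -> L1 (fun y => `|f y|).
Proof. exact: integrable_abse. Qed.

Lemma L1_sum (I : Type) (s : seq I) (F : I -> Y -> R) :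
  (forall i, L1 (F i)) -> L1 (fun y => \sum_(i <- s) F i y).
Proof.
move=> F1; elim: s => [|i s IH].
  by under [X in L1 X]funext do rewrite big_nil; exact: integrable0.
by under [X in L1 X]funext do rewrite big_cons; apply: L1D.
Qed.

Lemma L1_le f g : L1 g -> measurable_fun setT f -> (forall y, `|f y| <= g y) -> L1 f.
Proof.
move=> g1 mf fg; apply: (le_integrable measurableT _ _ g1).
  exact/measurable_EFinP.
by move=> y _ /=; rewrite lee_fin (le_trans (fg y))// ler_norm.
Qed.

Lemma L1_cst (c : R) : L1 (fun=> c).
Proof. exact: finite_measure_integrable_cst. Qed.

Lemma L1_bounded f (K : R) : measurable_fun setT f -> (forall y, `|f y| <= K) -> L1 f.
Proof. by move=> mf fK; apply: (@L1_le _ (fun=> K)) => //; exact: L1_cst. Qed.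

Lemma measurable_le_cst f (c : R) : measurable_fun setT f ->
  measurable [set y | f y <= c].
Proof.
move=> mf; have -> : [set y | f y <= c] = f @^-1` `]-oo, c]%classic.
  by apply/seteqP; split => y /=; rewrite in_itv.
by rewrite -[X in measurable X]setTI; exact: mf.
Qed.

Lemma measurable_gt_cst f (c : R) : measurable_fun setT f ->
  measurable [set y | c < f y].
Proof.
move=> mf; have -> : [set y | c < f y] = ~` [set y | f y <= c].
  by apply/seteqP; split => y /=; rewrite ltNge => /negP.
by apply: measurableC; exact: measurable_le_cst.
Qed.

Lemma L1_indic (A : set Y) : measurable A -> L1 (\1_A : Y -> R).
Proof.
move=> mA; apply: (@L1_bounded _ 1); first exact: measurable_indic.
by move=> y; rewrite indicE; case: (_ \in _); rewrite ?normr1 ?normr0.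
Qed.

Lemma ED f g : L1 f -> L1 g -> E (fun y => f y + g y) = E f + E g.
Proof. by move=> f1 g1; rewrite RintegralD. Qed.

Lemma EB f g : L1 f -> L1 g -> E (fun y => f y - g y) = E f - E g.
Proof. by move=> f1 g1; rewrite RintegralB. Qed.

Lemma EZ (c : R) f : L1 f -> E (fun y => c * f y) = c * E f.
Proof. by move=> f1; rewrite RintegralZl. Qed.

Lemma E_cst (c : R) : E (fun=> c) = c.
Proof.
rewrite (Rintegral_cst mu measurableT) -[RHS]mulr1; congr (_ * _).
exact: (congr1 fine (probability_setT mu)).
Qed.

Lemma E_sum (I : Type) (s : seq I) (F : I -> Y -> R) :
  (forall i, L1 (F i)) -> E (fun y => \sum_(i <- s) F i y) = \sum_(i <- s) E (F i).
Proof.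
move=> F1; elim: s => [|i s IH].
  by under [X in Rintegral _ _ X]funext do rewrite big_nil; rewrite big_nil E_cst.
under [X in Rintegral _ _ X]funext do rewrite big_cons.
by rewrite ED ?IH ?big_cons//; exact: L1_sum.
Qed.

Lemma E_le f g : L1 f -> L1 g -> (forall y, f y <= g y) -> E f <= E g.
Proof. by move=> f1 g1 fg; apply: le_Rintegral. Qed.

Lemma E_ge0 f : (forall y, 0 <= f y) -> 0 <= E f.
Proof. by move=> f0; apply: Rintegral_ge0. Qed.

Lemma E_indic (A : set Y) : measurable A -> (E \1_A)%:E = mu A.
Proof.
move=> mA; rewrite /Rintegral integral_indic// setIT fineK//.
exact: fin_num_measure.
Qed.

(** Dominated convergence. *)
Lemma E_cvg (F : nat -> Y -> R) f h :
  (forall n, measurable_fun setT (F n)) -> measurable_fun setT f -> L1 h ->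
  (forall n y, `|F n y| <= h y) ->
  {ae mu, forall y, F n y @[n --> \oo] --> f y} ->
  L1 f /\ E (F n) @[n --> \oo] --> E f.
Proof.
move=> mF mf h1 Fh Ff.
have mF' n : measurable_fun setT (EFin \o F n) by exact/measurable_EFinP.
have mf' : measurable_fun setT (EFin \o f) by exact/measurable_EFinP.
have [||f1 _ cv] := dominated_convergence measurableT mF' mf' _ h1.
- by apply: filterS Ff => y Fy _; apply/fine_cvgP; split => //; exact: nearW.
- by apply: nearW => y n _ /=; rewrite lee_fin.
split=> //; rewrite /Rintegral; apply: fine_cvg.
rewrite fineK; first exact: cv.
exact: integrable_fin_num.
Qed.

End integrable_functions.

(** * Measure-preserving maps *)

Section measure_preserving.
Context {R : realType} {d : measure_display} {Y : measurableType d}.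
Variables (mu : probability Y R) (T : Y -> Y).
Hypothesis hT : measure_preserving mu T.
Implicit Types (f g h : Y -> R).
Local Notation E f := (Rintegral mu setT f).
Local Notation L1 := (L1 mu).

Lemma measurable_iter n : measurable_fun setT (iter n T).
Proof.
elim: n => [|n IH]; first exact: measurable_id.
by apply: (measurableT_comp (proj1 hT)).
Qed.

Lemma measure_preserving_iter n A : measurable A -> mu (iter n T @^-1` A) = mu A.
Proof.
elim: n A => [|n IH] A mA //.
rewrite -(proj2 hT A mA) -(IH (T @^-1` A))//.
by rewrite -[_ @^-1` _]setTI; exact: (proj1 hT).
Qed.

Lemma measurable_comp_iter n f : measurable_fun setT f ->
  measurable_fun setT (fun y => f (iter n T y)).
Proof. by move=> mf; apply: (measurableT_comp mf); exact: measurable_iter. Qed.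

Lemma integral_comp_iter n (F : Y -> \bar R) : measurable_fun setT F ->
  (forall y, 0 <= F y)%E -> (\int[mu]_y F (iter n T y) = \int[mu]_y F y)%E.
Proof.
move=> mF F0.
have mp := measurable_iter n.
have <- := @ge0_integral_pushforward _ _ _ _ _ _ mp mu setT F measurableT mF (fun y _ => F0 y).
by apply: eq_measure_integral => A mA _; exact: measure_preserving_iter.
Qed.

Lemma L1_comp n f : L1 f -> L1 (fun y => f (iter n T y)).
Proof.
move=> f1; have mf := L1_measurable f1.
apply/integrableP; split.
  exact/measurable_EFinP/measurable_comp_iter.
have := @integral_comp_iter n (fun y => `|(f y)%:E|%E).
rewrite /= => ->//.
  by case/integrableP: f1.
by apply/measurable_EFinP; exact: measurableT_comp.
Qed.

Lemma E_comp n f : L1 f -> E (fun y => f (iter n T y)) = E f.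
Proof.
move=> f1; rewrite /Rintegral.
have mp := measurable_iter n.
have mf : measurable_fun setT (EFin \o f) by case/integrableP: f1.
have <- := @integral_pushforward _ _ _ _ _ _ mp mu setT (EFin \o f) mf (L1_comp n f1) measurableT.
congr fine; apply: eq_measure_integral => A mA _.
exact: measure_preserving_iter.
Qed.

End measure_preserving.

(** * The maximal ergodic theorem *)

Section maximal_ergodic.
Context {R : realType} {d : measure_display} {Y : measurableType d}.
Variables (mu : probability Y R) (T : Y -> Y).
Hypothesis hT : measure_preserving mu T.
Implicit Types (f g h : Y -> R).
Local Notation E f := (Rintegral mu setT f).
Local Notation L1 := (L1 mu).

Definition orbit_sum f n y : R := \sum_(k < n) f (iter k T y).

Lemma orbit_sumS f n y : orbit_sum f n.+1 y = f y + orbit_sum f n (T y).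
Proof.
rewrite /orbit_sum big_ord_recl /=; congr (_ + _); apply: eq_bigr => k _.
by rewrite -iterSr.
Qed.

(** The maximum of the sums over at most n terms of the orbit, including the
    empty sum, in the recursive form that Garsia's argument uses. *)
Fixpoint orbit_max f n y : R :=
  if n is n'.+1 then Num.max 0 (f y + orbit_max f n' (T y)) else 0.

Lemma orbit_maxS f n y :
  orbit_max f n.+1 y = Num.max 0 (f y + orbit_max f n (T y)).
Proof. by []. Qed.

Lemma orbit_max_ge0 f n y : 0 <= orbit_max f n y.
Proof. by case: n => //= n; rewrite le_max lexx. Qed.

Lemma orbit_max_nondecr f n y : orbit_max f n y <= orbit_max f n.+1 y.
Proof.
elim: n y => [|n IH] y; first exact: orbit_max_ge0.
by rewrite /= ge_max le_max lexx /= le_max lerD2l IH orbT.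
Qed.

Lemma orbit_sum_le_max f n k y : (k <= n)%N -> orbit_sum f k y <= orbit_max f n y.
Proof.
elim: n k y => [|n IH] k y.
  by rewrite leqn0 => /eqP->; rewrite /orbit_sum big_ord0.
case: k => [|k] kn; first by rewrite /orbit_sum big_ord0 orbit_max_ge0.
by rewrite orbit_sumS /= le_max lerD2l IH ?orbT.
Qed.

Lemma L1_orbit_sum f n : L1 f -> L1 (orbit_sum f n).
Proof.
by move=> f1; apply: L1_sum => k; exact: (L1_comp hT).
Qed.

Lemma measurable_orbit_sum f n : measurable_fun setT f ->
  measurable_fun setT (orbit_sum f n).
Proof. by move=> mf; apply: measurable_sum => k; exact: (measurable_comp_iter hT). Qed.

Lemma L1_orbit_max f n : L1 f -> L1 (orbit_max f n).
Proof.
move=> f1; elim: n => [|n IH]; first exact: L1_cst.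
have h := L1D f1 (L1_comp hT 1 IH).
apply: (L1_le (L1_abs h)).
  by apply: measurable_maxr; [exact: measurable_cst|exact: L1_measurable h].
move=> y /=; rewrite ger0_norm; last by rewrite le_max lexx.
by rewrite ge_max normr_ge0 ler_norm.
Qed.

Definition max_set f n : set Y := [set y | 0 < orbit_max f n y].

Lemma measurable_max_set f n : L1 f -> measurable (max_set f n).
Proof.
move=> f1; have /L1_measurable m := L1_orbit_max n f1.
exact: measurable_gt_cst.
Qed.

Lemma L1_mul_indic f (A : set Y) : L1 f -> measurable A -> L1 (fun y => f y * \1_A y).
Proof.
move=> f1 mA; apply: (L1_le (L1_abs f1)).
  by apply: measurable_funM; [exact: L1_measurable f1|exact: measurable_indic].
by move=> y; rewrite normrM indicE ler_piMr//; case: (_ \in _); rewrite ?normr1 ?normr0.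
Qed.

(** Where the maximum M_n is positive, it equals f + M_(n-1) o T, so f is at
    least M_n - M_n o T there; elsewhere this difference is nonpositive, and
    it integrates to 0. *)
Lemma garsia f n : L1 f -> 0 <= E (fun y => f y * \1_(max_set f n) y).
Proof.
case: n => [|n] f1.
  by apply: E_ge0 => y; rewrite indicE /max_set /= memNset ?mulr0 //= ltxx.
have m1 := L1_orbit_max n.+1 f1.
have -> : 0 = E (fun y => orbit_max f n.+1 y - orbit_max f n.+1 (iter 1 T y)).
  by rewrite EB// ?(E_comp hT)// ?subrr//; exact: (L1_comp hT).
apply: E_le.
- by apply: L1B => //; exact: (L1_comp hT).
- by apply: L1_mul_indic => //; exact: measurable_max_set.
move=> y; rewrite indicE; have [h|h] := boolP (y \in _).
  have {}h : 0 < orbit_max f n.+1 y by exact: set_mem h.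
  move: h; rewrite mulr1 lerBlDr [iter 1 T y]/= (orbit_maxS f n y).
  rewrite lt_max ltxx orFb => h.
  by rewrite max_r ?(ltW h)// lerD2l orbit_max_nondecr.
rewrite mulr0 subr_le0 (_ : orbit_max f n.+1 y = 0) ?orbit_max_ge0//.
have {}h : ~ 0 < orbit_max f n.+1 y by move=> ?; move/negP: h; apply; exact: mem_set.
by apply/eqP; rewrite eq_le orbit_max_ge0 andbT leNgt; exact/negP.
Qed.

(** Garsia's inequality for f - l. *)
Lemma maximal_ergodic f l n : L1 f -> (forall y, 0 <= f y) -> 0 < l ->
  E \1_(max_set (fun y => f y - l) n) <= l^-1 * E f.
Proof.
move=> f1 f0 l0; set A := max_set _ n.
have fl1 : L1 (fun y => f y - l) by apply: L1B => //; exact: L1_cst.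
have mA : measurable A by exact: measurable_max_set.
rewrite ler_pdivlMl// -EZ; last exact: L1_indic.
have := garsia n fl1; rewrite -/A.
have -> : (fun y => (f y - l) * \1_A y) = (fun y => f y * \1_A y - l * \1_A y).
  by apply/funext => y; rewrite mulrBl.
rewrite EB; last 2 first.
- exact: L1_mul_indic.
- by apply: L1Z; exact: L1_indic.
rewrite subr_ge0 => /le_trans; apply; apply: E_le => //; first exact: L1_mul_indic.
by move=> y; rewrite ler_piMr// indicE; case: (_ \in _).
Qed.

Lemma max_set_of_average f l n k y : (k <= n)%N -> l * k%:R < orbit_sum f k y ->
  max_set (fun y => f y - l) n y.
Proof.
move=> kn h; rewrite /max_set /=; apply: lt_le_trans (orbit_sum_le_max _ _ kn).
rewrite /orbit_sum sumrB sumr_const card_ord subr_gt0 -mulr_natr; exact: h.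
Qed.

(** Unlike a set defined by a limit superior, it is invariant by inspection:
    the sums along y and T y differ by a shift and the value at y. *)
Definition unbounded_set f : set Y :=
  [set y | forall K : nat, exists n, K%:R < orbit_sum f n y].

Lemma measurable_unbounded_set f : measurable_fun setT f -> measurable (unbounded_set f).
Proof.
move=> mf; have -> : unbounded_set f =
    \bigcap_(K : nat) \bigcup_n (orbit_sum f n @^-1` `]K%:R, +oo[%classic).
  apply/seteqP; split => y /= h.
    by move=> K _; have [n hn] := h K; exists n => //=; rewrite in_itv /= andbT.
  by move=> K; have [n _ /=] := h K I; rewrite in_itv /= andbT; exists n.
apply: bigcapT_measurable => K; apply: bigcupT_measurable => n.
rewrite -[X in measurable X]setTI; exact: measurable_orbit_sum.
Qed.

Lemma unbounded_set_invariant f : T @^-1` (unbounded_set f) = unbounded_set f.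
Proof.
apply/seteqP; split => y /= h K.
  have [N hN] : exists N : nat, `|f y| < N%:R.
    by exists (Num.Def.trunc `|f y|).+1; exact: truncnS_gt.
  have [n hn] := h (K + N)%N; exists n.+1; rewrite orbit_sumS.
  move: hn; rewrite natrD => hn.
  by have := ler_norm (- f y); rewrite normrN; lra.
have [N hN] : exists N : nat, `|f y| < N%:R.
  by exists (Num.Def.trunc `|f y|).+1; exact: truncnS_gt.
have [[|n] hn] := h (K + N)%N.
  move: hn; rewrite /orbit_sum big_ord0 natrD => hn; exists 0%N.
  rewrite big_ord0.
  by have : 0 <= K%:R + N%:R :> R by []; lra.
exists n; move: hn; rewrite orbit_sumS natrD.
by have := ler_norm (f y); lra.
Qed.

End maximal_ergodic.

(** * Approximation by coboundaries *)

Section coboundary_approximation.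
Context {R : realType} {d : measure_display} {Y : measurableType d}.
Variables (mu : probability Y R) (T : Y -> Y).
Hypothesis hT : measure_preserving mu T.
Implicit Types (f g h : Y -> R).
Local Notation E f := (Rintegral mu setT f).
Local Notation L1 := (L1 mu).

Definition zero_mean f := forall A, measurable A -> T @^-1` A = A ->
  E (fun y => f y * \1_A y) = 0.

Lemma natr_large (c : R) : exists N : nat, c < N%:R.
Proof. by exists (Num.Def.trunc c).+1; exact: truncnS_gt. Qed.

Lemma orbit_sumB f g n y :
  orbit_sum T (fun y => f y - g y) n y = orbit_sum T f n y - orbit_sum T g n y.
Proof. by rewrite /orbit_sum sumrB. Qed.

Lemma orbit_sum_cst (c : R) n y : orbit_sum T (fun=> c) n y = c * n%:R.
Proof. by rewrite /orbit_sum sumr_const card_ord mulr_natr. Qed.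

(** Let U be this set, h the restriction of f - e to U. The sets where the
    maximum of h is positive increase to U because U is invariant, so Garsia's
    inequality passes to the limit: the integral of f - e over U is
    nonnegative. It equals - e times the measure of U. *)
Lemma unbounded_set_null f (e : R) : L1 f -> zero_mean f -> 0 < e ->
  mu (unbounded_set T (fun y => f y - e)) = 0%E.
Proof.
move=> f1 f0 e0; set g := fun y => f y - e; set U := unbounded_set T g.
have g1 : L1 g by apply: L1B => //; exact: L1_cst.
have mU : measurable U by apply: (measurable_unbounded_set hT); exact: L1_measurable g1.
have TU : T @^-1` U = U by exact: unbounded_set_invariant.
have UT y : (T y \in U) = (y \in U).
  by apply/idP/idP; rewrite !inE => h; [rewrite -TU|rewrite -TU in h].
pose h := fun y => g y * \1_U y.
have h1 : L1 h by exact: L1_mul_indic.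
have hsum n y : y \in U -> orbit_sum T h n y = orbit_sum T g n y.
  elim: n y => [|n IH] y yU; first by rewrite /orbit_sum !big_ord0.
  by rewrite !orbit_sumS IH ?UT// /h indicE yU mulr1.
have hmax n y : y \notin U -> orbit_max T h n y = 0.
  elim: n y => [|n IH] y yU //.
  by rewrite orbit_maxS IH ?UT// /h indicE (negbTE yU) mulr0 addr0 maxxx.
have cv y : h y * \1_(max_set T h n) y @[n --> \oo] --> h y.
  have [yU|yU] := boolP (y \in U); last first.
    rewrite /h indicE (negbTE yU) mulr0; apply: cvg_near_cst.
    by apply: nearW => n; rewrite mul0r.
  apply: cvg_near_cst; have [n0 hn0] := set_mem yU 0%N.
  exists n0 => // n /= n0n; rewrite indicE mem_set ?mulr1//.
  apply: lt_le_trans (orbit_sum_le_max T h y n0n).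
  by rewrite hsum.
have [_ lim] := @E_cvg _ _ _ mu (fun n y => h y * \1_(max_set T h n) y) h
  (fun y => `|h y|) (fun n => L1_measurable (L1_mul_indic h1 (measurable_max_set hT n h1)))
  (L1_measurable h1) (L1_abs h1) ltac:(move=> n y; rewrite normrM ler_piMr// indicE;
    by case: (_ \in _); rewrite ?normr1 ?normr0) (aeW mu cv).
have Eh : 0 <= E h.
  rewrite -(cvg_lim (@Rhausdorff R) lim); apply: limr_ge; first exact: cvgP lim.
  by apply: nearW => n; exact: (garsia hT).
apply/eqP; rewrite -E_indic// eqe eq_le E_ge0 ?andbT; last first.
  by move=> y; rewrite indicE.
move: Eh; have -> : h = (fun y => f y * \1_U y - e * \1_U y).
  by apply/funext => y; rewrite /h mulrBl.
rewrite EB; last 2 first.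
- exact: L1_mul_indic.
- by apply: L1Z; exact: L1_indic.
rewrite f0// EZ; last exact: L1_indic.
by rewrite sub0r oppr_ge0 pmulr_rle0.
Qed.

Lemma zero_meanN f : L1 f -> zero_mean f -> zero_mean (fun y => - f y).
Proof.
move=> f1 f0 A mA TA.
have -> : (fun y => - f y * \1_A y) = (fun y => -1 * (f y * \1_A y)).
  by apply/funext => y; ring.
by rewrite EZ ?f0 ?mulr0//; exact: L1_mul_indic.
Qed.

(** Outside the null sets of [unbounded_set_null], for f and - f and all e =
    1/(i+1), the sums are at most e n plus a constant in absolute value. *)
Lemma ae_orbit_average0 f : L1 f -> zero_mean f ->
  {ae mu, forall y, orbit_sum T f n y / n%:R @[n --> \oo] --> (0 : R)}.
Proof.
move=> f1 f0.
pose U s i := unbounded_set T (fun y => (-1) ^+ (s : bool) * f y - i.+1%:R^-1).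
have mU s i : measurable (U s i).
  apply: (measurable_unbounded_set hT); apply: measurable_funB => //.
  by apply: measurable_funM => //; exact: L1_measurable f1.
have U0 s i : mu (U s i) = 0%E.
  rewrite /U; case: s; apply: unbounded_set_null => //.
  - by apply: L1Z.
  - by under [X in zero_mean X]funext do rewrite expr1 mulN1r; exact: zero_meanN.
  - by apply: L1Z.
  - by under [X in zero_mean X]funext do rewrite expr0 mul1r.
exists (\bigcup_i (U true i `|` U false i)); split.
- by apply: bigcupT_measurable => i; apply: measurableU.
- apply/eqP; rewrite eq_le measure_ge0 andbT.
  apply: le_trans (measure_sigma_subadditive _ _ _ _) _.
  + by move=> i; exact: measurableU (mU true i) (mU false i).
  + by apply: bigcupT_measurable => i; apply: measurableU.
  + by [].
  + rewrite eseries0// => i _ _; apply/eqP; rewrite eq_le measure_ge0 andbT.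
    by rewrite (le_trans (measureU2 _ (mU true i) (mU false i)))//= !U0 adde0.
move=> y /= ny; apply: contrapT => yU; apply: ny.
apply/cvgrPdist_le => e e0; have [i hi] := natr_large (2 / e).
have bnd s : exists K : nat, forall n,
    (-1) ^+ (s : bool) * orbit_sum T f n y <= K%:R + i.+1%:R^-1 * n%:R.
  apply: contrapT => h; apply: yU; exists i => //.
  suff : U s i y by case: s {h}; [left|right].
  move=> K; apply: contrapT => h2; apply: h; exists K => n.
  rewrite leNgt; apply/negP => h3; apply: h2; exists n.
  rewrite orbit_sumB orbit_sum_cst ltrBrDr.
  by move: h3; rewrite /orbit_sum mulr_sumr.
have [K1 h1] := bnd true; have [K0 h0] := bnd false.
have ie : i.+1%:R^-1 <= e / 2.
  rewrite invf_ple ?posrE ?ltr0n ?divr_gt0// invf_div ltW//.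
  by apply: lt_trans hi _; rewrite ltr_nat.
near=> n.
have n0 : (0 : R) < n%:R by rewrite ltr0n; near: n; exact: nbhs_infty_gt.
have nK : (2 / e) * (K0 + K1)%:R <= n%:R by near: n; exact: nbhs_infty_ger.
rewrite sub0r normrN normrM normfV (ger0_norm (ler0n R n)) ler_pdivrMr//.
have := h1 n; have := h0 n; rewrite expr0 expr1 mul1r mulN1r => g0 g1.
have {}nK : (K0 + K1)%:R <= e / 2 * n%:R.
  by rewrite -ler_pdivrMl ?divr_gt0// invf_div.
have combine (S k0 k1 v w : R) : 0 <= k0 -> 0 <= k1 -> k0 + k1 <= w -> v <= w ->
    S <= k0 + v -> - S <= k1 + v -> `|S| <= 2 * w.
  by rewrite ler_norml => *; apply/andP; split; lra.
have -> : e * n%:R = 2 * (e / 2 * n%:R) by field.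
apply: combine g0 g1 => //; first by rewrite -natrD.
by rewrite ler_wpM2r// ltW.
Unshelve. all: by end_near. Qed.

Definition truncation (K : R) f y := f y * \1_[set y | `|f y| <= K] y.

Lemma L1_truncation K f : L1 f -> L1 (truncation K f).
Proof.
by move=> f1; apply: L1_mul_indic => //; apply: measurable_le_cst;
  apply: measurableT_comp => //; exact: L1_measurable f1.
Qed.

Lemma truncation_bounded K f y : 0 <= K -> `|truncation K f y| <= K.
Proof.
move=> K0; rewrite /truncation indicE; have [|_] := boolP (y \in _).
  by rewrite inE /= mulr1.
by rewrite mulr0 normr0.
Qed.

Lemma truncation_approx f (e : R) : L1 f -> 0 < e ->
  exists2 K : R, 0 <= K & E (fun y => `|f y - truncation K f y|) <= e.
Proof.
move=> f1 e0.
have r1 n : L1 (fun y => `|f y - truncation n%:R f y|).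
  by apply: L1_abs; apply: L1B => //; exact: L1_truncation.
have cv y : `|f y - truncation n%:R f y| @[n --> \oo] --> (0 : R).
  apply: cvg_near_cst; have [N hN] := natr_large `|f y|.
  exists N => // n /= Nn; rewrite /truncation indicE mem_set /= ?mulr1 ?subrr ?normr0//.
  by rewrite ltW// (lt_le_trans hN)// ler_nat.
have [|_] := @E_cvg _ _ _ mu (fun n y => `|f y - truncation n%:R f y|) (fun=> 0)
  (fun y => `|f y|) (fun n => L1_measurable (r1 n)) (measurable_cst _) (L1_abs f1) _ (aeW mu cv).
  move=> n y; rewrite normr_id /truncation indicE.
  by case: (_ \in _); rewrite ?mulr1 ?mulr0 ?subrr ?subr0 ?normr0.
rewrite E_cst => /cvgrPdist_le /(_ e e0) [N _ hN].
exists N%:R => //; have := hN N (leqnn N); rewrite sub0r normrN.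
exact: le_trans (ler_norm _).
Qed.

Lemma norm_orbit_sum_le f n y : `|orbit_sum T f n y| <= orbit_sum T (fun y => `|f y|) n y.
Proof. exact: ler_norm_sum. Qed.

Lemma E_orbit_sum f n : L1 f -> E (orbit_sum T f n) = n%:R * E f.
Proof.
move=> f1; rewrite /orbit_sum E_sum; last by move=> k; exact: (L1_comp hT).
under eq_bigr do rewrite (E_comp hT)//.
by rewrite sumr_const card_ord mulr_natl.
Qed.

(** Almost everywhere convergence gives convergence in mean for the averages
    cut at height K. What exceeds K is dominated by the averages of the
    truncation error, whose mean does not depend on n. *)
Lemma mean_ergodic0 f (e : R) : L1 f -> zero_mean f -> 0 < e ->
  exists2 n : nat, (0 < n)%N & E (fun y => `|orbit_sum T f n y / n%:R|) <= e.
Proof.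
move=> f1 f0 e0; have [K K0 hK] := truncation_approx f1 (divr_gt0 e0 (ltr0n R 2)).
have a1 n : L1 (fun y => `|orbit_sum T f n y / n%:R|).
  apply: L1_abs; under [X in L1 X]funext do rewrite mulrC.
  by apply: L1Z; exact: L1_orbit_sum.
have m1 n : measurable_fun setT (fun y => Num.min `|orbit_sum T f n y / n%:R| K).
  by apply: measurable_minr => //; exact: L1_measurable (a1 n).
have b1 n y : `|Num.min `|orbit_sum T f n y / n%:R| K| <= K.
  by rewrite ger0_norm ?le_min ?normr_ge0 ?K0// ge_min lexx orbT.
have cv : {ae mu, forall y, Num.min `|orbit_sum T f n y / n%:R| K @[n --> \oo] --> (0 : R)}.
  apply: filterS (ae_orbit_average0 f1 f0) => y /cvg_norm; rewrite normr0 => cv.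
  apply: (squeeze_cvgr _ (cvg_cst 0) cv); apply: nearW => n.
  by rewrite le_min normr_ge0 K0 ge_min lexx.
have [_] := @E_cvg _ _ _ mu (fun n y => Num.min `|orbit_sum T f n y / n%:R| K)
  (fun=> 0) (fun=> K) m1 (measurable_cst _) (L1_cst _ _) b1 cv.
rewrite E_cst => /cvgrPdist_le /(_ (e / 2)) [|N _ hN]; first by rewrite divr_gt0.
exists N.+1 => //; have {hN} := hN N.+1 (leqnSn N); rewrite sub0r normrN => hN.
pose r y := `|f y - truncation K f y|.
have r1 : L1 r by apply: L1_abs; apply: L1B => //; exact: L1_truncation.
apply: (@le_trans _ _ (E (fun y => Num.min `|orbit_sum T f N.+1 y / N.+1%:R| K +
    N.+1%:R^-1 * orbit_sum T r N.+1 y))).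
  apply: E_le => //.
    apply: L1D; first exact: (L1_bounded mu (m1 N.+1) (b1 N.+1)).
    by apply: L1Z; exact: L1_orbit_sum.
  move=> y; have r0 : 0 <= N.+1%:R^-1 * orbit_sum T r N.+1 y.
    by rewrite mulr_ge0// /orbit_sum sumr_ge0// => k _; exact: normr_ge0.
  have [_|_] := leP `|orbit_sum T f N.+1 y / N.+1%:R| K; first by rewrite lerDl.
  rewrite normrM normfV (ger0_norm (ler0n R N.+1)) ler_pdivrMr ?ltr0n// mulrDl mulrAC mulVf// mul1r.
  have -> : K * N.+1%:R = orbit_sum T (fun=> K) N.+1 y by rewrite orbit_sum_cst.
  rewrite -big_split /=; apply: le_trans (ler_norm_sum _ _ _) _.
  apply: ler_sum => k _; rewrite /r; move: (iter k T y) => z.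
  have := truncation_bounded f z K0; have := ler_normD (truncation K f z) (f z - truncation K f z).
  have -> : truncation K f z + (f z - truncation K f z) = f z by ring.
  lra.
rewrite ED; last 2 first.
- exact: (L1_bounded mu (m1 N.+1) (b1 N.+1)).
- by apply: L1Z; exact: L1_orbit_sum.
rewrite EZ; last exact: L1_orbit_sum.
rewrite E_orbit_sum// mulKf//.
move: (le_trans (ler_norm _) hN) hK; rewrite -/r; lra.
Qed.

(** For a bounded truncation t of f, the difference of t and its n-th ergodic
    average is the coboundary of g = 1/n sum_(k < n) sum_(i < k) t o T^i, and
    the averages are small in mean by [mean_ergodic0]. *)
Lemma coboundary_approximation f (e : R) : L1 f -> zero_mean f -> 0 < e ->
  exists g : Y -> R, [/\ measurable_fun setT g,
    exists K, forall y, `|g y| <= K &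
    E (fun y => `|f y - (g y - g (T y))|) <= e].
Proof.
move=> f1 f0 e0; have e30 : 0 < e / 3 by rewrite divr_gt0.
have [K K0 hK] := truncation_approx f1 e30.
have [n n0 hn] := mean_ergodic0 f1 f0 e30.
have n0' : n%:R != 0 :> R by rewrite pnatr_eq0 -lt0n.
pose t := truncation K f; pose r y := f y - t y.
have t1 : L1 t by exact: L1_truncation.
have r1 : L1 r by exact: L1B.
(* g solves g - g o T = t - (n-th average of t), since the double sum telescopes. *)
pose g y := n%:R^-1 * \sum_(k < n) orbit_sum T t k y.
have gE y : g y - g (T y) = t y - orbit_sum T t n y / n%:R.
  rewrite /g -mulrBr -sumrB.
  have -> : \sum_(k < n) (orbit_sum T t k y - orbit_sum T t k (T y)) =
     \sum_(k < n) (t y - t (iter k T y)).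
    apply: eq_bigr => k _; have := orbit_sumS T t k y.
    rewrite {1}/orbit_sum big_ord_recr /= -/(orbit_sum T t k y) => h; lra.
  rewrite sumrB sumr_const card_ord -[t y *+ n]mulr_natl mulrBr mulKf//.
  by congr (_ - _); exact: mulrC.
exists g; split.
- apply: measurable_funM => //; apply: measurable_sum => k.
  by apply: (measurable_orbit_sum hT); exact: L1_measurable t1.
- exists (n%:R^-1 * \sum_(k < n) \sum_(i < k) K) => y.
  rewrite /g normrM ger0_norm ?invr_ge0// ler_wpM2l ?invr_ge0//.
  apply: le_trans (ler_norm_sum _ _ _) _; apply: ler_sum => k _.
  apply: le_trans (ler_norm_sum _ _ _) _; apply: ler_sum => i _.
  exact: truncation_bounded.
have A1 h : L1 h -> L1 (fun y => `|orbit_sum T h n y / n%:R|).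
  move=> h1; apply: L1_abs; under [X in L1 X]funext do rewrite mulrC.
  by apply: L1Z; exact: L1_orbit_sum.
have r1' : L1 (fun y => n%:R^-1 * orbit_sum T (fun z => `|r z|) n y).
  by apply: L1Z; apply: L1_orbit_sum => //; exact: L1_abs.
apply: (@le_trans _ _ (E (fun y => `|r y| + (`|orbit_sum T f n y / n%:R| +
    n%:R^-1 * orbit_sum T (fun z => `|r z|) n y)))).
  apply: E_le.
  - apply: L1_abs; apply: L1B => //.
    under [X in L1 X]funext do rewrite gE; apply: L1B => //.
    under [X in L1 X]funext do rewrite mulrC.
    by apply: L1Z; exact: L1_orbit_sum.
  - apply: L1D; first exact: L1_abs.
    by apply: L1D => //; exact: A1.
  move=> y; rewrite gE.
  have -> : f y - (t y - orbit_sum T t n y / n%:R) =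
    r y + (orbit_sum T f n y / n%:R - n%:R^-1 * orbit_sum T r n y).
    by rewrite /r orbit_sumB; field.
  apply: le_trans (ler_normD _ _) _; rewrite lerD2l.
  apply: le_trans (ler_normB _ _) _; rewrite lerD2l normrM.
  by rewrite ger0_norm ?invr_ge0// ler_wpM2l ?invr_ge0// norm_orbit_sum_le.
rewrite ED; [|exact: L1_abs|by apply: L1D => //; exact: A1].
rewrite ED//; last exact: A1.
rewrite EZ ?E_orbit_sum ?mulKf//; [|exact: L1_abs|by apply: L1_orbit_sum => //; exact: L1_abs].
move: hK hn; rewrite -/t -/r.
have -> : (fun y => `|f y - t y|) = (fun y => `|r y|) by [].
lra.
Qed.

End coboundary_approximation.

(** * Inequalities for finite sums *)

Section finite_sums.
Context {R : realType}.
Implicit Types (r v l : R).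

Lemma geometric_below r v J : 1 < r -> 0 <= v ->
  \sum_(j < J) (if r ^+ j < v then r ^+ j else 0) <= r / (r - 1) * v.
Proof.
move=> r1 v0; have r1' : 0 < r - 1 by lra.
have K0 : 0 <= r / (r - 1) by rewrite divr_ge0//; lra.
elim: J => [|J IH]; first by rewrite big_ord0 mulr_ge0.
rewrite big_ord_recr /=; have [h|_] := ltP (r ^+ J) v; last by rewrite addr0.
have geo n : \sum_(j < n) r ^+ j = (r ^+ n - 1) / (r - 1).
  elim: n => [|n IHn]; first by rewrite big_ord0 expr0 subrr mul0r.
  by rewrite big_ord_recr /= IHn exprS; field; rewrite gt_eqF.
apply: (@le_trans _ _ (\sum_(j < J.+1) r ^+ j)).
  rewrite big_ord_recr /= lerD2r; apply: ler_sum => j _.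
  by case: ifP => // _; rewrite exprn_ge0//; lra.
rewrite geo; apply: (@le_trans _ _ (r / (r - 1) * r ^+ J)); last first.
  by rewrite ler_wpM2l// ltW.
rewrite mulrAC -exprS ler_wpM2r ?invr_ge0 ?(ltW r1')//; lra.
Qed.

(** The partial sums vanish until r^j reaches v; from then on K / v - K / r^J,
    with K = r / (r - 1), absorbs exactly one new term at each step. *)
Lemma geometric_above r v J : 1 < r -> 0 < v ->
  \sum_(j < J) (if v <= r ^+ j then (r ^+ j)^-1 else 0) <= r / (r - 1) * v^-1.
Proof.
move=> r1 v0; have r1' : 0 < r - 1 by lra.
have r0 : 0 < r by lra.
have K0 : 0 <= r / (r - 1) by rewrite divr_ge0// ltW.
(* The maximum with 0 covers the steps at which no term has been collected yet. *)
suff : \sum_(j < J) (if v <= r ^+ j then (r ^+ j)^-1 else 0) <=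
    r / (r - 1) * Num.max 0 (v^-1 - (r ^+ J)^-1).
  move=> /le_trans; apply; rewrite ler_wpM2l// ge_max invr_ge0 (ltW v0)/=.
  by rewrite gerBl invr_ge0 exprn_ge0 ?ltW.
elim: J => [|J IH]; first by rewrite big_ord0 mulr_ge0// le_max lexx.
rewrite big_ord_recr /=.
have rJ : 0 < r ^+ J by exact: exprn_gt0.
have [h|h] := leP v (r ^+ J).
  move: IH; rewrite max_r; last by rewrite subr_ge0 lef_pV2 ?posrE.
  have -> : Num.max 0 (v^-1 - (r ^+ J.+1)^-1) = v^-1 - (r ^+ J.+1)^-1.
    rewrite max_r// subr_ge0 lef_pV2 ?posrE ?exprn_gt0// (le_trans h)//.
    by rewrite exprS ler_peMl ?(ltW rJ) ?(ltW r1).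
  have -> : r / (r - 1) * (v^-1 - (r ^+ J.+1)^-1) =
     r / (r - 1) * (v^-1 - (r ^+ J)^-1) + (r ^+ J)^-1.
    rewrite exprS; field.
    by rewrite !gt_eqF.
  by rewrite lerD2r.
rewrite addr0; apply: le_trans IH _.
rewrite max_l ?mulr0; last by rewrite subr_le0 lef_pV2 ?posrE// ltW.
by rewrite mulr_ge0// le_max lexx.
Qed.

(** Summation by parts, arranged as an induction whose hypothesis keeps the
    boundary term. *)
Lemma decreasing_weights (s u : nat -> R) l M :
  (forall k m, (k <= m)%N -> s m <= s k) -> (forall k, 0 <= s k) ->
  (forall m, (m <= M)%N -> \sum_(k < m) u k <= l * m%:R) ->
  \sum_(k < M) s k * u k <= l * \sum_(k < M) s k.
Proof.
move=> sd s0 hu.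
have key m : (m.+1 <= M)%N ->
    s m * (l * m.+1%:R - \sum_(k < m.+1) u k) <=
    l * \sum_(k < m.+1) s k - \sum_(k < m.+1) s k * u k.
  elim: m => [|m IH] mM; first by rewrite !big_ord_recr !big_ord0 /= !add0r mulr1 mulrBr mulrC.
  have last_term (F : nat -> R) : \sum_(k < m.+2) F k = \sum_(k < m.+1) F k + F m.+1.
    by rewrite big_ord_recr.
  rewrite (last_term s) (last_term u) (last_term (fun k => s k * u k)).
  have := IH (ltnW mM); have := hu _ (ltnW mM); have := sd _ _ (leqnSn m).
  rewrite -[m.+2]addn1 natrD.
  move: (\sum_(k < m.+1) u k) (\sum_(k < m.+1) s k) (\sum_(k < m.+1) s k * u k).
  move: (m.+1%:R) (s m) (s m.+1) (u m.+1) => w s1 s2 u2 p q t h1 h2 h3.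
  move: (h2); rewrite -subr_ge0 => h2'.
  have := ler_wpM2r h2' h1; lra.
case: M hu key => [|M] hu key; first by rewrite !big_ord0 mulr0.
rewrite -subr_ge0; apply: le_trans (key M (leqnn _)).
by rewrite mulr_ge0// subr_ge0 hu.
Qed.

Lemma square_sum (u : nat -> R) M :
  (\sum_(k < M) u k) ^+ 2 = \sum_(k < M) u k ^+ 2 +
    2 * \sum_(i < M) \sum_(k < M - i.+1) u k * u (k + i.+1)%N.
Proof.
elim: M => [|M IH]; first by rewrite !big_ord0 expr0n mulr0 addr0.
have -> : \sum_(i < M.+1) \sum_(k < M.+1 - i.+1) u k * u (k + i.+1)%N =
  \sum_(i < M) \sum_(k < M - i.+1) u k * u (k + i.+1)%N + (\sum_(k < M) u k) * u M.
  rewrite big_ord_recr /= subnn big_ord0 addr0 [X in _ + X * _](reindex_inj rev_ord_inj) /=.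
  rewrite mulr_suml -big_split /=; apply: eq_bigr => i _.
  rewrite subSS; have iM := ltn_ord i.
  have -> : (M - i = (M - i.+1).+1)%N by lia.
  rewrite big_ord_recr /=; congr (_ + _ * u _); lia.
rewrite !big_ord_recr /= sqrrD IH; ring.
Qed.

End finite_sums.

(** * The weak type inequality *)

Section weak_type.
Context {R : realType} {d : measure_display} {Y : measurableType d}.
Variables (mu : probability Y R) (T : Y -> Y).
Hypothesis hT : measure_preserving mu T.
Implicit Types (f g h : Y -> R) (x : nat -> bool).
Local Notation E f := (Rintegral mu setT f).
Local Notation L1 := (L1 mu).
Local Notation cst1 := (fun=> 1 : R).

Definition sparse_sum x f M y : R := \sum_(k < M) (x k)%:R * f (iter k.+1 T y).

Definition noise_sum (a : R) x f M y : R :=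
  \sum_(k < M) ((x k)%:R - sigma a k) * f (iter k.+1 T y).

Lemma measurable_sparse_sum x f M : measurable_fun setT f ->
  measurable_fun setT (sparse_sum x f M).
Proof.
move=> mf; apply: measurable_sum => k; apply: measurable_funM => //.
exact: (measurable_comp_iter hT).
Qed.

(** Invariance of the measure turns each product of values at times k and k +
    i into the same integral, whose coefficient is then the correlation at lag
    i. *)
Lemma E_noise_sum_sqr a x h M (K D O : R) : measurable_fun setT h ->
  (forall y, 0 <= h y <= K) -> 0 <= O ->
  \sum_(k < M) ((x k)%:R - sigma a k) ^+ 2 <= D ->
  (forall i, (0 < i < M)%N -> `|corr a cst1 cst1 x M i| <= O) ->
  L1 (fun y => noise_sum a x h M y ^+ 2) /\
  E (fun y => noise_sum a x h M y ^+ 2) <=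
  D * E (fun y => h y ^+ 2) + 2 * O * E (fun y => h y * \sum_(i < M) h (iter i.+1 T y)).
Proof.
move=> mh hK O0 hD hO; set c := fun k => (x k)%:R - sigma a k.
pose Q i y := h y * h (iter i T y).
have Q0 i y : 0 <= Q i y by rewrite mulr_ge0//; have /andP[] := hK y => //; have /andP[] := hK (iter i T y).
have Q1 i : L1 (Q i).
  apply: (@L1_bounded _ _ _ _ _ (K * K)).
    by apply: measurable_funM => //; exact: (measurable_comp_iter hT).
  move=> y; rewrite ger0_norm// /Q; have /andP[? ?] := hK y.
  by have /andP[? ?] := hK (iter i T y); apply: ler_pM.
pose S y := \sum_(k < M) c k ^+ 2 * Q 0%N (iter k.+1 T y) +
  2 * \sum_(i < M) \sum_(k < M - i.+1) c k * c (k + i.+1)%N * Q i.+1 (iter k.+1 T y).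
have SE : (fun y => noise_sum a x h M y ^+ 2) = S.
  apply/funext => y; rewrite /noise_sum (square_sum (fun k => c k * h (iter k.+1 T y))).
  rewrite /S; congr (_ + 2 * _); first by apply: eq_bigr => k _; rewrite /Q /= exprMn expr2.
  apply: eq_bigr => i _; apply: eq_bigr => k _.
  by rewrite mulrACA /Q -iterD; congr (_ * (_ * h (iter _ T y))); lia.
have S1 i k : L1 (fun y => c k * c (k + i)%N * Q i (iter k.+1 T y)).
  by apply: L1Z; exact: (L1_comp hT).
have S2 k : L1 (fun y => c k ^+ 2 * Q 0%N (iter k.+1 T y)).
  by apply: L1Z; exact: (L1_comp hT).
have S3 i : L1 (fun y => \sum_(k < M - i.+1) c k * c (k + i.+1)%N * Q i.+1 (iter k.+1 T y)).
  by apply: L1_sum => k.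
have S4 : L1 (fun y => \sum_(i < M) \sum_(k < M - i.+1) c k * c (k + i.+1)%N * Q i.+1 (iter k.+1 T y)).
  by apply: L1_sum => i.
have SL : L1 S by apply: L1D; [exact: L1_sum|exact: L1Z].
have EQ i k r : E (fun y => r * Q i (iter k T y)) = r * E (Q i).
  by rewrite EZ ?(E_comp hT)//; exact: (L1_comp hT).
rewrite SE; split => //.
rewrite /S ED; [|exact: L1_sum|exact: L1Z].
rewrite EZ// !E_sum//; apply: lerD.
  have -> : (fun y => h y ^+ 2) = Q 0%N by apply/funext => y; rewrite /Q expr2.
  under eq_bigr do rewrite EQ.
  by rewrite -mulr_suml; apply: ler_wpM2r; [exact: E_ge0|exact: hD].
rewrite -mulrA ler_wpM2l//.
have -> : (fun y => h y * \sum_(i < M) h (iter i.+1 T y)) = (fun y => \sum_(i < M) Q i.+1 y).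
  by apply/funext => y; rewrite mulr_sumr.
rewrite E_sum// mulr_sumr; apply: ler_sum => i _.
rewrite E_sum//.
under eq_bigr do rewrite EQ.
rewrite -mulr_suml; apply: ler_wpM2r; first exact: E_ge0.
have [iM|Mi] := ltnP i.+1 M; last first.
  have -> : (M - i.+1 = 0)%N by lia.
  by rewrite big_ord0.
apply: le_trans (ler_norm _) _.
have := hO i.+1 iM; rewrite /corr /noise.
by under eq_bigr do rewrite !mulr1.
Qed.

End weak_type.

Section dyadic_scales.
Context {R : realType}.
Variable a : R.
Hypothesis a01 : 0 < a < 2^-1.

(** Comparable to the number of ones among the first 2^j bits. *)
Definition scale (j : nat) : R := (2 ^ j)%:R `^ (1 - a).

Lemma dyadic_powR (t : R) j : (2 ^ j)%:R `^ t = (2 `^ t) ^+ j.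
Proof.
by rewrite natrX -(powR_mulrn j (ler0n R 2)) -(powR_mulrn j (powR_ge0 2 t)) -!powRrM mulrC.
Qed.

Lemma gt1_powR2 (t : R) : 0 < t -> 1 < 2 `^ t.
Proof.
move=> t0; rewrite /powR pnatr_eq0 /= -[ltLHS]expR0 ltr_expR mulr_gt0// ln_gt0//.
by rewrite ltr1n.
Qed.

Lemma scaleE j : scale j = (2 `^ (1 - a)) ^+ j.
Proof. exact: dyadic_powR. Qed.

Lemma scale_gt0 j : 0 < scale j.
Proof. by rewrite powR_gt0// ltr0n expn_gt0. Qed.

Definition ratio_const : R := 2 `^ (1 - a) / (2 `^ (1 - a) - 1).
Definition decay_const : R := 2 `^ gain a / (2 `^ gain a - 1).

Lemma ratio_const_ge0 : 0 <= ratio_const.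
Proof.
have /andP[a0 a1] := a01; have := @gt1_powR2 (1 - a) ltac:(lra) => h.
by rewrite divr_ge0//; lra.
Qed.

Lemma gain_gt0 : 0 < gain a.
Proof. by have /andP[a0 a1] := a01; rewrite /gain; lra. Qed.

Lemma decay_const_ge0 : 0 <= decay_const.
Proof. have := gt1_powR2 gain_gt0 => h; by rewrite divr_ge0//; lra. Qed.

Lemma scale_decay j :
  (2 ^ j)%:R * (2 ^ j)%:R `^ (3 * gain a) / scale j ^+ 2 = ((2 `^ gain a) ^+ j)^-1.
Proof.
rewrite -dyadic_powR -powRN /scale.
have p0 : (2 ^ j)%:R != 0 :> R by rewrite pnatr_eq0 expn_eq0.
rewrite -{1}[(2 ^ j)%:R]powRr1// -powR_mulrn ?powR_ge0// -powRrM -powRN.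
rewrite -!powRD ?p0 ?implybT//; congr (_ `^ _).
by rewrite /gain; field.
Qed.

(** The scales grow geometrically, so the sum of those below v / l is of the
    order of the last one. *)
Lemma sum_below (l v : R) J : 0 < l -> 0 <= v ->
  \sum_(j < J) (if l * scale j < v then scale j else 0) <= ratio_const * (v / l).
Proof.
move=> l0 v0; have /andP[a0 a1] := a01.
apply: le_trans (geometric_below J (@gt1_powR2 (1 - a) ltac:(lra)) (divr_ge0 v0 (ltW l0))).
apply: ler_sum => j _; rewrite -scaleE ltr_pdivlMr// mulrC.
by case: ifP.
Qed.

(** The dual of [sum_below]: only scales above v / l contribute, and their
    inverses decrease geometrically. *)
Lemma sum_above (l v : R) J : 0 < l -> 0 <= v ->
  \sum_(j < J) (if v <= l * scale j then (scale j)^-1 * v ^+ 2 else 0) <=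
  ratio_const * (l * v).
Proof.
move=> l0; have /andP[a0 a1] := a01; rewrite le_eqVlt => /predU1P[<-|v0].
  by rewrite big1 ?mulr0// => j _; rewrite expr0n/= mulr0; case: ifP.
have h := @geometric_above _ _ (v / l) J (@gt1_powR2 (1 - a) ltac:(lra)) (divr_gt0 v0 l0).
have -> : ratio_const * (l * v) = ratio_const * (v / l)^-1 * v ^+ 2.
  by rewrite invf_div; field; rewrite gt_eqF.
apply: le_trans (ler_wpM2r (sqr_ge0 v) h); rewrite mulr_suml.
apply: ler_sum => j _; rewrite -scaleE ler_pdivrMr// [scale j * l]mulrC.
by case: ifP => // _; rewrite mul0r.
Qed.

Lemma sum_decay J : \sum_(j < J) ((2 `^ gain a) ^+ j)^-1 <= decay_const.
Proof.
have h := geometric_above J (gt1_powR2 gain_gt0) (@ltr01 R).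
rewrite invr1 mulr1 in h; apply: le_trans h; apply: ler_sum => j _.
by rewrite exprn_ege1// ltW// gt1_powR2 ?gain_gt0.
Qed.

End dyadic_scales.

Section weak_type.
Context {R : realType} {d : measure_display} {Y : measurableType d}.
Variables (mu : probability Y R) (T : Y -> Y).
Hypothesis hT : measure_preserving mu T.
Implicit Types (f g h : Y -> R).
Local Notation E f := (Rintegral mu setT f).
Local Notation L1 := (L1 mu).
Local Notation cst1 := (fun=> 1 : R).
Variables (a : R) (x : nat -> bool) (L : nat -> seq (nat -> R)) (M0 : nat).
Hypothesis a01 : 0 < a < 2^-1.
Hypothesis typ : forall M, (M0 <= M)%N -> typical a (L M) M x.
Hypothesis Lone : forall M, cst1 \in L M.

Lemma sum_sigma_le2 M : \sum_(k < M) sigma a k <= 2 * M%:R `^ (1 - a).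
Proof.
have /andP[a0 a1] := a01.
apply: le_trans (sum_sigma_le M _) _; first lra.
rewrite ler_wpM2r ?powR_ge0// invf_ple ?posrE; lra.
Qed.

Lemma noise_variance_le M : (M0 <= M)%N ->
  \sum_(k < M) ((x k)%:R - sigma a k) ^+ 2 <= 6 * M%:R `^ (1 - a).
Proof.
move=> /typ[_ h _ _]; have /andP[a0 a1] := a01.
have := sum_sigma_le2 M; move: h; rewrite /cnt natr_sum => h1 h2.
apply: (@le_trans _ _ (\sum_(k < M) ((x k)%:R + sigma a k))).
  apply: ler_sum => k _; have := sigma_gt0 a k; have := sigma_le1 k (ltW a0).
  by case: (x k) => /= ? ?; nra.
rewrite big_split /=; lra.
Qed.

Section level.
Variables (f : Y -> R) (l : R).
Hypothesis f1 : L1 f.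
Hypothesis f0 : forall y, 0 <= f y.
Hypothesis l0 : 0 < l.

Let mf : measurable_fun setT f. Proof. exact: L1_measurable f1. Qed.

(** Two truncations at scale j: by height, so that squares can be summed over
    scales, and by the forward average over a window of length 2^j, so that
    the off-diagonal terms can be summed over lags. *)
Definition low_set j : set Y :=
  [set y | f y <= l * scale a j] `&` [set y | orbit_sum T f (2 ^ j).+1 y <= l * (2 ^ j)%:R].

Lemma measurable_low_set j : measurable (low_set j).
Proof.
apply: measurableI; first exact: measurable_le_cst.
by apply: measurable_le_cst; exact: (measurable_orbit_sum hT).
Qed.

Definition low_part j y := f y * \1_(low_set j) y.

Lemma low_partP j y : low_set j y -> low_part j y = f y.
Proof. by move=> h; rewrite /low_part indicE mem_set// mulr1. Qed.

Lemma low_part0 j y : ~ low_set j y -> low_part j y = 0.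
Proof. by move=> h; rewrite /low_part indicE memNset// mulr0. Qed.

Lemma low_part_ge0 j y : 0 <= low_part j y.
Proof. by rewrite /low_part mulr_ge0// indicE. Qed.

Lemma low_part_le j y : low_part j y <= f y.
Proof. by rewrite /low_part ler_piMr// indicE; case: (_ \in _). Qed.

Lemma low_part_bounded j y : 0 <= low_part j y <= l * scale a j.
Proof.
rewrite low_part_ge0 /=; have [h|h] := pselect (low_set j y).
  by rewrite low_partP//; case: h.
by rewrite low_part0// mulr_ge0// ltW// scale_gt0.
Qed.

Lemma measurable_low_part j : measurable_fun setT (low_part j).
Proof.
by apply: measurable_funM => //; apply: measurable_indic; exact: measurable_low_set.
Qed.

Lemma L1_low_part_sqr j : L1 (fun y => low_part j y ^+ 2).
Proof.
apply: (@L1_bounded _ _ _ _ _ ((l * scale a j) ^+ 2)).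
  by apply: measurable_funX; exact: measurable_low_part.
move=> y; have /andP[h1 h2] := low_part_bounded j y.
by rewrite ger0_norm ?sqr_ge0// ler_sqr ?nnegrE//; apply: le_trans h2.
Qed.

(** On [low_set] the sum of f over the window is at most l times its length,
    and the low part at the later points is at most f. *)
Lemma low_part_window j y :
  low_part j y * \sum_(i < 2 ^ j) low_part j (iter i.+1 T y) <= l * (2 ^ j)%:R * f y.
Proof.
have [h|h] := pselect (low_set j y); last first.
  by rewrite low_part0// mul0r !mulr_ge0// ltW.
rewrite low_partP// mulrC ler_wpM2r//.
case: h => _ /= h; apply: le_trans h; rewrite /orbit_sum big_ord_recl /= -[leLHS]add0r.
by apply: lerD => //; apply: ler_sum => i _; exact: low_part_le.
Qed.

Lemma L1_window j :
  L1 (fun y => low_part j y * \sum_(i < 2 ^ j) low_part j (iter i.+1 T y)).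
Proof.
apply: (@L1_le _ _ _ _ _ (fun y => l * (2 ^ j)%:R * f y)); first exact: L1Z.
  apply: measurable_funM; first exact: measurable_low_part.
  apply: measurable_sum => i; apply: (measurable_comp_iter hT); exact: measurable_low_part.
move=> y; rewrite ger0_norm ?low_part_window//.
by rewrite mulr_ge0 ?low_part_ge0// sumr_ge0// => i _; exact: low_part_ge0.
Qed.

(** The diagonal carries the variance of order [scale], the other terms the
    correlation bound times a window sum. *)
Lemma dyadic_L2 j : (M0 <= 2 ^ j)%N ->
  L1 (fun y => noise_sum T a x (low_part j) (2 ^ j) y ^+ 2) /\
  E (fun y => noise_sum T a x (low_part j) (2 ^ j) y ^+ 2) <=
  6 * scale a j * E (fun y => low_part j y ^+ 2) +
  2 * (2 ^ j)%:R `^ (3 * gain a) * (l * (2 ^ j)%:R * E f).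
Proof.
move=> hj.
have [] := @E_noise_sum_sqr _ _ _ mu T hT a x (low_part j) (2 ^ j) (l * scale a j)
  (6 * scale a j) ((2 ^ j)%:R `^ (3 * gain a)) (measurable_low_part j) (low_part_bounded j)
  (powR_ge0 _ _) (noise_variance_le hj).
  by move=> i iM; have [_ _ _ h] := typ hj; exact: h (Lone _) (Lone _) iM.
move=> h1 h2; split => //; apply: le_trans h2 _; rewrite lerD2l; apply: ler_wpM2l.
  by rewrite mulr_ge0// powR_ge0.
rewrite -EZ//; apply: E_le; [exact: L1_window|exact: L1Z|exact: low_part_window].
Qed.

(** Off the maximal set, the points of the orbit up to time 2^j satisfy the
    window condition because their windows stay within 3 * 2^j, so only the
    height condition can fail; then the average only sees the low part, whose
    smooth sum takes up at most 2 l. *)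
Lemma noise_sum_large j n y : (3 * 2 ^ j <= n)%N ->
  ~ max_set T (fun y => f y - l / 3) n y ->
  (forall k, (k < 2 ^ j)%N -> x k -> f (iter k.+1 T y) <= l * scale a j) ->
  3 * l * scale a j < sparse_sum T x f (2 ^ j) y ->
  l * scale a j < noise_sum T a x (low_part j) (2 ^ j) y.
Proof.
move=> jn hmax hlow hA; have /andP[a0 a1] := a01.
have hsum m : (m <= n)%N -> orbit_sum T f m y <= l / 3 * m%:R.
  move=> mn; rewrite leNgt; apply/negP => h; apply: hmax.
  exact: max_set_of_average h.
have M1 : (0 < 2 ^ j)%N by rewrite expn_gt0.
have shift m : \sum_(k < m) f (iter k.+1 T y) <= orbit_sum T f m.+1 y.
  by rewrite /orbit_sum big_ord_recl lerDr.
have xlow k : (k < 2 ^ j)%N -> x k -> low_part j (iter k.+1 T y) = f (iter k.+1 T y).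
  move=> kj xk; apply: low_partP; split => /=; first exact: hlow.
  apply: (@le_trans _ _ (orbit_sum T f (2 * 2 ^ j).+1 y)).
    rewrite -iterS /orbit_sum.
    have -> : \sum_(k0 < (2 ^ j).+1) f (iter k0 T (iter k.+1 T y)) =
        \sum_(k.+1 <= i < k.+1 + (2 ^ j).+1) f (iter i T y).
      have := big_addn 0 (k.+1 + (2 ^ j).+1) k.+1 xpredT (fun i => f (iter i T y)).
      rewrite add0n => ->; rewrite addKn big_mkord.
      by apply: eq_bigr => i _; rewrite iterD.
    rewrite -(big_mkord xpredT (fun i => f (iter i T y))).
    rewrite [leRHS](@big_cat_nat _ _ _ k.+1)//=; last by lia.
    rewrite -[leLHS]add0r lerD ?sumr_ge0//.
    rewrite [leRHS](@big_cat_nat _ _ _ (k.+1 + (2 ^ j).+1))//=; [|lia|lia].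
    by rewrite lerDl sumr_ge0.
  apply: le_trans (hsum _ _) _; first by lia.
  have -> : l * (2 ^ j)%:R = l / 3 * (3 * 2 ^ j)%:R by rewrite natrM; field.
  rewrite ler_wpM2l ?divr_ge0 ?(ltW l0)// ler_nat; lia.
have sE : sparse_sum T x f (2 ^ j) y = sparse_sum T x (low_part j) (2 ^ j) y.
  apply: eq_bigr => k _; case xk : (x k); last by rewrite !mul0r.
  by rewrite xlow.
have smooth : \sum_(k < 2 ^ j) sigma a k * low_part j (iter k.+1 T y) <= 2 * l * scale a j.
  apply: (@le_trans _ _ (l * \sum_(k < 2 ^ j) sigma a k)); last first.
    have := sum_sigma_le2 (2 ^ j); rewrite -/(scale a j) => h.
    by have := ler_wpM2l (ltW l0) h; lra.
  apply: (@decreasing_weights _ (sigma a) (fun k => low_part j (iter k.+1 T y))) => [k m km|k|m mj].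
  - by apply: sigma_nincr => //; exact: ltW.
  - exact/ltW/sigma_gt0.
  - apply: (@le_trans _ _ (\sum_(k < m) f (iter k.+1 T y))).
      by apply: ler_sum => k _; exact: low_part_le.
    case: m mj => [|m] mj; first by rewrite big_ord0 mulr0.
    apply: le_trans (shift _) _; apply: le_trans (hsum _ _) _; first by lia.
    have -> : l * m.+1%:R = l / 3 * (3 * m.+1)%:R by rewrite natrM; field.
    rewrite ler_wpM2l ?divr_ge0 ?(ltW l0)// ler_nat; lia.
have -> : noise_sum T a x (low_part j) (2 ^ j) y = sparse_sum T x (low_part j) (2 ^ j) y
    - \sum_(k < 2 ^ j) sigma a k * low_part j (iter k.+1 T y).
  by rewrite -sumrB; apply: eq_bigr => k _; rewrite mulrBl.
rewrite -sE; lra.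
Qed.

End level.
End weak_type.

Section weak_type_inequality.
Context {R : realType} {d : measure_display} {Y : measurableType d}.
Variables (mu : probability Y R) (T : Y -> Y).
Hypothesis hT : measure_preserving mu T.
Implicit Types (f g h : Y -> R).
Local Notation E f := (Rintegral mu setT f).
Local Notation L1 := (L1 mu).
Local Notation cst1 := (fun=> 1 : R).
Variables (a : R) (x : nat -> bool) (L : nat -> seq (nat -> R)) (M0 : nat).
Hypothesis a01 : 0 < a < 2^-1.
Hypothesis typ : forall M, (M0 <= M)%N -> typical a (L M) M x.
Hypothesis Lone : forall M, cst1 \in L M.

Definition weak_const : R :=
  3 + 4 * ratio_const a + (6 * ratio_const a + 2 * decay_const a).

Lemma weak_const_ge0 : 0 <= weak_const.
Proof.
have := ratio_const_ge0 a01; have := decay_const_ge0 a01; rewrite /weak_const; lra.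
Qed.

Definition high_average f l j : set Y :=
  [set y | 3 * l * scale a j < sparse_sum T x f (2 ^ j) y].

Lemma measurable_high_average f l j : measurable_fun setT f ->
  measurable (high_average f l j).
Proof. by move=> mf; apply: measurable_gt_cst; exact: (measurable_sparse_sum hT). Qed.

Definition scales (J : nat) : seq nat := [seq j <- iota 0 J | (M0 <= 2 ^ j)%N].

Lemma mem_scales j J : (j \in scales J) = (j < J)%N && (M0 <= 2 ^ j)%N.
Proof. by rewrite mem_filter mem_iota andbC. Qed.

Lemma sum_scales_le (F : nat -> R) J : (forall j, 0 <= F j) ->
  \sum_(j <- scales J) F j <= \sum_(j < J) F j.
Proof.
move=> F0; rewrite big_filter -(big_mkord xpredT F) /index_iota subn0.
rewrite big_mkcond; apply: ler_sum => j _; by case: ifP.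
Qed.

(** The indicator of the exceptional set is dominated by that of the maximal
    set of f, plus the number of ones at which f exceeds its height at some
    scale, plus normalized squares of noise sums. Each of the three is
    integrated separately. *)
Lemma weak_type_scales f l J : L1 f -> (forall y, 0 <= f y) -> 0 < l ->
  (mu (\bigcup_(j in [set` scales J]) high_average f l j) <=
   (weak_const * (l^-1 * E f))%:E)%E.
Proof.
move=> f1 f0 l0; set B := \bigcup_(_ in _) _.
have mf : measurable_fun setT f by exact: L1_measurable f1.
have mB : measurable B by apply: bigcup_measurable => j _; exact: measurable_high_average.
pose n := (3 * 2 ^ J)%N.
pose A := max_set T (fun y => f y - l / 3) n.
have fl1 : L1 (fun y => f y - l / 3) by apply: L1B => //; exact: L1_cst.
have mA : measurable A by exact: (measurable_max_set hT).
pose G j := [set y | l * scale a j < f y].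
have mG j : measurable (G j) by exact: measurable_gt_cst.
pose V j y := noise_sum T a x (low_part T a f l j) (2 ^ j) y ^+ 2.
pose c j := ((l * scale a j) ^+ 2)^-1.
have sc0 j : 0 < scale a j by exact: scale_gt0.
have c0 j : 0 <= c j by rewrite invr_ge0 sqr_ge0.
have V1 j : j \in scales J -> L1 (V j).
  by rewrite mem_scales => /andP[_ hj]; have [] := dyadic_L2 hT a01 typ Lone f1 f0 l0 hj.
pose V' j y := if j \in scales J then V j y else 0.
have V'1 j : L1 (V' j).
  rewrite /V'; case: (j \in scales J) (@V1 j) => [V1'|_]; last exact: L1_cst.
  exact: V1'.
have G1 j k : L1 (fun y => (x k)%:R * \1_(G j) (iter k.+1 T y)).
  by apply: L1Z; apply: (L1_comp hT); exact: L1_indic.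
pose W y : R := \1_A y +
  (\sum_(j <- scales J) \sum_(k < 2 ^ j) (x k)%:R * \1_(G j) (iter k.+1 T y) +
   \sum_(j <- scales J) c j * V' j y).
have W2 : L1 (fun y => \sum_(j <- scales J) \sum_(k < 2 ^ j) (x k)%:R * \1_(G j) (iter k.+1 T y)).
  by apply: L1_sum => j; apply: L1_sum => k.
have W3 : L1 (fun y => \sum_(j <- scales J) c j * V' j y).
  by apply: L1_sum => j; exact: L1Z.
have W1 : L1 W by apply: L1D; [exact: L1_indic|exact: L1D].
have t1 y : (0 : R) <= \1_A y by rewrite indicE.
have t2' j k y : 0 <= (x k)%:R * \1_(G j) (iter k.+1 T y) :> R by rewrite mulr_ge0// indicE.
have t2 y : 0 <= \sum_(j <- scales J) \sum_(k < 2 ^ j) (x k)%:R * \1_(G j) (iter k.+1 T y) :> R.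
  by apply: sumr_ge0 => j _; apply: sumr_ge0.
have t3' j y : 0 <= c j * V' j y.
  by rewrite mulr_ge0// /V'; case: ifP => // _; exact: sqr_ge0.
have t3 y : 0 <= \sum_(j <- scales J) c j * V' j y by apply: sumr_ge0.
have BW y : \1_B y <= W y.
  rewrite indicE; have [|_] := boolP (y \in B); last by rewrite !addr_ge0.
  rewrite inE => -[j /= jJ hj]; have := jJ; rewrite mem_scales => /andP[jJ' M0j].
  have [yA|yA] := pselect (A y).
    by rewrite /W indicE mem_set// -[leLHS]addr0 lerD2l addr_ge0.
  have [[k [kj xk hk]]|hlow] := pselect (exists k, [/\ (k < 2 ^ j)%N, x k & l * scale a j < f (iter k.+1 T y)]).
    rewrite /W addrCA -[leLHS]addr0 lerD ?addr_ge0//.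
    rewrite (big_rem j)//= -[leLHS]addr0 lerD//; last first.
      by apply: sumr_ge0 => i _; apply: sumr_ge0.
    rewrite (bigD1 (Ordinal kj))//= xk mul1r indicE mem_set// lerDl.
    by apply: sumr_ge0.
  rewrite /W addrA -[leLHS]add0r lerD ?addr_ge0//.
  rewrite (big_rem j)//= -[leLHS]addr0 lerD//; last by apply: sumr_ge0.
  rewrite /V' jJ /c ler_pdivlMl ?exprn_gt0 ?mulr_gt0// mulr1 /V.
  have h : l * scale a j < noise_sum T a x (low_part T a f l j) (2 ^ j) y.
    apply: (noise_sum_large a01 f1 f0 l0 _ yA _ hj).
      by rewrite /n leq_pmul2l// leq_exp2l// ltnW.
    move=> k kj xk; rewrite leNgt; apply/negP => h; apply: hlow; exists k; split => //.
  have h0 : 0 <= l * scale a j by rewrite mulr_ge0// ltW.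
  by rewrite ler_sqr ?nnegrE// ?ltW// (le_lt_trans h0).
rewrite -(E_indic mu mB) lee_fin; apply: (@le_trans _ _ (E W)).
  by apply: E_le => //; exact: L1_indic.
rewrite /W ED; [|exact: L1_indic|exact: L1D].
rewrite ED// /weak_const 2!mulrDl; rewrite -[leRHS]addrA; apply: lerD; last apply: lerD.
- have := maximal_ergodic hT n f1 f0 (divr_gt0 l0 (ltr0n R 3)).
  by rewrite invf_div mulrA.
- rewrite E_sum; last by move=> j; exact: L1_sum.
  have EG j k : E (fun y => (x k)%:R * \1_(G j) (iter k.+1 T y)) = (x k)%:R * E \1_(G j).
    by rewrite EZ ?(E_comp hT)//; [exact: L1_indic|apply: (L1_comp hT); exact: L1_indic].
  under eq_bigr do [rewrite E_sum//; under eq_bigr do rewrite EG; rewrite -mulr_suml].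
  apply: (@le_trans _ _ (\sum_(j <- scales J) 4 * scale a j * E \1_(G j))).
    rewrite !big_seq; apply: ler_sum => j; rewrite mem_scales => /andP[_ M0j].
    apply: ler_wpM2r; first by apply: E_ge0 => y; rewrite indicE.
    by have [_ h _ _] := typ M0j; move: h; rewrite /cnt natr_sum.
  apply: le_trans (sum_scales_le _ _) _.
    by move=> j; rewrite !mulr_ge0 ?(ltW (sc0 _))//; apply: E_ge0 => y; rewrite indicE.
  have -> : \sum_(j < J) 4 * scale a j * E \1_(G j) =
     E (fun y => \sum_(j < J) 4 * scale a j * \1_(G j) y).
    rewrite E_sum; last by move=> j; apply: L1Z; exact: L1_indic.
    by apply: eq_bigr => j _; rewrite EZ//; exact: L1_indic.
  rewrite mulrA -EZ//; apply: E_le; [|exact: L1Z|].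
    by apply: L1_sum => j; apply: L1Z; exact: L1_indic.
  move=> y; have := sum_below a01 J l0 (f0 y) => h.
  have -> : 4 * ratio_const a / l * f y = 4 * (ratio_const a * (f y / l)) by ring.
  apply: (le_trans _ (ler_wpM2l (ler0n R 4) h)); rewrite mulr_sumr; apply: ler_sum => j _.
  rewrite indicE; have [yG|yG] := pselect (G j y).
    by rewrite mem_set// mulr1 ifT.
  by rewrite memNset// mulr0 mulr_ge0//; case: ifP => // _; exact: ltW.
rewrite E_sum; last by move=> j; exact: L1Z.
have step j : j \in scales J -> E (fun y => c j * V' j y) <=
    6 * (l ^+ 2)^-1 * ((scale a j)^-1 * E (fun y => low_part T a f l j y ^+ 2)) +
    2 * (l^-1 * E f) * ((2 `^ gain a) ^+ j)^-1.
  move=> jJ; have -> : (fun y => c j * V' j y) = (fun y => c j * V j y).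
    by apply/funext => y; rewrite /V' jJ.
  rewrite EZ; last exact: V1.
  move: jJ; rewrite mem_scales => /andP[_ hj].
  have [_ h] := dyadic_L2 hT a01 typ Lone f1 f0 l0 hj.
  apply: le_trans (ler_wpM2l (c0 j) h) _.
  rewrite -scale_decay// /c le_eqVlt; apply/orP; left; apply/eqP.
  by field; rewrite !gt_eqF.
rewrite big_seq; apply: le_trans (ler_sum _ step) _; rewrite -big_seq.
rewrite big_split /= [leRHS]mulrDl; apply: lerD; last first.
  rewrite -mulr_sumr.
  have Ef0 : 0 <= l^-1 * E f by rewrite mulr_ge0 ?invr_ge0 ?(ltW l0)//; exact: E_ge0.
  have h : \sum_(j <- scales J) ((2 `^ gain a) ^+ j)^-1 <= decay_const a.
    apply: le_trans (sum_scales_le _ _) (sum_decay a01 J).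
    by move=> j; rewrite invr_ge0 exprn_ge0// powR_ge0.
  have := ler_wpM2l Ef0 h; lra.
rewrite -mulr_sumr.
suff h : \sum_(j <- scales J) (scale a j)^-1 * E (fun y => low_part T a f l j y ^+ 2) <=
    ratio_const a * l * E f.
  have l20 : 0 <= 6 * l ^- 2 by rewrite mulr_ge0// invr_ge0 sqr_ge0.
  apply: le_trans (ler_wpM2l l20 h) _.
  rewrite le_eqVlt; apply/orP; left; apply/eqP; field; by rewrite gt_eqF.
have sq1 j := L1_low_part_sqr hT a f1 f0 l0 j.
apply: le_trans (sum_scales_le _ _) _.
  by move=> j; rewrite mulr_ge0 ?invr_ge0 ?(ltW (sc0 _))//; apply: E_ge0 => y; exact: sqr_ge0.
have -> : \sum_(j < J) (scale a j)^-1 * E (fun y => low_part T a f l j y ^+ 2) =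
   E (fun y => \sum_(j < J) (scale a j)^-1 * low_part T a f l j y ^+ 2).
  rewrite E_sum; last by move=> j; exact: L1Z.
  by apply: eq_bigr => j _; rewrite EZ.
rewrite -EZ//; apply: E_le; [|exact: L1Z|].
  by apply: L1_sum => j; exact: L1Z.
move=> y; have h := sum_above a01 J l0 (f0 y).
rewrite -mulrA; apply: le_trans h; apply: ler_sum => j _.
have [yl|yl] := pselect (low_set T a f l j y).
  by rewrite low_partP// ifT//; case: yl.
rewrite low_part0// expr0n /= mulr0; case: ifP => // _.
by rewrite mulr_ge0 ?invr_ge0 ?(ltW (sc0 _))// sqr_ge0.
Qed.

(** The factor 4 comes from a factor 2 in the lower bound of cnt x M and from
    M >= 2^j / 2. *)
Lemma cnt_dyadic M : (M0 <= M)%N -> (0 < M)%N ->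
  exists j, (M <= 2 ^ j)%N /\ scale a j <= 4 * (cnt x M)%:R.
Proof.
move=> M0M Mp; have /andP[a0 a1] := a01.
have [j /andP[j1 j2]] : exists j, (M <= 2 ^ j <= 2 * M)%N.
  have [h1|h1] := leqP M 1.
    by exists 0%N; rewrite expn0; lia.
  exists (up_log 2 M); rewrite (up_logP M (leqnn 2)).
  have [h2 _] := andP (@up_log_bounds 2 M (leqnn _) h1).
  have : (0 < up_log 2 M)%N by rewrite up_log_gt0.
  by move: h2; case: (up_log 2 M) => //= n h2 _; rewrite expnS; lia.
exists j; split => //; have [h _ _ _] := typ M0M.
apply: (@le_trans _ _ (2 * M%:R `^ (1 - a))); last by lra.
apply: (@le_trans _ _ ((2 * M)%:R `^ (1 - a))).
  by apply: ge0_ler_powR; rewrite ?nnegrE ?ler_nat//; lra.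
rewrite natrM powRM// ler_wpM2r ?powR_ge0//.
by apply: ler1_powR; rewrite ?ler1n//; lra.
Qed.

Lemma sparse_sum_nondecr f M N y : (forall y, 0 <= f y) -> (M <= N)%N ->
  sparse_sum T x f M y <= sparse_sum T x f N y.
Proof.
move=> f0 MN; pose F k : R := (x k)%:R * f (iter k.+1 T y).
rewrite /sparse_sum -!(big_mkord xpredT F) (@big_cat_nat _ _ _ M 0 N)//=.
by rewrite lerDl sumr_ge0// => k _; rewrite mulr_ge0.
Qed.

(** By monotonicity in M for a nonnegative f, dyadic scales suffice. *)
Lemma weak_type f l : L1 f -> (forall y, 0 <= f y) -> 0 < l ->
  exists B : set Y, [/\ measurable B, (mu B <= (weak_const * (l^-1 * E f))%:E)%E &
    forall y, ~ B y -> forall M, (M0 <= M)%N -> (0 < M)%N ->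
      sparse_sum T x f M y <= 12 * l * (cnt x M)%:R].
Proof.
move=> f1 f0 l0; have mf := L1_measurable f1.
pose B J := \bigcup_(j in [set` scales J]) high_average f l j.
have mB J : measurable (B J) by apply: bigcup_measurable => j _; exact: measurable_high_average.
have Bnd : nondecreasing_seq B.
  move=> m n mn; apply/subsetPset => y [j /=]; rewrite mem_scales => /andP[jm M0j] h.
  by exists j => //=; rewrite mem_scales M0j (leq_trans jm mn).
have mBU : measurable (\bigcup_J B J) by exact: bigcupT_measurable.
exists (\bigcup_J B J); split => //.
- have cv := @nondecreasing_cvg_mu _ _ _ mu _ mB mBU Bnd.
  rewrite -(cvg_lim (@ereal_hausdorff R) cv); apply: lime_le; first exact: cvgP cv.
  by apply: nearW => J; exact: weak_type_scales.
move=> y yB M M0M Mp; have [j [Mj hj]] := cnt_dyadic M0M Mp.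
apply: le_trans (sparse_sum_nondecr y f0 Mj) _.
apply: (@le_trans _ _ (3 * l * scale a j)).
  rewrite leNgt; apply/negP => h; apply: yB; exists j.+1 => //; exists j => //=.
  by rewrite mem_scales ltnSn (leq_trans M0M Mj).
by have := ler_wpM2l (ltW l0) hj; lra.
Qed.

End weak_type_inequality.

(** * A Schur test for Gram matrices *)

Section gram.
Context {R : realType}.
Implicit Types (A : nat -> nat -> R) (phi u : nat -> R) (D O : R).

(** By duality: with u = A phi, the sum S of the u_l^2 is the pairing of phi
    with the adjoint applied to u, and the norm of the latter is governed by
    the row sums of the Gram matrix. *)
Lemma gram_bound A phi D O n J : 0 < D -> 0 <= O ->
  (forall l, (l < n)%N -> \sum_(j < J) A l j ^+ 2 <= D) ->
  (forall l m, (l < m < n)%N -> `|\sum_(j < J) A l j * A m j| <= O) ->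
  \sum_(l < n) (\sum_(j < J) A l j * phi j) ^+ 2 <=
  (D + n%:R * O) * \sum_(j < J) phi j ^+ 2.
Proof.
move=> D0 O0 diag off; set K := D + n%:R * O.
have K0 : 0 < K by rewrite ltr_wpDr// mulr_ge0.
pose u l := \sum_(j < J) A l j * phi j.
pose v j := \sum_(l < n) u l * A l j.
set S := \sum_(l < n) _.
pose G l m := \sum_(j < J) A l j * A m j.
have SE : S = \sum_(j < J) phi j * v j.
  rewrite /S; under eq_bigr => l _ do rewrite -/(u l) expr2 {2}/u mulr_sumr.
  rewrite exchange_big /=; apply: eq_bigr => j _.
  by rewrite /v mulr_sumr; apply: eq_bigr => l _; rewrite -/(u l); ring.
have vE : \sum_(j < J) v j ^+ 2 = \sum_(l < n) \sum_(m < n) u l * u m * G l m.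
  under eq_bigr => j _ do rewrite /v expr2 mulr_suml.
  rewrite exchange_big /=; apply: eq_bigr => l _.
  under eq_bigr => j _ do rewrite mulr_sumr.
  rewrite exchange_big /=; apply: eq_bigr => m _.
  by rewrite /G mulr_sumr; apply: eq_bigr => j _; ring.
pose W (l m : 'I_n) := if l == m then D else O.
have GW (l m : 'I_n) : `|G l m| <= W l m.
  rewrite /W; case: eqVneq => [->|lm].
    rewrite /G ger0_norm; last by apply: sumr_ge0 => j _; rewrite -expr2 sqr_ge0.
    by apply: le_trans (diag m (ltn_ord m)); under eq_bigr do rewrite -expr2.
  have [h|h|h] := ltngtP l m.
  - by apply: off; rewrite h ltn_ord.
  - rewrite /G; under eq_bigr do rewrite mulrC.
    by apply: off; rewrite h ltn_ord.
  - by case/eqP: lm; apply: val_inj.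
have WS (l : 'I_n) : \sum_(m < n) W l m <= K.
  rewrite (bigD1 l)//= {1}/W eqxx lerD2l.
  apply: (@le_trans _ _ (\sum_(m < n) O)); last by rewrite sumr_const card_ord mulr_natl.
  rewrite [leRHS](bigD1 l)//= -[leLHS]add0r lerD//.
  by apply: ler_sum => m ml; rewrite /W eq_sym (negbTE ml).
have W0 l m : 0 <= W l m by rewrite /W; case: ifP => // _; exact: ltW.
have vS : \sum_(j < J) v j ^+ 2 <= K * S.
  rewrite vE.
  apply: (@le_trans _ _ (\sum_(l < n) \sum_(m < n) (2^-1 * (u l ^+ 2 * W l m) + 2^-1 * (u m ^+ 2 * W m l)))).
    apply: ler_sum => l _; apply: ler_sum => m _.
    have WC : W m l = W l m by rewrite /W eq_sym.
    rewrite WC; apply: le_trans (ler_norm _) _; rewrite !normrM.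
    apply: (@le_trans _ _ (`|u l| * `|u m| * W l m)).
      by apply: ler_wpM2l; rewrite ?mulr_ge0.
    (* |u_l u_m| <= (u_l^2 + u_m^2) / 2 makes the two factors separate. *)
    have := sqr_ge0 (`|u l| - `|u m|); rewrite sqrrB !real_normK ?num_real// => h.
    have := W0 l m; nra.
  have half : \sum_(l < n) \sum_(m < n) 2^-1 * (u l ^+ 2 * W l m) <= 2^-1 * (K * S).
    rewrite /S !mulr_sumr; apply: ler_sum => l _.
    rewrite -!mulr_sumr ler_wpM2l// mulrC ler_wpM2r ?sqr_ge0//.
  under eq_bigr do rewrite big_split /=.
  rewrite big_split /= [X in _ + X]exchange_big /=.
  have := lerD half half; move/le_trans; apply; lra.
(* 2 phi v <= K phi^2 + v^2 / K, and the last sum is at most S. *)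
have h : 2 * S <= K * \sum_(j < J) phi j ^+ 2 + K^-1 * \sum_(j < J) v j ^+ 2.
  rewrite SE !mulr_sumr -big_split /=; apply: ler_sum => j _.
  have := sqr_ge0 (K * phi j - v j) => hh.
  have : 0 <= K^-1 * (K * phi j - v j) ^+ 2 by rewrite mulr_ge0// invr_ge0 ltW.
  have -> : K^-1 * (K * phi j - v j) ^+ 2 =
    K * phi j ^+ 2 - 2 * (phi j * v j) + K^-1 * v j ^+ 2.
    by field; rewrite gt_eqF.
  lra.
have : K^-1 * \sum_(j < J) v j ^+ 2 <= S by rewrite ler_pdivrMl.
lra.
Qed.

End gram.

(** * The maximum over the weights *)

Section max_over_weights.
Context {R : realType} {d : measure_display} {Y : measurableType d}.
Variables (mu : probability Y R) (T : Y -> Y).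
Hypothesis hT : measure_preserving mu T.
Implicit Types (f g h : Y -> R) (b : nat -> R).
Local Notation E f := (Rintegral mu setT f).
Local Notation L1 := (L1 mu).
Local Notation cst1 := (fun=> 1 : R).
Variables (a : R) (x : nat -> bool) (L : nat -> seq (nat -> R)) (M0 : nat).
Hypothesis a01 : 0 < a < 2^-1.
Hypothesis typ : forall M, (M0 <= M)%N -> typical a (L M) M x.
Hypothesis Lone : forall M, cst1 \in L M.
Hypothesis Lle1 : forall M b, b \in L M -> forall n, (0 < n)%N -> `|b n| <= 1.

Definition noise_average b f M y : R := \sum_(k < M) noise a b x k * f (iter k.+1 T y).

(** The maximum runs over a list with exp (M^small) entries; summing over it
    instead would lose far more than the available gain. *)
Definition max_noise f M y : R :=
  \big[Num.max/0]_(b <- L M) noise_average b f M y ^+ 2.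

Lemma bigmax_attained (I : eqType) (s : seq I) (F : I -> R) : s != [::] ->
  (forall i, 0 <= F i) -> exists2 i, i \in s & \big[Num.max/0]_(j <- s) F j = F i.
Proof.
move=> s0 F0; elim: s s0 => // i s IH _; rewrite big_cons.
have [->|s0] := eqVneq s [::].
  by exists i; rewrite ?mem_head// big_nil max_l.
have [j js ->] := IH s0; rewrite /Num.max; case: ifP => _.
  by exists j; rewrite // inE js orbT.
by exists i; rewrite // mem_head.
Qed.

Lemma max_noise_attained f M y :
  exists2 b, b \in L M & max_noise f M y = noise_average b f M y ^+ 2.
Proof.
apply: (@bigmax_attained _ (L M) (fun b => noise_average b f M y ^+ 2)).
  by apply/eqP => L0; have := Lone M; rewrite L0.
by move=> b; exact: sqr_ge0.
Qed.

Lemma noise_average_le_max f M y b : b \in L M ->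
  noise_average b f M y ^+ 2 <= max_noise f M y.
Proof. move=> bL.
exact: (@le_bigmax_seq _ _ _ (L M) 0 b xpredT (fun b => noise_average b f M y ^+ 2) bL isT). Qed.

Lemma measurable_max_noise f M : measurable_fun setT f ->
  measurable_fun setT (max_noise f M).
Proof.
move=> mf; rewrite /max_noise; elim: (L M) => [|b s IH].
  by under [X in measurable_fun _ X]funext do rewrite big_nil; exact: measurable_cst.
under [X in measurable_fun _ X]funext do rewrite big_cons.
apply: measurable_maxr => //; apply: measurable_funX; apply: measurable_sum => k.
by apply: measurable_funM => //; exact: (measurable_comp_iter hT).
Qed.

(** Row l of the matrix sends the values of f along the orbit of y to the
    noise sum at T^l y. *)
Definition shifted_row (b : nat -> R) M l j : R :=
  if (l <= j < l + M)%N then noise a b x (j - l) else 0.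

Lemma shifted_row_sum b M l J (F : nat -> R) : (l + M <= J)%N ->
  \sum_(j < J) shifted_row b M l j * F j = \sum_(k < M) noise a b x k * F (l + k)%N.
Proof.
move=> lJ; rewrite -(big_mkord xpredT (fun j => shifted_row b M l j * F j)).
rewrite (@big_cat_nat _ _ _ l)//=; last by apply: leq_trans lJ; rewrite leq_addr.
rewrite [X in X + _]big_nat_cond big1 ?add0r; last first.
  by move=> j; rewrite andbT /= => jl; rewrite /shifted_row leqNgt jl mul0r.
rewrite (@big_cat_nat _ _ _ (l + M))//= ?leq_addr//.
rewrite [X in _ + X]big_nat_cond [X in _ + X]big1 ?addr0; last first.
  by move=> j; rewrite andbT => /andP[jl _]; rewrite /shifted_row ltnNge jl andbF mul0r.
have := big_addn 0 (l + M) l xpredT (fun j => shifted_row b M l j * F j).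
rewrite add0n => ->; rewrite addKn big_mkord; apply: eq_bigr => k _.
by rewrite /shifted_row leq_addl addnK addnC ltn_add2l ltn_ord.
Qed.

Lemma shifted_row_corr b c M l (h J : nat) : (0 < h < M)%N -> (l + h + M <= J)%N ->
  \sum_(j < J) shifted_row b M l j * shifted_row c M (l + h) j = corr a c b x M h.
Proof.
move=> /andP[h0 hM] lJ; under eq_bigr do rewrite mulrC.
rewrite shifted_row_sum// /corr.
rewrite -(big_mkord xpredT (fun k => noise a c x k * shifted_row b M l (l + h + k)%N)).
rewrite (@big_cat_nat _ _ _ (M - h))//= ?leq_subr//.
rewrite [X in _ + X]big_nat_cond [X in _ + X]big1 ?addr0; last first.
  move=> k; rewrite andbT => /andP[kM _]; rewrite /shifted_row.
  have -> : (l + h + k < l + M)%N = false by apply/negbTE; rewrite -leqNgt; lia.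
  by rewrite andbF mulr0.
rewrite big_mkord; apply: eq_bigr => k _; rewrite /shifted_row.
have kM := ltn_ord k.
have -> : (l <= l + h + k < l + M)%N by apply/andP; split; lia.
by congr (_ * noise _ _ _ _); lia.
Qed.

Lemma noise_sqr_sum_le b M : (M0 <= M)%N -> b \in L M ->
  \sum_(k < M) noise a b x k ^+ 2 <= 6 * M%:R `^ (1 - a).
Proof.
move=> M0M bL; apply: le_trans (noise_variance_le a01 typ M0M).
apply: ler_sum => k _; rewrite /noise exprMn ler_piMr ?sqr_ge0//.
by rewrite -real_normK ?num_real// expr_le1// (Lle1 bL).
Qed.

(** The weight attaining the maximum may vary with the point T^l y of the
    orbit. The bounds of [typical] hold for all pairs of weights, so the Gram
    matrix of the chosen rows is still almost diagonal. *)
Lemma orbit_max_noise f M (B : R) y : (M0 <= M)%N -> (0 < M)%N ->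
  (forall y, `|f y| <= B) ->
  \sum_(l < M) max_noise f M (iter l T y) <=
  14 * B ^+ 2 * (M%:R * (M%:R * M%:R `^ (3 * gain a))).
Proof.
move=> M0M Mp fB.
have [bl hbl] := @choice _ _ (fun l b => b \in L M /\
    max_noise f M (iter l T y) = noise_average b f M (iter l T y) ^+ 2)
    (fun l => let: ex_intro2 b bL e := max_noise_attained f M (iter l T y) in
      ex_intro _ b (conj bL e)).
have M1 : 1 <= M%:R :> R by rewrite ler1n.
have /andP[a0 a1] := a01.
pose D := 6 * M%:R `^ (1 - a) : R; pose O := M%:R `^ (3 * gain a) : R.
have D0 : 0 < D by rewrite mulr_gt0// powR_gt0// ltr0n.
have O0 : 0 <= O by exact: powR_ge0.
have DO : D <= 6 * (M%:R * O).
  rewrite /D /O ler_wpM2l// -{2}[M%:R]powRr1// -powRD; last first.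
    by rewrite pnatr_eq0 -lt0n Mp implybT.
  by apply: ler_powR => //; rewrite /gain; lra.
have rowE : \sum_(l < M) (\sum_(j < M + M) shifted_row (bl l) M l j * f (iter j.+1 T y)) ^+ 2 =
    \sum_(l < M) max_noise f M (iter l T y).
  apply: eq_bigr => l _; rewrite (hbl l).2 (shifted_row_sum _ (fun j => f (iter j.+1 T y))); last first.
    by rewrite leq_add2r ltnW.
  congr (_ ^+ 2); apply: eq_bigr => k _.
  by rewrite -iterD; congr (_ * f (iter _ T y)); lia.
have diag l : (l < M)%N -> \sum_(j < M + M) shifted_row (bl l) M l j ^+ 2 <= D.
  move=> lM; under eq_bigr do rewrite expr2.
  rewrite (shifted_row_sum _ (fun j => shifted_row (bl l) M l j)); last by rewrite leq_add2r ltnW.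
  apply: le_trans (noise_sqr_sum_le M0M (hbl l).1).
  apply: ler_sum => k _; rewrite /shifted_row leq_addr ltn_add2l ltn_ord addKn.
  by rewrite expr2.
have off l m : (l < m < M)%N ->
    `|\sum_(j < M + M) shifted_row (bl l) M l j * shifted_row (bl m) M m j| <= O.
  move=> /andP[lm mM]; rewrite -{2}(subnKC (ltnW lm)) shifted_row_corr; last 2 first.
    by apply/andP; split; lia.
    by lia.
  have [_ _ _ hc] := typ M0M; apply: hc; [exact: (hbl _).1|exact: (hbl _).1|].
  by apply/andP; split; lia.
have := @gram_bound R (fun l j => shifted_row (bl l) M l j) (fun j => f (iter j.+1 T y))
  D O M (M + M) D0 O0 diag off.
rewrite rowE => /le_trans; apply.
have hf : \sum_(j < M + M) f (iter j.+1 T y) ^+ 2 <= 2 * M%:R * B ^+ 2.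
  apply: (@le_trans _ _ (\sum_(j < M + M) B ^+ 2)).
    apply: ler_sum => j _; rewrite -real_normK ?num_real// ler_sqr ?nnegrE//.
    exact: le_trans (fB y).
  by rewrite sumr_const card_ord -[leLHS]mulr_natl natrD; lra.
apply: le_trans (ler_wpM2l _ hf) _; first by rewrite addr_ge0 ?mulr_ge0// ltW.
have -> : 14 * B ^+ 2 * (M%:R * (M%:R * M%:R `^ (3 * gain a))) =
  (7 * (M%:R * O)) * (2 * M%:R * B ^+ 2) by rewrite /O; ring.
apply: ler_wpM2r; first by apply: mulr_ge0; [exact: mulr_ge0|exact: sqr_ge0].
by rewrite -lerBrDr; apply: le_trans DO _; move: (M%:R * O) => z; lra.
Qed.

Lemma E_max_noise f M (B : R) : measurable_fun setT f -> (M0 <= M)%N -> (0 < M)%N ->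
  (forall y, `|f y| <= B) ->
  L1 (max_noise f M) /\
  E (max_noise f M) <= 14 * B ^+ 2 * (M%:R * M%:R `^ (3 * gain a)).
Proof.
move=> mf M0M Mp fB; set C := 14 * B ^+ 2 * _.
have mx0 y : 0 <= max_noise f M y by apply: bigmax_ge_id.
have pw y : \sum_(l < M) max_noise f M (iter l T y) <= M%:R * C.
  by apply: le_trans (orbit_max_noise y M0M Mp fB) _; rewrite /C; lra.
have m1 : L1 (max_noise f M).
  apply: (@L1_bounded _ _ _ _ _ (M%:R * C)); first exact: measurable_max_noise.
  move=> y; rewrite ger0_norm//; apply: le_trans (pw y).
  by rewrite (bigD1 (Ordinal Mp))//= lerDl sumr_ge0.
split => //.
have : E (fun y => \sum_(l < M) max_noise f M (iter l T y)) <= M%:R * C.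
  rewrite -[leRHS](E_cst mu); apply: E_le => //; last exact: L1_cst.
  by apply: L1_sum => l; exact: (L1_comp hT).
rewrite E_sum; last by move=> l; exact: (L1_comp hT).
under eq_bigr do rewrite (E_comp hT)//.
by rewrite sumr_const card_ord -[leLHS]mulr_natl ler_pM2l ?ltr0n.
Qed.

End max_over_weights.

(** * Averages of coboundaries *)

Section coboundaries.
Context {R : realType} {d : measure_display} {Y : measurableType d}.
Variables (mu : probability Y R) (T : Y -> Y).
Hypothesis hT : measure_preserving mu T.
Implicit Types (f g h : Y -> R) (b : nat -> R).
Local Notation E f := (Rintegral mu setT f).
Local Notation L1 := (L1 mu).
Local Notation cst1 := (fun=> 1 : R).
Variables (a : R) (x : nat -> bool) (L : nat -> seq (nat -> R)) (M0 : nat).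
Hypothesis a01 : 0 < a < 2^-1.
Hypothesis typ : forall M, (M0 <= M)%N -> typical a (L M) M x.
Hypothesis Lone : forall M, cst1 \in L M.
Hypothesis Lle1 : forall M b, b \in L M -> forall n, (0 < n)%N -> `|b n| <= 1.

Lemma cnt_le M : (cnt x M <= M)%N.
Proof.
rewrite -[leqRHS]card_ord -sum1_card /cnt; apply: leq_sum => k _; exact: leq_b1.
Qed.

Lemma cnt_leq M N : (M <= N)%N -> (cnt x M <= cnt x N)%N.
Proof.
move=> /subnKC <-; elim: (N - M)%N => [|n IH]; first by rewrite addn0.
by rewrite addnS cntS (leq_trans IH) ?leq_addr.
Qed.

Lemma cnt_surjective N : exists M, cnt x M = N.
Proof.
have /andP[a0 a1] := a01.
have exM : exists M, (N <= cnt x M)%N.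
  have [n _ hn] := @near_powR_ge R (1 - a) (2 * N%:R) ltac:(lra).
  exists (maxn n M0); have [h _ _ _] := typ (leq_maxr n M0).
  have := hn _ (leq_maxl n M0); rewrite -(ler_nat R); lra.
case: (ex_minnP exM) => -[|M] hM minM.
  by exists 0%N; move: hM; rewrite /cnt big_ord0 leqn0 => /eqP.
exists M.+1; apply/eqP; rewrite eqn_leq hM andbT cntS.
have : (cnt x M < N)%N.
  by rewrite ltnNge; apply/negP => /minM; rewrite ltnn.
by have := leq_b1 (x M); lia.
Qed.

Lemma cnt_large M : (M0 <= M)%N -> M%:R `^ (1 - a) <= 2 * (cnt x M)%:R.
Proof. by move=> /typ[h _ _ _]; lra. Qed.

(** Chebyshev's inequality. With cnt x M = n^p the power gain M^(- gain) is at
    most n^-3 by the choice of p. *)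
Lemma max_noise_proportion f (B e : R) M n p : measurable_fun setT f ->
  (forall y, `|f y| <= B) -> 0 < e -> 3 <= p%:R * gain a -> (0 < n)%N ->
  (M0 <= M)%N -> cnt x M = (n ^ p)%N ->
  (mu [set y | ((e * (n ^ p)%:R) ^+ 2 < max_noise T a x L f M y)%R] <=
    (56 * B ^+ 2 / e ^+ 2 / n%:R ^+ 3)%:E)%E.
Proof.
move=> mf fB e0 hp n0 M0M cM; set A := [set y | _].
have np0 : (0 < n ^ p)%N by rewrite expn_gt0 n0.
have nM : (n ^ p <= M)%N by rewrite -cM cnt_le.
have Mp : (0 < M)%N by exact: leq_trans nM.
have M0' : M%:R != 0 :> R by rewrite pnatr_eq0 -lt0n.
have [m1 hE] := E_max_noise hT a01 typ Lone Lle1 mf M0M Mp fB.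
have mA : measurable A by apply: measurable_gt_cst; exact: L1_measurable m1.
set c := (e * (n ^ p)%:R) ^+ 2; have c0 : 0 < c by rewrite exprn_gt0// mulr_gt0// ltr0n.
rewrite -(E_indic mu mA) lee_fin.
apply: (@le_trans _ _ (E (fun y => c^-1 * max_noise T a x L f M y))).
  apply: E_le; [exact: L1_indic|exact: L1Z|] => y.
  have mx0 : 0 <= max_noise T a x L f M y by apply: bigmax_ge_id.
  rewrite indicE; have [yA|yA] := boolP (y \in A); last by rewrite mulr_ge0// invr_ge0 ltW.
  by rewrite ler_pdivlMl// mulr1 ltW//; move/set_mem: yA.
rewrite EZ//; apply: le_trans (ler_wpM2l _ hE) _; first by rewrite invr_ge0 ltW.
have /andP[a0 a1] := a01.
have hM : M%:R * M%:R `^ (3 * gain a) = M%:R `^ (1 - a) ^+ 2 * M%:R `^ (- gain a) :> R.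
  rewrite -{1}[M%:R]powRr1// -powR_mulrn ?powR_ge0// -powRrM -!powRD ?M0' ?implybT//.
  by congr (_ `^ _); rewrite /gain; field.
have h1 : M%:R `^ (1 - a) ^+ 2 <= 4 * (n ^ p)%:R ^+ 2 :> R.
  have := cnt_large M0M; rewrite cM => h.
  have -> : 4 * (n ^ p)%:R ^+ 2 = (2 * (n ^ p)%:R) ^+ 2 :> R by rewrite exprMn; congr (_ * _); ring.
  by rewrite ler_sqr ?nnegrE ?powR_ge0// mulr_ge0.
have h2 : M%:R `^ (- gain a) <= (n%:R ^+ 3)^-1 :> R.
  rewrite powRN lef_pV2 ?posrE ?exprn_gt0 ?ltr0n ?powR_gt0 ?ltr0n//.
  apply: (@le_trans _ _ ((n ^ p)%:R `^ gain a)); last first.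
    by apply: ge0_ler_powR; rewrite ?nnegrE ?ler_nat ?(ltW (gain_gt0 a01)).
  rewrite natrX -(powR_mulrn p)// -(powR_mulrn 3)//.
  rewrite -powRrM; apply: ler_powR => //; by rewrite ler1n.
rewrite hM.
apply: (@le_trans _ _ (c^-1 * (14 * B ^+ 2 * (4 * (n ^ p)%:R ^+ 2 * (n%:R ^+ 3)^-1)))).
  apply: ler_wpM2l; first by rewrite invr_ge0 ltW.
  apply: ler_wpM2l; first by rewrite mulr_ge0 ?sqr_ge0.
  by apply: ler_pM; rewrite ?sqr_ge0 ?powR_ge0.
rewrite le_eqVlt; apply/orP; left; apply/eqP; rewrite /c.
have e0' : e != 0 by rewrite gt_eqF.
have n0' : n%:R != 0 :> R by rewrite pnatr_eq0 -lt0n.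
have np0' : (n ^ p)%:R != 0 :> R by rewrite pnatr_eq0 -lt0n.
by field; rewrite e0' n0' np0'.
Qed.

End coboundaries.

Section coboundaries.
Context {R : realType} {d : measure_display} {Y : measurableType d}.
Variables (mu : probability Y R) (T : Y -> Y).
Hypothesis hT : measure_preserving mu T.
Implicit Types (f g h : Y -> R) (b : nat -> R).
Local Notation E f := (Rintegral mu setT f).
Local Notation L1 := (L1 mu).
Local Notation cst1 := (fun=> 1 : R).
Variables (a : R) (x : nat -> bool) (L : nat -> seq (nat -> R)) (M0 : nat).
Hypothesis a01 : 0 < a < 2^-1.
Hypothesis typ : forall M, (M0 <= M)%N -> typical a (L M) M x.
Hypothesis Lone : forall M, cst1 \in L M.
Hypothesis Lle1 : forall M b, b \in L M -> forall n, (0 < n)%N -> `|b n| <= 1.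

Lemma ae_lacunary_noise f (B : R) (p : nat) (mk : nat -> nat) :
  measurable_fun setT f -> (forall y, `|f y| <= B) -> 3 <= p%:R * gain a ->
  (0 < p)%N -> (forall n, cnt x (mk n) = (n ^ p)%N) ->
  {ae mu, forall y, forall e : R, 0 < e -> \forall n \near \oo,
     forall b, b \in L (mk n) ->
     `|noise_average T a x b f (mk n) y| <= e * (n ^ p)%:R}.
Proof.
move=> mf fB hp p0 mkE.
have mkn n : (n <= mk n)%N.
  case: n => // n; apply: leq_trans (cnt_le x _); rewrite mkE.
  by rewrite -{1}[n.+1]expn1 leq_pexp2l.
pose A i n := [set y | (i.+1%:R^-1 * (n ^ p)%:R) ^+ 2 < max_noise T a x L f (mk n) y].
have mA i n : measurable (A i n).
  by apply: measurable_gt_cst; exact: (measurable_max_noise hT).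
have small i : (\forall n \near \oo, mu (A i n) <= ((n.+1 * n.+2)%:R^-1)%:E)%E.
  have i0 : 0 < i.+1%:R^-1 :> R by rewrite invr_gt0.
  pose K : R := 56 * B ^+ 2 / i.+1%:R^-1 ^+ 2.
  have K0 : 0 <= K by apply: divr_ge0; [apply: mulr_ge0; [by []|exact: sqr_ge0]|exact: sqr_ge0].
  near=> n.
  have n0 : (0 < n)%N by near: n; exact: nbhs_infty_gt.
  have nM0 : (M0 <= mk n)%N.
    by apply: leq_trans (mkn n); near: n; exact: nbhs_infty_ge.
  have nK : 6 * K <= n%:R by near: n; exact: nbhs_infty_ger.
  have h := max_noise_proportion hT a01 typ Lone Lle1 mf fB i0 hp n0 nM0 (mkE n).
  apply: (le_trans h); rewrite lee_fin -/K.
  rewrite ler_pdivrMr ?exprn_gt0 ?ltr0n// ler_pdivlMl ?ltr0n//.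
  have h6 : (n.+1 * n.+2)%:R <= 6 * n%:R ^+ 2 :> R.
    by rewrite -natrX -natrM ler_nat; nia.
  apply: (le_trans (ler_wpM2r K0 h6)).
  have := ler_wpM2l (sqr_ge0 (n%:R : R)) nK.
  have -> : (n%:R : R) ^+ 3 = n%:R ^+ 2 * n%:R by rewrite exprSr.
  lra.
have ae1 := ae_foralln (fun i => ae_eventually_notin (mA i) (small i)).
apply: filterS ae1 => y hy e e0.
have [i hi] := natr_large e^-1.
near=> n => b bL.
have : ~ A i n y by near: n; exact: hy.
move=> /negP; rewrite /A /= -leNgt => h.
have h2 := le_trans (noise_average_le_max T a x f y bL) h.
have q0 : 0 <= i.+1%:R^-1 * (n ^ p)%:R :> R by rewrite mulr_ge0// invr_ge0.
apply: (@le_trans _ _ (i.+1%:R^-1 * (n ^ p)%:R)).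
  by rewrite -ler_sqr ?nnegrE// real_normK ?num_real.
rewrite ler_wpM2r// invf_ple ?posrE// ltW//; apply: lt_trans hi _.
by rewrite ltr_nat.
Unshelve. all: by end_near. Qed.

Definition weighted_sum b f M y : R :=
  \sum_(k < M) (x k)%:R * b (cnt x k).+1 * f (iter k.+1 T y).

Definition smooth_sum b f M y : R :=
  \sum_(k < M) sigma a k * b (cnt x k).+1 * f (iter k.+1 T y).

Lemma weighted_sumE b f M y :
  weighted_sum b f M y = noise_average T a x b f M y + smooth_sum b f M y.
Proof.
by rewrite -big_split /=; apply: eq_bigr => k _; rewrite /noise; ring.
Qed.

(** Summation by parts. The coefficient changes by the decrease of sigma,
    which telescopes, and by at most 2 sigma k when the bit k is a one. *)
Lemma smooth_coboundary_le b g (K : R) M y :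
  (forall n, (0 < n)%N -> `|b n| <= 1) -> (forall y, `|g y| <= K) ->
  `|smooth_sum b (fun y => g y - g (T y)) M y| <=
  K * (3 + 2 * \sum_(k < M) sigma a k * (x k)%:R).
Proof.
move=> b1 gK; have /andP[a0 a1] := a01.
have K0 : 0 <= K by exact: le_trans (gK y).
have sgx0 k : 0 <= sigma a k * (x k)%:R by rewrite mulr_ge0// ltW// sigma_gt0.
pose w k := sigma a k * b (cnt x k).+1.
pose F k := g (iter k.+1 T y).
have wle k : `|w k| <= 1.
  rewrite /w normrM mulr_ile1 ?normr_ge0 ?b1//.
  by rewrite ger0_norm ?sigma_le1 ?ltW ?sigma_gt0.
have dw k : `|w k.+1 - w k| <= (sigma a k - sigma a k.+1) + 2 * (sigma a k * (x k)%:R).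
  have s1 := sigma_nincr (ltW a0) (leqnSn k).
  have s2 := sigma_gt0 a k; have s3 := sigma_gt0 a k.+1.
  have hb := b1 (cnt x k).+1 isT; have hb' := b1 (cnt x k.+1).+1 isT.
  rewrite /w; move: hb'; rewrite cntS; case: (x k) => /=; rewrite ?addn1 ?addn0 => hb'.
    rewrite mulr1; apply: le_trans (ler_normB _ _) _; rewrite !normrM.
    rewrite (ger0_norm (ltW s2)) (ger0_norm (ltW s3)).
    have := ler_wpM2l (ltW s2) hb; have := ler_wpM2l (ltW s3) hb'; lra.
  have s4 : 0 <= sigma a k - sigma a k.+1 by rewrite subr_ge0.
  rewrite mulr0 mulr0 addr0 -mulrBl normrM distrC (ger0_norm s4).
  by apply: ler_piMr.
have key m : `|\sum_(k < m.+1) w k * (F k - F k.+1) + w m * F m.+1| <=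
    K * (2 - sigma a m + 2 * \sum_(k < m) sigma a k * (x k)%:R).
  elim: m => [|m IH].
    rewrite big_ord_recr !big_ord0 /= add0r mulr0 addr0 sigma0.
    have -> : w 0%N * (F 0%N - F 1%N) + w 0%N * F 1%N = w 0%N * F 0%N by ring.
    rewrite normrM; have := wle 0%N; have := gK (iter 1 T y).
    rewrite -/(F 0%N) => h1 h2; apply: le_trans (ler_piMl (normr_ge0 _) h2) _.
    by move: h1; lra.
  have -> : \sum_(k < m.+2) w k * (F k - F k.+1) + w m.+1 * F m.+2 =
    (\sum_(k < m.+1) w k * (F k - F k.+1) + w m * F m.+1) + (w m.+1 - w m) * F m.+1.
    by rewrite [X in X + _]big_ord_recr /=; ring.
  apply: le_trans (ler_normD _ _) _.
  have h : `|(w m.+1 - w m) * F m.+1| <=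
      ((sigma a m - sigma a m.+1) + 2 * (sigma a m * (x m)%:R)) * K.
    by rewrite normrM; apply: ler_pM => //; exact: gK.
  rewrite [in leRHS]big_ord_recr /=; move: (sigma a m * (x m)%:R) h IH => q h IH; lra.
rewrite /smooth_sum.
have -> : \sum_(k < M) sigma a k * b (cnt x k).+1 * (g (iter k.+1 T y) - g (T (iter k.+1 T y))) =
  \sum_(k < M) w k * (F k - F k.+1) by [].
case: M => [|M].
  rewrite !big_ord0 normr0 mulr0 addr0 mulr_ge0//.
have -> : \sum_(k < M.+1) w k * (F k - F k.+1) =
  (\sum_(k < M.+1) w k * (F k - F k.+1) + w M * F M.+1) - w M * F M.+1 by ring.
apply: le_trans (ler_normB _ _) _.
have h : `|w M * F M.+1| <= 1 * K by rewrite normrM; apply: ler_pM => //; exact: gK.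
rewrite [in leRHS]big_ord_recr /=; have := key M.
have := mulr_ge0 K0 (sgx0 M); have := mulr_ge0 K0 (ltW (sigma_gt0 a M)).
move: (sigma a M * (x M)%:R) h => q h; lra.
Qed.

Lemma weighted_sum_diff b f (K : R) M N y :
  (forall n, (0 < n)%N -> `|b n| <= 1) -> (forall y, `|f y| <= K) -> (M <= N)%N ->
  `|weighted_sum b f N y - weighted_sum b f M y| <= K * ((cnt x N)%:R - (cnt x M)%:R).
Proof.
move=> b1 fK /subnKC <-; elim: (N - M)%N => [|n IH].
  by rewrite addn0 !subrr normr0 mulr0.
rewrite addnS cntS natrD /weighted_sum big_ord_recr /= -/(weighted_sum b f (M + n) y).
rewrite [X in `|X|]addrAC [_ + _ - (cnt x M)%:R]addrAC [leRHS]mulrDr.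
apply: le_trans (ler_normD _ _) _.
have h : `|(x (M + n)%N)%:R * b (cnt x (M + n)).+1 * f (T (iter (M + n) T y))| <=
    K * (x (M + n)%N)%:R.
  rewrite !normrM mulrC; apply: ler_pM.
  - exact: normr_ge0.
  - by rewrite mulr_ge0.
  - exact: fK.
  - by rewrite normr_nat ler_piMr// b1.
by apply: lerD.
Qed.

(** Convexity: (1 + u)^p lies below its chord on the interval from 0 to 1. *)
Lemma expn_succ_le p n : (0 < n)%N ->
  n.+1%:R ^+ p <= n%:R ^+ p * (1 + 2 ^+ p / n%:R) :> R.
Proof.
move=> n0; have n0' : 0 < n%:R :> R by rewrite ltr0n.
have n1 : 1 <= n%:R :> R by rewrite ler1n.
set u : R := n%:R^-1; have u0 : 0 < u by rewrite invr_gt0.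
have u1 : u <= 1 by rewrite invf_le1.
have key q : (1 + u) ^+ q <= 1 + (2 ^+ q - 1) * u.
  elim: q => [|q IH]; first by rewrite !expr0 subrr mul0r addr0.
  have c0 : 0 <= 2 ^+ q - 1 :> R by rewrite subr_ge0 exprn_ege1// ler1n.
  rewrite !exprS; have u0' : 0 <= 1 + u by lra.
  apply: le_trans (ler_wpM2l u0' IH) _.
  move: (2 ^+ q) c0 => c c0.
  have : 0 <= (c - 1) * (u * (1 - u)).
    by rewrite !mulr_ge0 ?subr_ge0 ?(ltW u0)//; lra.
  lra.
have -> : n.+1%:R = n%:R * (1 + u) :> R by rewrite mulrDr mulr1 mulfV ?gt_eqF// natr1.
rewrite exprMn ler_wpM2l ?exprn_ge0//; apply: le_trans (key p) _.
by rewrite lerD2l ler_wpM2r ?(ltW u0)// gerBl.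
Qed.

Lemma lacunary_bracket p N : (0 < p)%N -> exists n, (n ^ p <= N < n.+1 ^ p)%N.
Proof.
move=> p0; elim: N => [|N [n /andP[h1 h2]]].
  by exists 0%N; rewrite exp0n// exp1n.
have [h|h] := ltnP N.+1 (n.+1 ^ p); first by exists n; rewrite h andbT ltnW.
exists n.+1; rewrite h /=; apply: leq_ltn_trans h2 _.
by rewrite ltn_exp2r.
Qed.

End coboundaries.

Section uniform_averages.
Context {R : realType} {d : measure_display} {Y : measurableType d}.
Variables (mu : probability Y R) (T : Y -> Y).
Hypothesis hT : measure_preserving mu T.
Implicit Types (f g h : Y -> R) (b : nat -> R).
Local Notation E f := (Rintegral mu setT f).
Local Notation L1 := (L1 mu).
Local Notation cst1 := (fun=> 1 : R).
Variables (a : R) (x : nat -> bool) (L : nat -> seq (nat -> R)) (M0 : nat).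
Hypothesis a01 : 0 < a < 2^-1.
Hypothesis typ : forall M, (M0 <= M)%N -> typical a (L M) M x.
Hypothesis Lone : forall M, cst1 \in L M.
Hypothesis Lle1 : forall M b, b \in L M -> forall n, (0 < n)%N -> `|b n| <= 1.
Variables (G : set (nat -> R)) (kappa C : R).
Hypothesis kappa0 : 0 < kappa.
Hypothesis G1 : forall b, G b -> forall n, (0 < n)%N -> `|b n| <= 1.
Hypothesis GL : forall M, (M0 <= M)%N -> forall b, G b ->
  exists2 b0, b0 \in L M & forall t, (0 < t <= M)%N -> `|b t - b0 t| <= C * M%:R `^ (- kappa).

(** The averages are indexed by the length M of the initial segment of x,
    while thresholds are in terms of the number of terms cnt x M, as several M
    may share the same average. *)
Definition uniformly_negligible f y := forall e : R, 0 < e -> exists N0, forall M,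
  (N0 <= cnt x M)%N -> forall b, G b -> `|weighted_sum T x b f M y| <= e * (cnt x M)%:R.

Lemma weighted_sum_close b c f (K q : R) M y : 0 <= q ->
  (forall y, `|f y| <= K) ->
  (forall t, (0 < t <= M)%N -> `|b t - c t| <= q) ->
  `|weighted_sum T x b f M y - weighted_sum T x c f M y| <= q * K * (cnt x M)%:R.
Proof.
move=> q0 fK bc; rewrite /weighted_sum -sumrB [in leRHS]/cnt natr_sum mulr_sumr.
apply: le_trans (ler_norm_sum _ _ _) _; apply: ler_sum => k _.
rewrite -mulrBl -mulrBr !normrM normr_nat.
rewrite -mulrA mulrC; apply: ler_wpM2r => //; apply: ler_pM => //.
apply: bc => /=; exact: leq_ltn_trans (cnt_le x k) (ltn_ord k).
Qed.

(** For cnt x M = n^p four errors compete: the approximation of b, the noise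
    sum, the boundary terms of the smooth sum, and its variation. Each is
    eventually a small multiple of n^p. *)
Lemma ae_coboundary_negligible g (K : R) : measurable_fun setT g ->
  (forall y, `|g y| <= K) ->
  {ae mu, forall y, uniformly_negligible (fun y => g y - g (T y)) y}.
Proof.
move=> mg gK; set f := fun y => _; have /andP[a0 a1] := a01.
have fK y : `|f y| <= 2 * K.
  apply: le_trans (ler_normB _ _) _; have := gK y; have := gK (T y); lra.
have mf : measurable_fun setT f.
  by apply: measurable_funB => //; exact: (measurable_comp_iter hT 1).
(* p is chosen so that the exceptional sets have measure O(n^-3). *)
have [p hp] := natr_large (3 / gain a).
have gain0 := gain_gt0 a01.
have {}hp : 3 <= p%:R * gain a by rewrite -ler_pdivrMr// ltW.
have p0 : (0 < p)%N.
  by case: (p) hp => //; rewrite mul0r => h; exfalso; lra.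
have [mk mkE] := choice (cnt_surjective a01 typ).
pose mkp n := mk (n ^ p)%N.
have mkpE n : cnt x (mkp n) = (n ^ p)%N by exact: mkE.
have nle n : (n <= n ^ p)%N by case: n => // n; rewrite -{1}[n.+1]expn1 leq_pexp2l.
have mkn n : (n <= mkp n)%N.
  by apply: leq_trans (nle n) _; rewrite -mkpE cnt_le.
apply: filterS (ae_lacunary_noise hT a01 typ Lone Lle1 mf fK hp p0 mkpE) => y hy e e0.
have K0 : 0 <= K by exact: le_trans (gK y).
pose e1 := e / 5; have e10 : 0 < e1 by rewrite divr_gt0.
have b12 : 0 < 1 - 2 * a by lra.
have : \forall n \near \oo, (0 < n)%N /\ 2 * K * (2 ^+ p / n%:R) <= e1 /\
    (forall b, G b -> `|weighted_sum T x b f (mkp n) y| <= 4 * e1 * (n ^ p)%:R).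
  near=> n.
  have n0 : (0 < n)%N by near: n; exact: nbhs_infty_gt.
  have n0' : 0 < n%:R :> R by rewrite ltr0n.
  split => //; split.
    rewrite mulrA ler_pdivrMr// [e1 * _]mulrC -ler_pdivrMr//.
    by near: n; exact: nbhs_infty_ger.
  have hyn : forall b, b \in L (mkp n) ->
      `|noise_average T a x b f (mkp n) y| <= e1 * (n ^ p)%:R.
    by near: n; exact: hy.
  have nM0 : (M0 <= n)%N by near: n; exact: nbhs_infty_ge.
  have nkappa : (2 * K * `|C|) / e1 <= n%:R `^ kappa by near: n; exact: near_powR_ge.
  have nalpha : 8 / (1 - 2 * a) * K / e1 <= n%:R `^ a by near: n; exact: near_powR_ge.
  have nK : e1^-1 * (3 * K) <= n%:R by near: n; exact: nbhs_infty_ger.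
  move=> b Gb; set M := mkp n.
  have nM : (n%:R : R) <= M%:R by rewrite ler_nat mkn.
  have M0M : (M0 <= M)%N.
    exact: leq_trans nM0 (mkn n).
  have Mp : 0 < M%:R :> R by exact: lt_le_trans nM.
  have [b0 b0L hb0] := GL M0M Gb.
  have powle (t : R) : 0 < t -> n%:R `^ t <= M%:R `^ t.
    by move=> t0; apply: ge0_ler_powR; rewrite ?nnegrE ?(ltW t0).
  pose q := `|C| * M%:R `^ (- kappa).
  have q0 : 0 <= q by rewrite mulr_ge0// powR_ge0.
  have hq : q * (2 * K) <= e1.
    have : (2 * K * `|C|) / e1 <= M%:R `^ kappa by exact: le_trans (powle _ kappa0).
    rewrite ler_pdivrMr// /q powRN => h.
    by rewrite mulrAC ler_pdivrMr ?powR_gt0// mulrC (mulrC e1).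
  have i1 : `|weighted_sum T x b f M y - weighted_sum T x b0 f M y| <= e1 * (n ^ p)%:R.
    apply: (@le_trans _ _ (q * (2 * K) * (cnt x M)%:R)).
      apply: weighted_sum_close => // t tM; apply: le_trans (hb0 t tM) _.
      by rewrite ler_wpM2r ?powR_ge0// ler_norm.
    by rewrite mkpE ler_wpM2r.
  have i2 : `|noise_average T a x b0 f M y| <= e1 * (n ^ p)%:R.
    exact: hyn.
  have i3 : `|smooth_sum T a x b0 f M y| <= 2 * e1 * (n ^ p)%:R.
    apply: le_trans (@smooth_coboundary_le _ _ _ T a x a01 b0 g K M y (Lle1 b0L) gK) _.
    have np1 : (n%:R : R) <= (n ^ p)%:R by rewrite ler_nat.
    have j1 : 3 * K <= e1 * (n ^ p)%:R.
      apply: (@le_trans _ _ (e1 * n%:R)); last by rewrite ler_wpM2l// ltW.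
      by rewrite -ler_pdivrMl.
    have [_ _ j2 _] := typ M0M.
    have j3 : 8 / (1 - 2 * a) * K / e1 <= M%:R `^ a.
      exact: le_trans (powle a a0).
    have j4 := cnt_large typ M0M; rewrite mkpE in j4.
    have j5 : M%:R `^ (1 - a) = M%:R `^ a * M%:R `^ (1 - 2 * a) :> R.
      rewrite -powRD ?(gt_eqF Mp) ?implybT//; congr (_ `^ _); ring.
    rewrite ler_pdivrMr// in j3.
    have := ler_wpM2r (powR_ge0 M%:R (1 - 2 * a)) j3.
    have := ler_wpM2l K0 j2; rewrite j5 in j4.
    have := ler_wpM2l (ltW e10) j4.
    have -> : 8 / (1 - 2 * a) * K * M%:R `^ (1 - 2 * a) =
      4 * (K * (2 / (1 - 2 * a) * M%:R `^ (1 - 2 * a))).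
      by move: (M%:R `^ _) => z; field; rewrite gt_eqF.
    move: (K * (_ / _ * _)) => z; move: (\sum_(_ < _) _) => s.
    move: (M%:R `^ a) (M%:R `^ _) ((n ^ p)%:R) j1 => u v w j1; lra.
  have := weighted_sumE T a x b0 f M y.
  move: i1 i2 i3; move: (weighted_sum _ _ _ _ _ _) (weighted_sum _ _ _ _ _ _) => s t.
  move: (noise_average _ _ _ _ _ _ _) (smooth_sum _ _ _ _ _ _ _) => u v.
  rewrite !ler_norml => *; apply/andP; split; lra.
move=> [n0 _ hn0]; exists (n0.+1 ^ p)%N => M hM b Gb.
have [n /andP[hn1 hn2]] := lacunary_bracket (cnt x M) p0.
have n0n : (n0 <= n)%N.
  have : (n0.+1 ^ p < n.+1 ^ p)%N by exact: leq_ltn_trans hn2.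
  by rewrite ltn_exp2r// ltnS => /ltnW.
have [np [h1 h2]] := hn0 n n0n.
have {}h2 := h2 b Gb.
have K20 : 0 <= 2 * K by lra.
have hdiff : `|weighted_sum T x b f M y - weighted_sum T x b f (mkp n) y| <=
    2 * K * ((cnt x M)%:R - (n ^ p)%:R).
  have [h|h] := leqP (mkp n) M.
    by rewrite -(mkpE n); apply: weighted_sum_diff => //; exact: G1.
  have e2 : cnt x M = (n ^ p)%N.
    by apply/eqP; rewrite eqn_leq hn1 andbT -mkpE cnt_leq// ltnW.
  rewrite e2 subrr mulr0 distrC.
  have := @weighted_sum_diff _ _ _ T x b f (2 * K) M (mkp n) y (G1 Gb) fK (ltnW h).
  by rewrite mkpE e2 subrr mulr0.
have hgap : (cnt x M)%:R - (n ^ p)%:R <= (n ^ p)%:R * (2 ^+ p / n%:R) :> R.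
  have := @expn_succ_le R p n np; rewrite -!natrX mulrDr mulr1 => h.
  have : (cnt x M)%:R <= (n.+1 ^ p)%:R :> R by rewrite ler_nat ltnW.
  by rewrite natrX; move: h; rewrite natrX; lra.
have hn1' : (n ^ p)%:R <= (cnt x M)%:R :> R by rewrite ler_nat.
have npp : 0 <= (n ^ p)%:R :> R by [].
have h3 := ler_wpM2l K20 hgap; have h4 := ler_wpM2l npp h1.
have h5 := ler_wpM2l (ltW e10) hn1'.
have h6 : 2 * K * ((n ^ p)%:R * (2 ^+ p / n%:R)) = (n ^ p)%:R * (2 * K * (2 ^+ p / n%:R)) by ring.
have h7 := ler_normD (weighted_sum T x b f M y - weighted_sum T x b f (mkp n) y)
  (weighted_sum T x b f (mkp n) y); rewrite subrK in h7.
apply: le_trans h7 _.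
have -> : e = 5 * e1 by rewrite /e1; field.
rewrite h6 in h3.
have combine (s t u v z : R) : s <= u * z -> t <= 4 * z * u -> z * u <= z * v ->
    s + t <= 5 * z * v.
  move=> *; lra.
exact: combine (le_trans hdiff (le_trans h3 h4)) h2 h5.
Unshelve. all: by end_near. Qed.

End uniform_averages.

(** * Passage to the limit in the function *)

Section density.
Context {R : realType} {d : measure_display} {Y : measurableType d}.
Variables (mu : probability Y R) (T : Y -> Y).
Hypothesis hT : measure_preserving mu T.
Implicit Types (f g h : Y -> R) (b : nat -> R).
Local Notation E f := (Rintegral mu setT f).
Local Notation L1 := (L1 mu).
Local Notation cst1 := (fun=> 1 : R).
Variables (a : R) (x : nat -> bool) (L : nat -> seq (nat -> R)) (M0 : nat).
Hypothesis a01 : 0 < a < 2^-1.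
Hypothesis typ : forall M, (M0 <= M)%N -> typical a (L M) M x.
Hypothesis Lone : forall M, cst1 \in L M.
Hypothesis Lle1 : forall M b, b \in L M -> forall n, (0 < n)%N -> `|b n| <= 1.
Variables (G : set (nat -> R)) (kappa C : R).
Hypothesis kappa0 : 0 < kappa.
Hypothesis G1 : forall b, G b -> forall n, (0 < n)%N -> `|b n| <= 1.
Hypothesis GL : forall M, (M0 <= M)%N -> forall b, G b ->
  exists2 b0, b0 \in L M & forall t, (0 < t <= M)%N -> `|b t - b0 t| <= C * M%:R `^ (- kappa).

Lemma ae_of_small_exceptions (Q : Y -> Prop) :
  (forall e : R, 0 < e -> exists D, [/\ measurable D, (mu D <= e%:E)%E &
     forall y, ~ D y -> Q y]) -> {ae mu, forall y, Q y}.
Proof.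
move=> hQ.
have [D hD] := choice (fun j : nat => hQ j.+1%:R^-1 ltac:(by rewrite invr_gt0)).
have mD : measurable (\bigcap_j D j).
  by apply: bigcapT_measurable => j; have [] := hD j.
exists (\bigcap_j D j); split => //.
- apply/eqP; rewrite eq_le measure_ge0 andbT; apply/lee_addgt0Pr => e e0.
  rewrite add0r; have [j hj] := natr_large e^-1.
  have [mDj Dj _] := hD j.
  apply: (@le_trans _ _ (mu (D j))).
    by apply: le_measure; rewrite ?inE//; exact: bigcap_inf.
  apply: le_trans Dj _; rewrite lee_fin invf_ple ?posrE// ltW//.
  by apply: lt_trans hj _; rewrite ltr_nat.
- move=> y /= nQ j _; apply: contrapT => nD; apply: nQ.
  by have [_ _] := hD j; exact.
Qed.

(** At level l, f is a coboundary plus r with the norm of r so small that, by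
    [weak_type], the averages of the absolute value of r exceed 12 l only on a
    set of arbitrarily small measure. *)
Lemma ae_uniformly_negligible f : L1 f -> zero_mean mu T f ->
  {ae mu, forall y, uniformly_negligible T x G f y}.
Proof.
move=> f1 f0.
pose Q (i : nat) y := exists N0, forall M, (N0 <= cnt x M)%N -> forall b, G b ->
  `|weighted_sum T x b f M y| <= 13 * i.+1%:R^-1 * (cnt x M)%:R.
suff Qae i : {ae mu, forall y, Q i y}.
  apply: filterS (ae_foralln Qae) => y Qy e e0.
  have [i hi] := natr_large (13 / e); have [N0 hN0] := Qy i.
  exists N0 => M hM b Gb; apply: le_trans (hN0 M hM b Gb) _.
  apply: ler_wpM2r => //; rewrite ler_pdivrMr ?ltr0n// mulrC -ler_pdivrMr// ltW//.
  by apply: lt_trans hi _; rewrite ltr_nat.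
set l : R := i.+1%:R^-1; have l0 : 0 < l by rewrite invr_gt0.
apply: ae_of_small_exceptions => e e0.
have W0 := weak_const_ge0 a01.
have W1 : 0 < 1 + weak_const a by rewrite ltr_wpDr.
(* With this tolerance, weak_const / l times the norm of r is at most e. *)
pose dl := e * l / (1 + weak_const a).
have dl0 : 0 < dl by rewrite divr_gt0// mulr_gt0.
have [g [mg [K gK] hg]] := coboundary_approximation hT f1 f0 dl0.
pose u y := g y - g (T y); pose r y := `|f y - u y|.
have u1 : L1 u.
  apply: (@L1_bounded _ _ _ _ _ (K + K)).
    by apply: measurable_funB => //; exact: (measurable_comp_iter hT 1).
  by move=> y; apply: le_trans (ler_normB _ _) _; apply: lerD.
have r1 : L1 r by apply: L1_abs; exact: L1B.
have r0 y : 0 <= r y by exact: normr_ge0.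
have [B [mB hB offB]] := weak_type hT a01 typ Lone r1 r0 l0.
have [Z [mZ hZ offZ]] := ae_coboundary_negligible hT a01 typ Lone Lle1 kappa0 G1 GL mg gK.
exists (B `|` Z); split; first exact: measurableU.
  apply: le_trans (measureU2 _ mB mZ) _; rewrite [X in (_ + X)%E]hZ adde0.
  apply: le_trans hB _; rewrite lee_fin.
  apply: (@le_trans _ _ (weak_const a * (l^-1 * dl))).
    by rewrite ler_wpM2l// ler_wpM2l// invr_ge0 ltW.
  have -> : weak_const a * (l^-1 * dl) = e * (weak_const a / (1 + weak_const a)).
    by rewrite /dl; field; rewrite !gt_eqF.
  rewrite ler_piMr ?(ltW e0)// ler_pdivrMr// mul1r; lra.
move=> y nBZ; have nB : ~ B y by move=> ?; apply: nBZ; left.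
have neg : uniformly_negligible T x G u y.
  by apply: contrapT => h; apply: nBZ; right; apply: offZ.
have [N0 hN0] := neg l l0.
exists (maxn N0 (maxn M0 1)) => M; rewrite !geq_max => /and3P[NM M0M M1] b Gb.
have cM := cnt_le x M.
have h1 := hN0 M NM b Gb.
have h2 := offB y nB M (leq_trans M0M cM) (leq_trans M1 cM).
have h3 : `|weighted_sum T x b f M y - weighted_sum T x b u M y| <= sparse_sum T x r M y.
  rewrite /weighted_sum -sumrB; apply: le_trans (ler_norm_sum _ _ _) _.
  apply: ler_sum => k _; rewrite -mulrBr !normrM normr_nat -mulrA ler_wpM2l//.
  by rewrite ler_piMl// G1.
have := ler_normD (weighted_sum T x b f M y - weighted_sum T x b u M y) (weighted_sum T x b u M y).
rewrite subrK => /le_trans; apply; apply: le_trans (lerD (le_trans h3 h2) h1) _.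
by rewrite -/l; clearbody l; lra.
Qed.

End density.

(** * Complex weights and the counting function *)

Section complex_parts.
Context {R : realType}.
Implicit Types z w : R[i].

Lemma modulus_Re z : `|complex.Re z| <= modulus z.
Proof.
case: z => u v; rewrite /modulus /Normc.normc /= -sqrtr_sqr ler_wsqrtr//.
by rewrite lerDl sqr_ge0.
Qed.

Lemma modulus_Im z : `|complex.Im z| <= modulus z.
Proof.
case: z => u v; rewrite /modulus /Normc.normc /= -sqrtr_sqr ler_wsqrtr//.
by rewrite lerDr sqr_ge0.
Qed.

Lemma modulus_le z : modulus z <= `|complex.Re z| + `|complex.Im z|.
Proof.
case: z => u v; rewrite /modulus /Normc.normc /=.
rewrite -[leRHS]ger0_norm ?addr_ge0// -sqrtr_sqr ler_wsqrtr//.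
by rewrite sqrrD !real_normK ?num_real// -addrA lerD2l lerDr mulrn_wge0 ?mulr_ge0.
Qed.

Lemma modulus_ge0 z : 0 <= modulus z.
Proof. by case: z => u v; exact: sqrtr_ge0. Qed.

Lemma modulusM z w : modulus (z * w) = modulus z * modulus w.
Proof. exact: Normc.normcM. Qed.

Lemma modulus_natV n : modulus (n%:R^-1 : R[i]) = n%:R^-1.
Proof.
rewrite /modulus Normc.normcV; congr (_^-1).
rewrite -(rmorph_nat (real_complex R)) /Normc.normc /= expr0n addr0.
by rewrite sqrtr_sqr normr_nat.
Qed.

Lemma Re_sub z w : complex.Re (z - w) = complex.Re z - complex.Re w.
Proof. by case: z; case: w. Qed.

Lemma Im_sub z w : complex.Im (z - w) = complex.Im z - complex.Im w.
Proof. by case: z; case: w. Qed.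

Lemma Re_mul z w :
  complex.Re (z * w) = complex.Re z * complex.Re w - complex.Im z * complex.Im w.
Proof. by case: z; case: w. Qed.

Lemma Im_mul z w :
  complex.Im (z * w) = complex.Re z * complex.Im w + complex.Im z * complex.Re w.
Proof. by case: z; case: w. Qed.

Lemma Re_sum n (F : nat -> R[i]) :
  complex.Re (\sum_(k < n) F k) = \sum_(k < n) complex.Re (F k).
Proof. by apply: (big_morph (@complex.Re R)) => // -[? ?] [? ?]. Qed.

Lemma Im_sum n (F : nat -> R[i]) :
  complex.Im (\sum_(k < n) F k) = \sum_(k < n) complex.Im (F k).
Proof. by apply: (big_morph (@complex.Im R)) => // -[? ?] [? ?]. Qed.

End complex_parts.

Section counting.
Context {R : realType} {d : measure_display} {Omega : measurableType d}.
Variables (P : probability Omega R) (X : nat -> {RV P >-> R}).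
Hypothesis X01 : forall n w, (0 < n)%N -> X n w = 0 \/ X n w = 1.

Lemma partial_sum_cnt w m : \sum_(1 <= i < m.+1) X i w = (cnt (bits X w) m)%:R.
Proof.
rewrite big_add1 big_mkord /cnt natr_sum; apply: eq_bigr => k _.
by rewrite natr_bits.
Qed.

(** If bit k is a one, the partial sums reach cnt x k + 1 for the first time
    at k + 1. *)
Lemma counting_functionE w k : bits X w k ->
  counting_function X w (cnt (bits X w) k).+1 = k.+1.
Proof.
move=> xk; have ck : cnt (bits X w) k.+1 = (cnt (bits X w) k).+1.
  by rewrite cntS xk addn1.
have late j : cnt (bits X w) j = (cnt (bits X w) k).+1 -> (k < j)%N.
  move=> cj; rewrite ltnNge; apply/negP => /(cnt_leq (bits X w)).
  by rewrite cj ltnn.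
apply: xget_unique => [|m [hm minm]].
  split; first by rewrite partial_sum_cnt ck.
  by move=> j /eqP; rewrite partial_sum_cnt eqr_nat => /eqP/late.
apply/eqP; rewrite eqn_leq minm ?partial_sum_cnt ?ck//=.
by apply: late; move/eqP: hm; rewrite partial_sum_cnt eqr_nat => /eqP.
Qed.

Lemma sum_counting (V : zmodType) w (F : nat -> nat -> V) M :
  \sum_(1 <= n < (cnt (bits X w) M).+1) F n (counting_function X w n) =
  \sum_(k < M) (if bits X w k then F (cnt (bits X w) k).+1 k.+1 else 0).
Proof.
elim: M => [|M IH]; first by rewrite big_ord0 [cnt _ _]big_ord0 big_geq.
rewrite big_ord_recr /= -IH cntS; case xM : (bits X w M); last by rewrite addn0 addr0.
by rewrite addn1 big_nat_recr//= counting_functionE.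
Qed.

End counting.

Section dynamics.
Context {R : realType} {d : measure_display} {Y : measurableType d}.
Variables (mu : probability Y R) (T : Y -> Y).

(** Over an invariant set, f has the same integral as its conditional
    expectation, which vanishes. *)
Lemma zero_mean_of_cond_exp (f g : Y -> R) : L1 mu f ->
  is_real_cond_exp mu (invariant_sets T) f g -> {ae mu, forall y, g y = 0} ->
  zero_mean mu T f.
Proof.
move=> f1 [g1 _ hg] g0 A mA TA.
have -> : \int[mu]_y (f y * \1_A y) = \int[mu]_(y in A) f y.
  rewrite [RHS]Rintegral_mkcond; congr Rintegral; apply/funext => y.
  by rewrite patchE indicE; case: ifP; rewrite ?mulr1 ?mulr0.
rewrite /Rintegral -hg; last by split.
rewrite (ae_eq_integral (cst 0%E)) ?integral0//.
  by apply: (measurable_funS measurableT) => //; case/integrableP: g1.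
by apply: filterS g0 => y -> _.
Qed.

End dynamics.

Section averages.
Context {R : realType} {d : measure_display} {Omega : measurableType d}.
Context {d' : measure_display} {Y : measurableType d'}.
Variables (P : probability Omega R) (X : nat -> {RV P >-> R}).
Hypothesis X01 : forall n w, (0 < n)%N -> X n w = 0 \/ X n w = 1.
Variables (T : Y -> Y) (B : set (nat -> R[i])).

Definition real_part (b : nat -> R[i]) (n : nat) : R := complex.Re (b n).
Definition imag_part (b : nat -> R[i]) (n : nat) : R := complex.Im (b n).
Definition parts : set (nat -> R) := (real_part @` B) `|` (imag_part @` B).

Lemma modulus_weighted_average w (b : nat -> R[i]) (f : Y -> R[i]) M y :
  modulus (weighted_average b (counting_function X w) T f (cnt (bits X w) M) y) <=
  (cnt (bits X w) M)%:R^-1 *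
  (`|weighted_sum T (bits X w) (real_part b) (fun y => complex.Re (f y)) M y| +
   `|weighted_sum T (bits X w) (imag_part b) (fun y => complex.Im (f y)) M y| +
   (`|weighted_sum T (bits X w) (real_part b) (fun y => complex.Im (f y)) M y| +
    `|weighted_sum T (bits X w) (imag_part b) (fun y => complex.Re (f y)) M y|)).
Proof.
set x := bits X w; set fr := fun y => complex.Re (f y).
set fi := fun y => complex.Im (f y).
rewrite /weighted_average modulusM modulus_natV.
rewrite ler_wpM2l ?invr_ge0//.
rewrite (sum_counting X01 w (fun n m => b n * f (iter m T y))) -/x.
apply: le_trans (modulus_le _) _.
rewrite (Re_sum M (fun k => if x k then b (cnt x k).+1 * f (iter k.+1 T y) else 0)).
rewrite (Im_sum M (fun k => if x k then b (cnt x k).+1 * f (iter k.+1 T y) else 0)).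
apply: lerD.
  have -> : \sum_(k < M) complex.Re (if x k then b (cnt x k).+1 * f (iter k.+1 T y) else 0) =
     weighted_sum T x (real_part b) fr M y - weighted_sum T x (imag_part b) fi M y.
    rewrite -sumrB; apply: eq_bigr => k _; case: (x k); last by rewrite !mul0r subr0.
    by rewrite Re_mul !mul1r.
  exact: ler_normB.
have -> : \sum_(k < M) complex.Im (if x k then b (cnt x k).+1 * f (iter k.+1 T y) else 0) =
   weighted_sum T x (real_part b) fi M y + weighted_sum T x (imag_part b) fr M y.
  rewrite -big_split /=; apply: eq_bigr => k _; case: (x k); last by rewrite !mul0r addr0.
  by rewrite Im_mul !mul1r.
exact: ler_normD.
Qed.

Lemma sup_average_cvg0 w (f : Y -> R[i]) y :
  (forall N, exists M, cnt (bits X w) M = N) ->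
  uniformly_negligible T (bits X w) parts (fun y => complex.Re (f y)) y ->
  uniformly_negligible T (bits X w) parts (fun y => complex.Im (f y)) y ->
  sup_average B (counting_function X w) T f N y @[N --> \oo] --> (0 : R).
Proof.
set x := bits X w => surj hr hi; apply/cvgrPdist_le => e e0.
have e40 : 0 < e / 4 by rewrite divr_gt0.
have [Nr hNr] := hr _ e40; have [Ni hNi] := hi _ e40.
near=> N; have [M cM] := surj N.
have N0 : (0 < N)%N by near: N; exact: nbhs_infty_gt.
have NNr : (Nr <= cnt x M)%N by rewrite cM; near: N; exact: nbhs_infty_ge.
have NNi : (Ni <= cnt x M)%N by rewrite cM; near: N; exact: nbhs_infty_ge.
have bnd b : B b -> modulus (weighted_average b (counting_function X w) T f N y) <= e.
  move=> Bb; have rb : parts (real_part b) by left; exists b.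
  have ib : parts (imag_part b) by right; exists b.
  have N0' : 0 < N%:R :> R by rewrite ltr0n.
  rewrite -cM; apply: le_trans (modulus_weighted_average w b f M y) _.
  rewrite -/x ler_pdivrMl ?cM//.
  have h1 := hNr M NNr _ rb; have h2 := hNr M NNr _ ib.
  have h3 := hNi M NNi _ rb; have h4 := hNi M NNi _ ib.
  rewrite cM in h1 h2 h3 h4.
  have -> : N%:R * e = e / 4 * N%:R + e / 4 * N%:R + (e / 4 * N%:R + e / 4 * N%:R) by field.
  by apply: lerD; apply: lerD.
rewrite sub0r normrN /sup_average.
have [[b Bb]|B0] := pselect (B !=set0); last first.
  have -> : B = set0 by apply/seteqP; split => // b Bb; apply: B0; exists b.
  by rewrite image_set0 sup0 normr0 ltW.
set S := [set _ | _ in _].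
have S0 : S !=set0 by exists (modulus (weighted_average b (counting_function X w) T f N y)); exists b.
have Sub : ubound S e by move=> _ [c Bc <-]; exact: bnd.
rewrite ger0_norm; first exact: ge_sup.
apply: le_trans (modulus_ge0 (weighted_average b (counting_function X w) T f N y)) _.
by apply: ub_le_sup; [exists e|exists b].
Unshelve. all: by end_near. Qed.

End averages.

(** * Approximating lists and the theorem *)

Section approximating_lists.
Context {R : realType}.
Variable B : set (nat -> R[i]).
Hypothesis hB1 : forall b n, B b -> (0 < n)%N -> modulus (b n) <= 1.

(** The constant weight 1 is added for the sake of the weak type inequality,
    which needs the correlations without weights. *)
Definition approximants (BN : {fset (nat -> R[i])}) : seq (nat -> R) :=
  (fun=> 1) :: [seq real_part b | b <- BN] ++ [seq imag_part b | b <- BN].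

Lemma mem_approximantsP BN c : c \in approximants BN ->
  c = (fun=> 1) \/ exists2 b, b \in BN & c = real_part b \/ c = imag_part b.
Proof.
rewrite inE mem_cat => /or3P[/eqP->|/mapP[b bB ->]|/mapP[b bB ->]]; first by left.
  by right; exists b => //; left.
by right; exists b => //; right.
Qed.

Lemma real_part_in BN b : b \in BN -> real_part b \in approximants BN.
Proof. by move=> bB; rewrite inE mem_cat map_f ?orbT. Qed.

Lemma imag_part_in BN b : b \in BN -> imag_part b \in approximants BN.
Proof. by move=> bB; rewrite inE mem_cat [X in _ || X]orbC map_f ?orbT. Qed.

Lemma size_approximants BN : size (approximants BN) = (1 + 2 * #|` BN|)%N.
Proof. by rewrite /approximants /= size_cat !size_map mul2n addnn. Qed.

Lemma parts_le1 c n : parts B c -> (0 < n)%N -> `|c n| <= 1.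
Proof.
move=> [[b Bb <-]|[b Bb <-]] n0; apply: le_trans (hB1 Bb n0).
  exact: modulus_Re.
exact: modulus_Im.
Qed.

Lemma approximants_le1 (BN : {fset (nat -> R[i])}) c n :
  [set` BN] `<=` B -> c \in approximants BN -> (0 < n)%N -> `|c n| <= 1.
Proof.
move=> BNB /mem_approximantsP[->|[b bBN hc]] n0; first by rewrite normr1.
by apply: parts_le1 => //; case: hc => ->; [left|right]; exists b => //; exact: BNB.
Qed.

Lemma approximants_close (BN : {fset (nat -> R[i])}) N (q : R) c :
  (forall b, B b -> exists b0, b0 \in BN /\
    \big[Num.max/0]_(1 <= t < N.+1) modulus (b t - b0 t) <= q) ->
  parts B c ->
  exists2 c0, c0 \in approximants BN & forall t, (0 < t <= N)%N -> `|c t - c0 t| <= q.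
Proof.
move=> hBN.
have aux b b0 t : \big[Num.max/0]_(1 <= t < N.+1) modulus (b t - b0 t) <= q ->
    (0 < t <= N)%N -> modulus (b t - b0 t) <= q.
  move=> h tN; apply: le_trans h.
  by apply: (@le_bigmax_seq _ _ _ (index_iota 1 N.+1) 0 t xpredT
    (fun t => modulus (b t - b0 t))) => //; rewrite mem_index_iota.
case=> -[b Bb <-]; have [b0 [b0N hb0]] := hBN b Bb.
- exists (real_part b0); first exact: real_part_in.
  move=> t tN; rewrite /real_part -Re_sub; apply: le_trans (modulus_Re _) _.
  exact: aux.
- exists (imag_part b0); first exact: imag_part_in.
  move=> t tN; rewrite /imag_part -Im_sub; apply: le_trans (modulus_Im _) _.
  exact: aux.
Qed.

End approximating_lists.

Theorem theorem1p4 (R : realType) (alpha : R)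
    (d : measure_display) (Omega : measurableType d) (P : probability Omega R)
    (X : nat -> {RV P >-> R}) (B : set (nat -> R[i]))
    (halpha0 : 0 < alpha) (halpha : alpha < 2^-1)
    (hX01 : forall n w, (0 < n)%N -> X n w = 0 \/ X n w = 1)
    (hXind : mutually_independent [set n | (0 < n)%N] X)
    (hXexp : forall n, (0 < n)%N -> ('E_P[X n] = (n%:R `^ (- alpha))%:E)%E)
    (hBapprox : approximable B)
    (hB1 : forall b n, B b -> (0 < n)%N -> modulus (b n) <= 1) :
  {ae P, forall w,
    forall (d' : measure_display) (Y : measurableType d')
      (mu : probability Y R) (T : Y -> Y) (f : Y -> R[i]),
      measure_preserving mu T ->
      complex_integrable mu f ->
      orthogonal_to_invariant mu T f ->
      {ae mu, forall y,
        sup_average B (counting_function X w) T f N y @[N --> \oo] --> (0 : R)}}.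
Proof.
have a01 : 0 < alpha < 2^-1 by rewrite halpha0.
(* Lists of size exp (M^(gain/2)) are negligible against the deviation bounds exp (- c M^gain). *)
have delta0 : 0 < gain alpha / 2 by rewrite divr_gt0// gain_gt0.
have [kappa [kappa0 [Cd [Ck [N1 _ hBN]]]]] := hBapprox _ delta0.
have hBN' N : exists F : {fset (nat -> R[i])},
    if (N1 <= N)%N then
      [/\ [set` F] `<=` B, #|` F|%:R <= Cd * expR (N%:R `^ (gain alpha / 2)) &
        forall b, B b -> exists b0, b0 \in F /\
          \big[Num.max/0]_(1 <= t < N.+1) modulus (b t - b0 t)
            <= Ck * N%:R `^ (- kappa)]
    else F = fset0.
  by case: leqP => [h|_]; [exact: hBN|exists fset0].
have [BN hBNN] := choice hBN'.
have BNB N : [set` BN N] `<=` B.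
  have := hBNN N; case: leqP => _; first by case.
  by move=> -> b /=; rewrite inE.
pose L N := approximants (BN N).
have L1 M b : b \in L M -> forall n, (0 < n)%N -> `|b n| <= 1.
  by move=> bL n; exact: (approximants_le1 hB1 (@BNB M) bL).
have Lone M : (fun=> 1) \in L M by exact: mem_head.
pose A : R := 1 + 2 * `|Cd|.
have A0 : 0 <= A by rewrite addr_ge0// mulr_ge0.
have Lsize : \forall M \near \oo,
    (size (L M))%:R <= expR (A + A * M%:R `^ (gain alpha / 2)).
  exists N1 => // M; rewrite [X in X -> _]/= => NM; have := hBNN M; rewrite NM => -[_ h _].
  rewrite /L size_approximants natrD natrM.
  set z := M%:R `^ _ in h *; have z0 : 0 <= z by exact: powR_ge0.
  have e1 : 1 <= expR z by rewrite -expR0 ler_expR.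
  have C0 : 0 <= `|Cd| by [].
  apply: (@le_trans _ _ (expR (2 * `|Cd|) * expR z)).
    apply: (@le_trans _ _ ((1 + 2 * `|Cd|) * expR z)).
      have := ler_wpM2r (expR_ge0 z) (ler_norm Cd).
      by move: (expR z) e1 h => ez e1 h h'; nra.
    by rewrite ler_wpM2r ?expR_ge0// expR_ge1Dx.
  rewrite -expRD ler_expR /A; nra.
have XE k : ('E_P[X k.+1] = (sigma alpha k)%:E)%E by rewrite hXexp.
apply: filterS (ae_typical a01 hX01 hXind XE A0 L1 Lsize) => w [N2 _ typ].
move=> d' Y mu T f hT [fr fi] [g [[gr gi] g0]].
pose M0 := maxn N1 N2.
have typ0 M : (M0 <= M)%N -> typical alpha (L M) M (bits X w).
  by move=> /(leq_trans (leq_maxr _ _)); exact: typ.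
have GL M : (M0 <= M)%N -> forall b, parts B b -> exists2 b0, b0 \in L M &
    forall t, (0 < t <= M)%N -> `|b t - b0 t| <= Ck * M%:R `^ (- kappa).
  move=> /(leq_trans (leq_maxl _ _)) NM b Gb; have := hBNN M; rewrite NM => -[_ _ h].
  exact: approximants_close h Gb.
have Zr : zero_mean mu T (fun y => complex.Re (f y)).
  by apply: zero_mean_of_cond_exp fr gr _; apply: filterS g0 => y ->.
have Zi : zero_mean mu T (fun y => complex.Im (f y)).
  by apply: zero_mean_of_cond_exp fi gi _; apply: filterS g0 => y ->.
have negl h (h1 : mu.-integrable setT (EFin \o h)) (h0 : zero_mean mu T h) :=
  ae_uniformly_negligible hT a01 typ0 Lone L1 kappa0
    (fun b Gb n => @parts_le1 _ _ hB1 b n Gb) GL h1 h0.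
apply: filterS2 (negl _ fr Zr) (negl _ fi Zi) => y hr hi.
exact: (sup_average_cvg0 hX01 (cnt_surjective a01 typ0) hr hi).
Qed.
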